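(* Let $m\in\mathbb{R}$ and let $\sigma\in M^{m}_{\rho,\Lambda}(\mathbb{Z}^n\times\mathbb{T}^n)$ be $M$-elliptic. Then $T_{\sigma,0}=T_{\sigma,1}$, i.e. the minimal and the maximal operators of $T_\sigma$ on $\ell^2(\mathbb{Z}^n)$ coincide.
   Context: Write $\mathbb{T}^n=\mathbb{R}^n/\mathbb{Z}^n$ and $\mathbb{N}_0=\{0,1,2,\dots\}$. For $f$ on $\mathbb{Z}^n$ set $\Delta_{k_j}f(k)=f(k+e_j)-f(k)$ ($e_j$ the $j$-th unit vector) and $\Delta_k^\alpha=\Delta_{k_1}^{\alpha_1}\cdots\Delta_{k_n}^{\alpha_n}$ for $\alpha\in\mathbb{N}_0^n$. On smooth functions on $\mathbb{T}^n$ set $D_x^{(\beta)}=D_{x_1}^{(\beta_1)}\cdots D_{x_n}^{(\beta_n)}$, where $D_{x_j}^{(0)}=I$ and $D_{x_j}^{(\ell)}=\prod_{m=0}^{\ell-1}\big(\frac{1}{2\pi i}\frac{\partial}{\partial x_j}-m\big)$ for $\ell\ge1$. Write $k^\gamma=k_1^{\gamma_1}\cdots k_n^{\gamma_n}$. Weight function: $\Lambda:\mathbb{Z}^n\to(0,\infty)$ is a weight function if there are positive constants $\mu_0\le\mu_1\le\mu$ and $C_0,C_1$ with $C_0(1+|k|)^{\mu_0}\le\Lambda(k)\le C_1(1+|k|)^{\mu_1}$ for all $k\in\mathbb{Z}^n$, and for all $\alpha\in\mathbb{N}_0^n$, $\gamma\in\{0,1\}^n$ there is $C_{\alpha,\gamma}>0$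 with $|k^\gamma\Delta_k^{\alpha+\gamma}\Lambda(k)|\le C_{\alpha,\gamma}\Lambda(k)^{1-|\alpha|/\mu}$ for all $k\in\mathbb{Z}^n$. Fix such a $\Lambda$ (with its constants) and $\rho\in(0,1/\mu]$. Symbol classes: for $m\in\mathbb{R}$, $S^m_{\rho,\Lambda}(\mathbb{Z}^n\times\mathbb{T}^n)$ is the set of $\sigma:\mathbb{Z}^n\times\mathbb{T}^n\to\mathbb{C}$, smooth in $x$ for every $k$, such that for all $\alpha,\beta\in\mathbb{N}_0^n$ there is a constant $C>0$ with $|D_x^{(\beta)}\Delta_k^\alpha\sigma(k,x)|\le C\Lambda(k)^{m-\rho|\alpha|}$ for all $(k,x)$. $M^m_{\rho,\Lambda}(\mathbb{Z}^n\times\mathbb{T}^n)$ is the set of $\sigma:\mathbb{Z}^n\times\mathbb{T}^n\to\mathbb{C}$, smooth in $x$ for every $k$, such that $k^\gamma\Delta_k^\gamma\sigma(k,x)\in S^m_{\rho,\Lambda}(\mathbb{Z}^n\times\mathbb{T}^n)$ for all $\gamma\in\{0,1\}^n$. Operators: $\mathcal{S}(\mathbb{Z}^n)$ is the space of rapidly decreasing functions on $\mathbb{Z}^n$. For $f\in\mathcal{S}(\mathbb{Z}^n)$ put $\widehat f(x)=\sum_{k\in\mathbb{Z}^n}e^{-2\pi i k\cdot x}f(k)$ and $T_\sigma f(k)=\int_{\mathbb{T}^n}e^{2\pi i k\cdot x}\sigma(k,x)\widehat f(x)\,dx$. The formal adjoint $T_\sigma^*:\mathcal{S}(\mathbb{Z}^n)\to\mathcal{S}(\mathbb{Z}^n)$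 is determined by $\langle T_\sigma f,g\rangle=\langle f,T_\sigma^*g\rangle$ for $f,g\in\mathcal{S}(\mathbb{Z}^n)$, with $\langle\cdot,\cdot\rangle$ the $\ell^2(\mathbb{Z}^n)$ inner product. $M$-ellipticity: $\sigma\in M^m_{\rho,\Lambda}(\mathbb{Z}^n\times\mathbb{T}^n)$ is $M$-elliptic if there are positive constants $C,R_1$ with $|\sigma(k,x)|\ge C\Lambda(k)^m$ for all $x\in\mathbb{T}^n$ and all $k\in\mathbb{Z}^n$ with $|k|\ge R_1$. Minimal operator: $T_\sigma$, viewed as an operator in $\ell^2(\mathbb{Z}^n)$ with domain $\mathcal{S}(\mathbb{Z}^n)$, is closable, and $T_{\sigma,0}$ is its closure: $\mathrm{Dom}(T_{\sigma,0})$ consists of all $g\in\ell^2(\mathbb{Z}^n)$ for which there is a sequence $(\phi_j)$ in $\mathcal{S}(\mathbb{Z}^n)$ with $\phi_j\to g$ and $T_\sigma\phi_j\to f$ in $\ell^2(\mathbb{Z}^n)$ for some $f\in\ell^2(\mathbb{Z}^n)$; then $T_{\sigma,0}g=f$. Maximal operator: for $f,g\in\ell^2(\mathbb{Z}^n)$, $g\in\mathrm{Dom}(T_{\sigma,1})$ and $T_{\sigma,1}g=f$ if and only if $\langle g,T_\sigma^*\psi\rangle=\langle f,\psi\rangle$ for all $\psi\in\mathcal{S}(\mathbb{Z}^n)$. *)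

(* Defs.v *)
From HB Require Import structures.
From mathcomp Require Import all_boot all_order all_algebra.
From mathcomp Require Import complex.
From mathcomp Require Import all_classical all_reals all_analysis.
Import Order.TTheory GRing.Theory Num.Theory.
Import numFieldNormedType.Exports.
Import ComplexField.Normc.

Set Implicit Arguments.
Unset Strict Implicit.
Unset Printing Implicit Defensive.

Local Open Scope classical_set_scope.
Local Open Scope complex_scope.
Local Open Scope ring_scope.

(* Z^n is 'rV[int]_n.  A function on T^n = R^n / Z^n is a function on 'rV[R]_n
   that is 1-periodic in each coordinate (predicate [zperiodic] below).
   Multi-indices in N_0^n are functions 'I_n -> nat, those in {0,1}^n are
   functions 'I_n -> bool, read as multi-indices through [nat_of_bool]. *)

Section Lattice.
Context {R : realType} {n : nat}.
Implicit Types (k : 'rV[int]_n) (a : 'I_n -> nat).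

Definition mlen a : nat := (\sum_j a j)%N.

Definition madd a (b : 'I_n -> nat) : 'I_n -> nat := fun j => (a j + b j)%N.

Definition mind (g : 'I_n -> bool) : 'I_n -> nat := fun j => nat_of_bool (g j).

Definition monom k a : int := \prod_j k 0 j ^+ a j.

Definition eucl k : R := Num.sqrt (\sum_j (k 0 j)%:~R ^+ 2).

Definition dot k (x : 'rV[R]_n) : R := \sum_j (k 0 j)%:~R * x 0 j.

Definition diff1 (V : zmodType) (j : 'I_n) (f : 'rV[int]_n -> V) :
  'rV[int]_n -> V := fun k => f (k + delta_mx 0 j) - f k.

Definition Delta (V : zmodType) a (f : 'rV[int]_n -> V) : 'rV[int]_n -> V :=
  foldr (fun j g => iter (a j) (diff1 j) g) f (enum 'I_n).

End Lattice.

Section Torus.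
Context {R : realType}.

Definition zperiodic n (T : Type) (u : 'rV[R]_n -> T) : Prop :=
  forall (x : 'rV[R]_n) (j : 'I_n), u (x + delta_mx 0 j) = u x.

Fixpoint Cr n (r : nat) (u : 'rV[R]_n -> R) : Prop :=
  match r with
  | 0%N => continuous u
  | r'.+1 => continuous u /\
      forall j : 'I_n, (forall x, derivable u x (delta_mx 0 j)) /\
        Cr r' (fun x => 'D_(delta_mx 0 j) u x)
  end.

Definition smooth n (u : 'rV[R]_n -> R[i]) : Prop :=
  forall r, Cr r (fun x => complex.Re (u x)) /\ Cr r (fun x => complex.Im (u x)).

Definition cpartial n (j : 'I_n) (u : 'rV[R]_n -> R[i]) : 'rV[R]_n -> R[i] :=
  fun x => ('D_(delta_mx 0 j) (fun y => complex.Re (u y)) x)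
        +i* ('D_(delta_mx 0 j) (fun y => complex.Im (u y)) x).

Fixpoint Dfact1 n (j : 'I_n) (l : nat) (u : 'rV[R]_n -> R[i]) :
    'rV[R]_n -> R[i] :=
  match l with
  | 0%N => u
  | m.+1 => fun x => (0 +i* (2 * pi))^-1 * cpartial j (Dfact1 j m u) x
                     - m%:R * Dfact1 j m u x
  end.

Definition Dfact n (b : 'I_n -> nat) (u : 'rV[R]_n -> R[i]) :
    'rV[R]_n -> R[i] :=
  foldr (fun j v => Dfact1 j (b j) v) u (enum 'I_n).

(* Integral over T^n, as an iterated Lebesgue integral over [0, 1]^n. *)
Fixpoint torus_Rint n : ('rV[R]_n -> R) -> R :=
  match n with
  | 0%N => fun u => u 0
  | n'.+1 => fun u =>
      Rintegral (@lebesgue_measure R) `[0%R, 1%R]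
        (fun t => torus_Rint (fun y : 'rV[R]_n' => u (row_mx (t%:M : 'M[R]_1) y)))
  end.

Definition torus_int n (u : 'rV[R]_n -> R[i]) : R[i] :=
  torus_Rint (fun x => complex.Re (u x)) +i* torus_Rint (fun x => complex.Im (u x)).

Definition expi (t : R) : R[i] := cos t +i* sin t.

End Torus.

Section Sums.
Context {R : realType} {I : choiceType}.

(* Unordered sum of an absolutely summable family: positive part minus
   negative part, and real and imaginary parts separately. The value is
   meaningful only when the family is absolutely summable, which holds wherever
   it is used below. *)
Definition rsum (f : I -> R) : R :=
  fine (\esum_(k in [set: I]) (Num.max (f k) 0)%:E)
  - fine (\esum_(k in [set: I]) (Num.max (- f k) 0)%:E).

Definition csum (f : I -> R[i]) : R[i] :=
  rsum (fun k => complex.Re (f k)) +i* rsum (fun k => complex.Im (f k)).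

Definition l2sq (f : I -> R[i]) : \bar R :=
  \esum_(k in [set: I]) (normc (f k) ^+ 2)%:E.

Definition l2 (f : I -> R[i]) : Prop := (l2sq f < +oo)%E.

Definition l2inner (f g : I -> R[i]) : R[i] := csum (fun k => f k * conjc (g k)).

Definition l2cvg (u : nat -> I -> R[i]) (f : I -> R[i]) : Prop :=
  (fun j => l2sq (fun k => u j k - f k)) @ \oo --> 0%E.

End Sums.

Section Symbols.
Context {R : realType} {n : nat}.
Implicit Types (Lambda : 'rV[int]_n -> R)
  (sigma : 'rV[int]_n -> 'rV[R]_n -> R[i]).

Definition weight_function Lambda (mu0 mu1 mu C0 C1 : R) : Prop :=
  [/\ forall k, 0 < Lambda k,
      [/\ 0 < mu0, mu0 <= mu1 & mu1 <= mu],
      0 < C0 /\ 0 < C1,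
      forall k, C0 * (1 + eucl k) `^ mu0 <= Lambda k
                /\ Lambda k <= C1 * (1 + eucl k) `^ mu1
    & forall (a : 'I_n -> nat) (g : 'I_n -> bool), exists2 C : R, 0 < C &
        forall k, `|(monom k (mind g))%:~R * Delta (madd a (mind g)) Lambda k|
                  <= C * Lambda k `^ (1 - (mlen a)%:R / mu)].

Definition symbS Lambda (rho m : R) sigma : Prop :=
  (forall k, zperiodic (sigma k) /\ smooth (sigma k)) /\
  forall a b : 'I_n -> nat, exists2 C : R, 0 < C &
    forall k x,
      normc (Dfact b (fun y => Delta a (fun l => sigma l y) k) x)
      <= C * Lambda k `^ (m - rho * (mlen a)%:R).

Definition symbM Lambda (rho m : R) sigma : Prop :=
  (forall k, zperiodic (sigma k) /\ smooth (sigma k)) /\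
  forall g : 'I_n -> bool,
    symbS Lambda rho m
      (fun k x => (monom k (mind g))%:~R
                  * Delta (mind g) (fun l => sigma l x) k).

Definition M_elliptic Lambda (m : R) sigma : Prop :=
  exists C R1 : R, [/\ 0 < C, 0 < R1 &
    forall k x, R1 <= eucl k -> C * Lambda k `^ m <= normc (sigma k x)].

End Symbols.

Section Operators.
Context {R : realType} {n : nat}.
Local Notation fctZ := ('rV[int]_n -> R[i]).
Implicit Types (f g : fctZ) (sigma : 'rV[int]_n -> 'rV[R]_n -> R[i])
  (T A : fctZ -> fctZ).

Definition schwartz f : Prop :=
  forall N : nat, exists C : R, forall k, (1 + eucl k) ^+ N * normc (f k) <= C.

Definition fourier f : 'rV[R]_n -> R[i] :=
  fun x => csum (fun k => expi (- (2 * pi * dot k x)) * f k).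

Definition pdo sigma : fctZ -> fctZ :=
  fun f k => torus_int (fun x => expi (2 * pi * dot k x) * sigma k x * fourier f x).

Definition is_formal_adjoint T A : Prop :=
  (forall f, schwartz f -> schwartz (A f)) /\
  forall f g, schwartz f -> schwartz g -> l2inner (T f) g = l2inner f (A g).

(* Definite description: two operators satisfying [is_formal_adjoint T] agree
   on S(Z^n); the value is unspecified when there is none. *)
Definition formal_adjoint T : fctZ -> fctZ :=
  xget (idfun : {classic fctZ -> fctZ}) [set A | is_formal_adjoint T A].

(* Operators in l^2(Z^n) are represented by their graphs, as sets of pairs
   (g, f) meaning: g is in the domain and is mapped to f. *)
Definition minimal_op sigma : set (fctZ * fctZ) :=
  [set gf | [/\ l2 gf.1, l2 gf.2 &
    exists phi : nat -> fctZ,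
      [/\ forall j, schwartz (phi j), l2cvg phi gf.1
        & l2cvg (fun j => pdo sigma (phi j)) gf.2]]].

Definition maximal_op sigma : set (fctZ * fctZ) :=
  [set gf | [/\ l2 gf.1, l2 gf.2 &
    forall psi, schwartz psi ->
      l2inner gf.1 (formal_adjoint (pdo sigma) psi) = l2inner gf.2 psi]].

End Operators.

(* Main.v *)
Require Import Defs.
From mathcomp Require Import all_boot all_order all_algebra.
From mathcomp Require Import finmap complex.
From mathcomp Require Import all_classical all_reals all_analysis.
From mathcomp Require Import ring lra zify.
Import Order.TTheory GRing.Theory Num.Theory.
Import numFieldNormedType.Exports.
Import ComplexField.Normc.
Set Implicit Arguments.
Unset Strict Implicit.
Unset Printing Implicit Defensive.
Local Open Scope classical_set_scope.
Local Open Scope complex_scope.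
Local Open Scope ring_scope.

(** Expanding in Fourier series in the second variable, the operator with symbol
    [sigma] acts on sequences by the infinite matrix with entries
    [entry k l = fcoef (sigma k) (l - k)], where [fcoef (sigma k)] denotes the
    Fourier coefficients of [sigma k]. The symbol estimates say that the entries
    are of size [Lambda k `^ m] and decay rapidly off the diagonal, and that the
    Fourier coefficients change slowly with [k]. By an inequality of Peetre's
    type ([Lambda_powR]) powers of [Lambda] can be moved from [k] to [l] at the
    cost of a power of [1 + |k - l|], which the decay absorbs; so
    such matrices are controlled by convolution with a fixed summable function
    and are bounded on weighted square-summable sequences by Young's inequality
    ([young]).

    The conjugate transpose of the matrix preserves rapidly decreasing
    sequences, so it is the formal adjoint. Passing to the limit in the adjoint
    relation shows that the minimal operator is contained in the maximal one
    ([minimal_sub_maximal]). Conversely, testing against point masses shows that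
    [(g, f)] belongs to the maximal operator only if [f] is the matrix applied
    to [g]. The heart of the matter is elliptic regularity ([regularity]): then
    [Lambda `^ m g] is square summable. Granting this, the truncations of [g] to
    finite sets converge to [g] even with the weight [Lambda `^ m], hence their
    images converge to [f], and [(g, f)] lies in the minimal operator
    ([maximal_sub_minimal]).

    Regularity is proved with a parametrix of first order only. At a point [k]
    where ellipticity holds, freeze the first variable of the symbol at [k]. The
    frozen operator is multiplication by the function [sigma k] on the torus, so
    it is inverted exactly by the Fourier coefficients of [1 / sigma k]
    ([frozen_inverse]), which by ellipticity are of size [Lambda k `^ (- m)] and
    decay rapidly ([inv_sigma_coef]). Unfreezing costs an error of relative
    order [- rho] ([freeze_error]). Therefore, if [Lambda `^ s g] is square
    summable, so is [Lambda `^ t g] for [t <= m] and [t <= s + rho]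
    ([regularity_step]); finitely many steps lead to [t = m].

    The Fourier analysis is kept elementary. Functions on the torus are bounded
    and Lipschitz, and the only property of the integral beyond linearity and
    monotonicity is translation invariance. Translating by half a period of a
    character gives orthogonality and, applied to iterated finite differences,
    the decay of coefficients ([fcoef_decay]); bounds on differences pass to
    reciprocals by algebra ([FD_inv]) and follow from bounds on derivatives by
    the mean value inequality ([FD_smooth]). Fourier inversion ([fser_fcoef])
    rests on uniqueness of coefficients, obtained from Fejer's kernel in one
    variable and by slicing in several ([uniqueness]). *)

(** * Absolutely summable real families *)

Section RealSums.
Context {R : realType}.
Implicit Types (I J : choiceType).

Definition asum I (f : I -> R) : Prop :=
  (\esum_(k in [set: I]) (`|f k|)%:E < +oo)%E.

Lemma asum_le I (f g : I -> R) :
  (forall k, `|f k| <= g k) -> asum g -> asum f.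
Proof.
move=> fg; apply: le_lt_trans; apply: le_esum => i _.
by rewrite lee_fin (le_trans (fg i)) ?ler_norm.
Qed.

Lemma asum_abs I (f : I -> R) : asum f -> asum (fun k => `|f k|).
Proof. by apply: le_lt_trans; apply: le_esum => i _; rewrite normr_id. Qed.

Lemma asumD I (f g : I -> R) : asum f -> asum g -> asum (fun k => f k + g k).
Proof.
move=> hf hg; apply: (@le_lt_trans _ _
  (\esum_(k in [set: I]) (`|f k|%:E + `|g k|%:E))%E).
  by apply: le_esum => i _; rewrite -EFinD lee_fin ler_normD.
by rewrite esumD ?lte_add_pinfty.
Qed.

Lemma le_esumZ I (c : R) (a : I -> R) : 0 <= c -> (forall i, 0 <= a i) ->
  (\esum_(i in [set: I]) (c * a i)%:E <= c%:E * \esum_(i in [set: I]) (a i)%:E)%E.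
Proof.
move=> c0 a0; apply: ge_ereal_sup => _ [X [finX _] <-].
under eq_fsbigr do rewrite EFinM.
rewrite -ge0_mule_fsumr => [|i]; last by rewrite lee_fin.
apply: lee_wpmul2l; first by rewrite lee_fin.
by apply: ereal_sup_ubound; exists X.
Qed.

Lemma esumZ I (c : R) (a : I -> R) : 0 <= c -> (forall i, 0 <= a i) ->
  (\esum_(i in [set: I]) (c * a i)%:E = c%:E * \esum_(i in [set: I]) (a i)%:E)%E.
Proof.
rewrite le_eqVlt => /predU1P[<- a0|c0 a0].
  by rewrite mul0e esum1// => i _; rewrite mul0r.
apply/eqP; rewrite eq_le le_esumZ ?(ltW c0)//=.
have ac0 i : 0 <= c * a i by rewrite mulr_ge0 // ltW.
have := @le_esumZ I c^-1 _ _ ac0; rewrite invr_ge0 ltW// => /(_ isT) h.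
have {}h : (c%:E * (\esum_(i in [set: I]) (a i)%:E) <=
   c%:E * ((c^-1)%:E * \esum_(i in [set: I]) (c * a i)%:E))%E.
  apply: lee_wpmul2l; first by rewrite lee_fin ltW.
  apply: le_trans h; apply: le_esum => i _.
  by rewrite mulrA mulVf ?mul1r ?gt_eqF.
by apply: le_trans h _; rewrite muleA -EFinM divff ?mul1e ?gt_eqF.
Qed.

Lemma asumZ I (c : R) (f : I -> R) : asum f -> asum (fun k => c * f k).
Proof.
move=> hf; rewrite /asum.
under eq_esum do rewrite normrM.
rewrite esumZ//.
have : (\esum_(i in [set: I]) `|f i|%:E \is a fin_num)%E.
  by rewrite ge0_fin_numE// esum_ge0.
by move=> /fineK <-; rewrite -EFinM ltry.
Qed.

Lemma rsum_nneg I (f : I -> R) : (forall k, 0 <= f k) ->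
  rsum f = fine (\esum_(k in [set: I]) (f k)%:E).
Proof.
move=> f0; rewrite /rsum [X in _ - fine X]esum1 ?subr0 => [|i _].
  by congr fine; apply: eq_esum => i _; rewrite (max_idPl _).
by rewrite (max_idPr _) // oppr_le0.
Qed.

Lemma rsum_nnegE I (f : I -> R) : (forall k, 0 <= f k) -> asum f ->
  (rsum f)%:E = (\esum_(k in [set: I]) (f k)%:E)%E.
Proof.
move=> f0 hf; rewrite rsum_nneg// fineK// ge0_fin_numE.
  by apply: le_lt_trans hf; apply: le_esum => i _; rewrite lee_fin ler_norm.
by apply: esum_ge0 => i _; rewrite lee_fin.
Qed.

Lemma eq_rsum I (f g : I -> R) : f =1 g -> rsum f = rsum g.
Proof. by move=> /funext ->. Qed.

Lemma rsum_parts I (f : I -> R) : rsum f =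
  rsum (fun k => Num.max (f k) 0) - rsum (fun k => Num.max (- f k) 0).
Proof.
have m0 (g : I -> R) k : 0 <= Num.max (g k) 0 by rewrite le_max lexx orbT.
by rewrite (rsum_nneg (m0 f)) (rsum_nneg (m0 (fun k => - f k))).
Qed.

(** The positive and negative parts in the definition of [rsum] may be replaced
    by any other decomposition; linearity follows, since sums and multiples of
    decompositions are decompositions. *)
Lemma rsum_sub I (p q : I -> R) : (forall k, 0 <= p k) -> (forall k, 0 <= q k) ->
  asum p -> asum q ->
  rsum (fun k => p k - q k) = rsum p - rsum q.
Proof.
move=> p0 q0 hp hq; set f := fun k => p k - q k.
have hf : asum f.
  apply: (@asum_le _ _ (fun k => p k + q k)) (asumD hp hq) => k.
  by rewrite /f (le_trans (ler_normB _ _)) // !ger0_norm.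
have m0 (g : I -> R) k : 0 <= Num.max (g k) 0 by rewrite le_max lexx orbT.
have hm (g : I -> R) : asum g -> asum (fun k => Num.max (g k) 0).
  move=> hg; apply: asum_le (asum_abs hg) => k; rewrite ger0_norm //.
  by rewrite ge_max ler_norm normr_ge0.
have hfN : asum (fun k => - f k).
  by apply: asum_le (asum_abs hf) => k; rewrite normrN.
have h : (rsum (fun k => Num.max (f k) 0) + rsum q =
          rsum p + rsum (fun k => Num.max (- f k) 0)).
  apply: EFin_inj.
  rewrite [LHS]EFinD [RHS]EFinD !rsum_nnegE//; do ?exact: hm; do ?exact: (m0 f);
    do ?exact: (m0 (fun k => - f k)).
  rewrite -!esumD//; do ?by move=> i _; rewrite lee_fin ?(m0 f) ?(m0 (fun k => - f k)).
  apply: eq_esum => i _; rewrite -!EFinD; congr EFin; rewrite /f.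
  case: (leP (p i) (q i)) => pq.
    rewrite (max_idPr _) ?(max_idPl _); lra.
  rewrite (max_idPl _) ?(max_idPr _); lra.
by rewrite rsum_parts; lra.
Qed.


Let pos_neg (x : R) : x = Num.max x 0 - Num.max (- x) 0.
Proof.
by case: (leP x 0) => h; [rewrite (max_idPl _)|rewrite (max_idPr _)]; lra.
Qed.
Let max0 (x : R) : 0 <= Num.max x 0. Proof. by rewrite le_max lexx orbT. Qed.
Let maxle (x : R) : Num.max x 0 <= `|x|.
Proof. by rewrite ge_max ler_norm normr_ge0. Qed.
Let maxleN (x : R) : Num.max (- x) 0 <= `|x|.
Proof. by rewrite -normrN maxle. Qed.

Let asum_pos I (f : I -> R) : asum f -> asum (fun k => Num.max (f k) 0).
Proof. by move=> /asum_abs; apply: asum_le => k; rewrite ger0_norm. Qed.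
Let asum_neg I (f : I -> R) : asum f -> asum (fun k => Num.max (- f k) 0).
Proof. by move=> /asum_abs; apply: asum_le => k; rewrite ger0_norm. Qed.

Lemma rsumD I (f g : I -> R) : asum f -> asum g ->
  rsum (fun k => f k + g k) = rsum f + rsum g.
Proof.
move=> hf hg.
have -> : (fun k => f k + g k) =
  (fun k => (Num.max (f k) 0 + Num.max (g k) 0) -
            (Num.max (- f k) 0 + Num.max (- g k) 0)).
  by apply/funext => k; rewrite {1}(pos_neg (f k)) {1}(pos_neg (g k)); lra.
rewrite rsum_sub; do ?(move=> k; exact: addr_ge0);
  do ?(by apply: asumD; [exact: asum_pos|exact: asum_pos]);
  do ?(by apply: asumD; [exact: asum_neg|exact: asum_neg]).
have E (u v : I -> R) : asum u -> asum v ->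
   (forall k, 0 <= u k) -> (forall k, 0 <= v k) ->
   rsum (fun k => u k + v k) = rsum u + rsum v.
  move=> hu hv u0 v0; apply: EFin_inj; rewrite [RHS]EFinD !rsum_nnegE//.
  - by rewrite -esumD// => i _; rewrite lee_fin.
  - by move=> k; rewrite addr_ge0.
  - exact: asumD.
rewrite E//; do ?exact: asum_pos; rewrite E//; do ?exact: asum_neg.
by rewrite (rsum_parts f) (rsum_parts g); lra.
Qed.

Lemma rsumN I (f : I -> R) : rsum (fun k => - f k) = - rsum f.
Proof.
rewrite /rsum opprB; congr (_ - _); congr fine; apply: eq_esum => i _.
by rewrite opprK.
Qed.

Lemma asumN I (f : I -> R) : asum f -> asum (fun k => - f k).
Proof. by move=> /asum_abs; apply: asum_le => k; rewrite normrN. Qed.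

Lemma rsumB I (f g : I -> R) : asum f -> asum g ->
  rsum (fun k => f k - g k) = rsum f - rsum g.
Proof. by move=> hf hg; rewrite rsumD ?rsumN//; exact: asumN. Qed.

Lemma rsumZ I (c : R) (f : I -> R) : asum f ->
  rsum (fun k => c * f k) = c * rsum f.
Proof.
wlog c0 : c f / 0 <= c => [H hf|hf].
  have [|c0] := leP 0 c; first by move/H; apply.
  have -> : (fun k => c * f k) = (fun k => - (- c * f k)).
    by apply/funext => k; rewrite mulNr opprK.
  by rewrite rsumN H // ?mulNr ?opprK //; lra.
have E (u : I -> R) : asum u -> (forall k, 0 <= u k) ->
    rsum (fun k => c * u k) = c * rsum u.
  move=> hu u0; apply: EFin_inj; rewrite [RHS]EFinM !rsum_nnegE//.
  - by rewrite esumZ.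
  - by move=> k; rewrite mulr_ge0.
  - exact: asumZ.
have -> : (fun k => c * f k) =
  (fun k => c * Num.max (f k) 0 - c * Num.max (- f k) 0).
  by apply/funext => k; rewrite -mulrBr -pos_neg.
rewrite rsum_sub; do ?(move=> k; exact: mulr_ge0);
  do ?(apply: asumZ; first [exact: asum_pos | exact: asum_neg]).
rewrite !E//; do ?exact: asum_pos; do ?exact: asum_neg.
by rewrite -mulrBr -rsum_parts.
Qed.

Lemma rsum_ge0 I (f : I -> R) : (forall k, 0 <= f k) -> 0 <= rsum f.
Proof.
by move=> f0; rewrite rsum_nneg// fine_ge0// esum_ge0// => i _; rewrite lee_fin.
Qed.

Lemma ler_rsum I (f g : I -> R) : (forall k, f k <= g k) -> asum f -> asum g ->
  rsum f <= rsum g.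
Proof.
move=> fg hf hg; rewrite -subr_ge0 -rsumB//; apply: rsum_ge0 => k.
by rewrite subr_ge0.
Qed.

Lemma ler_norm_rsum I (f : I -> R) : asum f ->
  `|rsum f| <= rsum (fun k => `|f k|).
Proof.
move=> hf; rewrite ler_norml; apply/andP; split.
  rewrite -rsumN; apply: ler_rsum => //.
  - by move=> k; rewrite lerNl ler_normr lexx orbT.
  - by apply: asumN; exact: asum_abs.
by apply: ler_rsum => //; [move=> k; exact: ler_norm|exact: asum_abs].
Qed.

Lemma asum_sup I (f : I -> R) (k : I) : asum f -> `|f k| <= rsum (fun k => `|f k|).
Proof.
move=> hf; rewrite -lee_fin rsum_nnegE//; last exact: asum_abs.
apply: esum_ge; exists [set k] => //.
by rewrite fsbig_set1.
Qed.

Lemma asum_supp1 I (a : I) (f : I -> R) : (forall k, k != a -> f k = 0) ->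
  (\esum_(k in [set: I]) `|f k|%:E = `|f a|%:E)%E.
Proof.
move=> h; rewrite (esumID [set a])// setTI esum_set1// esum1 ?adde0//.
by move=> k [_ /= /eqP ka]; rewrite h ?normr0.
Qed.

Lemma asum1 I (a : I) (f : I -> R) : (forall k, k != a -> f k = 0) -> asum f.
Proof. by move=> h; rewrite /asum (asum_supp1 h) ltry. Qed.

Lemma rsum1 I (a : I) (f : I -> R) : (forall k, k != a -> f k = 0) ->
  rsum f = f a.
Proof.
move=> h; have hf := asum1 h.
have E (u : I -> R) : (forall k, 0 <= u k) -> (forall k, k != a -> u k = 0) ->
    fine (\esum_(k in [set: I]) (u k)%:E) = u a.
  move=> u0 uh; have := asum_supp1 uh.
  under eq_esum do rewrite ger0_norm//.
  by move=> -> /=; rewrite ger0_norm.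
rewrite /rsum !E// => k /h ->; rewrite ?oppr0 maxxx //.
Qed.

Lemma asum_reindex I J (e : I -> J) (f : J -> R) : bijective e ->
  asum f -> asum (f \o e).
Proof.
move=> be; rewrite /asum (@reindex_esum _ _ _ setT setT e)//.
by rewrite setTT_bijective.
Qed.

Lemma rsum_reindex I J (e : I -> J) (f : J -> R) : bijective e ->
  rsum (f \o e) = rsum f.
Proof.
move=> be; have bb : set_bij setT setT e by rewrite setTT_bijective.
by rewrite /rsum !(@reindex_esum _ _ _ setT setT e _ bb).
Qed.

Definition asum2 I J (f : I -> J -> R) : Prop :=
  (\esum_(i in [set: I]) \esum_(j in [set: J]) `|f i j|%:E < +oo)%E.

Lemma esum_swap I J (f : I -> J -> \bar R) : (forall i j, 0 <= f i j)%E ->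
  (\esum_(i in [set: I]) \esum_(j in [set: J]) f i j =
   \esum_(j in [set: J]) \esum_(i in [set: I]) f i j)%E.
Proof.
move=> f0; rewrite !esum_esum//.
pose e (p : J * I) := (p.2, p.1).
rewrite (@reindex_esum _ _ _ ([set: J] `*`` (fun=> [set: I])) _ e)//.
split => //.
- by move=> [i j] [j' i'] _ _ [-> ->].
- by move=> [i j] _; exists (j, i).
Qed.

Lemma asum2_swap I J (f : I -> J -> R) : asum2 f -> asum2 (fun j i => f i j).
Proof. by rewrite /asum2 esum_swap. Qed.

Lemma asum2_row I J (f : I -> J -> R) i : asum2 f -> asum (f i).
Proof.
apply: le_lt_trans; apply: esum_ge; exists [set i] => //.
by rewrite fsbig_set1.
Qed.

Lemma asum2_le I J (f g : I -> J -> R) : (forall i j, `|f i j| <= g i j) ->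
  asum2 g -> asum2 f.
Proof.
move=> fg; apply: le_lt_trans; apply: le_esum => i _; apply: le_esum => j _.
by rewrite lee_fin (le_trans (fg i j)) ?ler_norm.
Qed.

Lemma asum2_abs I J (f : I -> J -> R) : asum2 f -> asum2 (fun i j => `|f i j|).
Proof.
apply: le_lt_trans; apply: le_esum => i _; apply: le_esum => j _.
by rewrite normr_id.
Qed.

Lemma asum2_out I J (f : I -> J -> R) : asum2 f ->
  asum (fun i => rsum (fun j => `|f i j|)).
Proof.
move=> h; apply: le_lt_trans (h); apply: le_esum => i _.
rewrite ger0_norm; last by apply: rsum_ge0.
by rewrite rsum_nnegE//; apply: asum_abs; exact: asum2_row h.
Qed.

Lemma asum2P I J (f : I -> J -> R) : (forall i, asum (f i)) ->
  asum (fun i => rsum (fun j => `|f i j|)) -> asum2 f.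
Proof.
move=> h1; apply: le_lt_trans; apply: le_esum => i _.
rewrite ger0_norm; last by apply: rsum_ge0.
by rewrite rsum_nnegE//; exact: asum_abs.
Qed.

Lemma asum2Z I J (c : R) (f : I -> J -> R) : asum2 f ->
  asum2 (fun i j => c * f i j).
Proof.
move=> h; apply: asum2P => [i|]; first by apply: asumZ; exact: asum2_row h.
apply: asum_le (asumZ `|c| (asum2_out h)) => i.
rewrite ger0_norm; last by apply: rsum_ge0.
rewrite -(rsumZ _ (asum_abs (asum2_row i h))) le_eqVlt; apply/orP; left.
by apply/eqP; apply: eq_rsum => j; rewrite normrM.
Qed.

Lemma asum2_out' I J (f : I -> J -> R) : asum2 f -> asum (fun i => rsum (f i)).
Proof.
move=> h; apply: asum_le (asum2_out h) => i.
by apply: ler_norm_rsum; exact: asum2_row h.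
Qed.

(** Fubini's theorem, from Tonelli's for the positive and negative parts. *)
Lemma rsum_swap I J (f : I -> J -> R) : asum2 f ->
  rsum (fun i => rsum (f i)) = rsum (fun j => rsum (fun i => f i j)).
Proof.
move=> hf.
have E (g : I -> J -> R) : asum2 g -> (forall i j, 0 <= g i j) ->
    rsum (fun i => rsum (g i)) = rsum (fun j => rsum (fun i => g i j)).
  move=> hg g0; have hg' := asum2_swap hg; apply: EFin_inj.
  rewrite !rsum_nnegE.
  - transitivity (\esum_(i in [set: I]) (\esum_(j in [set: J]) (g i j)%:E))%E.
      by apply: eq_esum => i _; rewrite rsum_nnegE//; exact: asum2_row hg.
    rewrite esum_swap; last by move=> i j; rewrite lee_fin.
    by apply: eq_esum => j _; rewrite rsum_nnegE//; exact: asum2_row hg'.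
  - by move=> j; apply: rsum_ge0.
  - exact: asum2_out' hg'.
  - by move=> j; apply: rsum_ge0.
  - exact: asum2_out' hg.
pose p i j := Num.max (f i j) 0; pose q i j := Num.max (- f i j) 0.
have hp : asum2 p by apply: asum2_le (asum2_abs hf) => i j; rewrite ger0_norm; [exact: maxle|exact: max0].
have hq : asum2 q by apply: asum2_le (asum2_abs hf) => i j; rewrite ger0_norm; [exact: maxleN|exact: max0].
have hp' := asum2_swap hp; have hq' := asum2_swap hq.
have p0 i j : 0 <= p i j by exact: max0.
have q0 i j : 0 <= q i j by exact: max0.
have -> : f = fun i j => p i j - q i j.
  by apply/funext => i; apply/funext => j; rewrite -pos_neg.
transitivity (rsum (fun i => rsum (p i)) - rsum (fun i => rsum (q i))).
  rewrite -rsumB; do ?[exact: asum2_out' hp|exact: asum2_out' hq].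
  apply: eq_rsum => i.
  by rewrite rsumB//; [exact: asum2_row hp|exact: asum2_row hq].
rewrite (E p)// (E q)//.
rewrite -rsumB; do ?[exact: asum2_out' hp'|exact: asum2_out' hq'].
apply: eq_rsum => j.
by rewrite -rsumB//; [exact: asum2_row hp'|exact: asum2_row hq'].
Qed.

(** Used in two ways: to exchange an infinite sum with an integral, and to
    choose the truncations that approximate a function in a weighted norm. *)
Lemma asum_tail I (f : I -> R) (e : R) : asum f -> 0 < e ->
  exists F : {fset I},
    rsum (fun k => if k \in F then 0 else `|f k|) <= e.
Proof.
move=> hf e0; set S := (\esum_(k in [set: I]) `|f k|%:E)%E.
have Sfin : (S \is a fin_num)%E by rewrite ge0_fin_numE// esum_ge0.
have [_ [X [finX _] <-] hX] := ub_ereal_sup_adherent e0 Sfin.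
exists (fset_set X).
set g := fun k => _.
have g0 k : 0 <= g k by rewrite /g; case: ifP.
have hg : asum g.
  by apply: asum_le (asum_abs hf) => k; rewrite ger0_norm// /g; case: ifP.
rewrite -lee_fin rsum_nnegE//.
have -> : (\esum_(k in [set: I]) (g k)%:E = \esum_(k in ~` X) `|f k|%:E)%E.
  rewrite [RHS]esum_mkcond; apply: eq_esum => i _.
  rewrite /g in_fset_set//.
  by rewrite in_setC; case: (i \in X).
have : (S = \esum_(k in X) `|f k|%:E + \esum_(k in ~` X) `|f k|%:E)%E.
  by rewrite /S (esumID X)// !setTI.
rewrite (esum_fset finX)//; have {}hX : (S - e%:E < \sum_(i \in X) `|f i|%:E)%E by [].
move: hX.
have F1 : (\sum_(i \in X) `|f i|%:E \is a fin_num)%E.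
  rewrite ge0_fin_numE ?fsume_ge0//.
  apply: le_lt_trans hf; apply: ereal_sup_ubound; exists X => //.
have F2 : (\esum_(k in ~` X) `|f k|%:E \is a fin_num)%E.
  rewrite ge0_fin_numE ?esum_ge0//.
  apply: le_lt_trans hf; rewrite [X in (_ <= X)%E](esumID X)// !setTI.
  by rewrite leeDr// esum_ge0.
move: Sfin F1 F2; move: S (\sum_(i \in X) _)%E (\esum_(k in ~` X) _)%E.
move=> [s||] [a||] [b||] // _ _ _.
by rewrite -EFinB lte_fin lee_fin => h1 [h2]; lra.
Qed.

Lemma asum_fset I (F : {fset I}) (f : I -> R) : asum (fun k => if k \in F then f k else 0).
Proof.
rewrite /asum.
have -> : (\esum_(k in [set: I]) `|(if k \in F then f k else 0)%R|%:E =
  \esum_(k in [set` F]) `|f k|%:E)%E.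
  rewrite [RHS]esum_mkcond; apply: eq_esum => i _.
  rewrite (_ : (i \in [set` F]) = (i \in F)); last by apply/idP/idP; rewrite inE.
  by case: ifP => //; rewrite normr0.
rewrite esum_fset//.
elim/big_ind: _ => //; first by move=> x y; exact: lte_add_pinfty.
by move=> i _; exact: ltry.
Qed.

End RealSums.

(** * Absolutely summable complex families *)

Section ComplexSums.
Context {R : realType}.
Implicit Types (I J : choiceType) (z w : R[i]).

Lemma normcE z : normc z = Num.sqrt (complex.Re z ^+ 2 + complex.Im z ^+ 2).
Proof. by case: z. Qed.

Lemma normc_ge0 z : 0 <= normc z.
Proof. by rewrite normcE sqrtr_ge0. Qed.

Lemma normc_norm z : (normc z)%:C = `|z|.
Proof. by case: z. Qed.

Lemma le_normcD z w : normc (z + w) <= normc z + normc w.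
Proof. by rewrite -lecR rmorphD /= !normc_norm ler_normD. Qed.

Lemma normcN z : normc (- z) = normc z.
Proof. by apply: complexI; rewrite !normc_norm normrN. Qed.

Lemma le_normcB z w : normc (z - w) <= normc z + normc w.
Proof. by rewrite -(normcN w) le_normcD. Qed.

Lemma normc_conj z : normc (conjc z) = normc z.
Proof. by case: z => a b /=; rewrite sqrrN. Qed.

Lemma normcR (r : R) : normc r%:C = `|r|.
Proof. by rewrite /= expr0n addr0 sqrtr_sqr. Qed.

Lemma normc_nat k : normc (k%:R : R[i]) = k%:R.
Proof.
by rewrite (_ : k%:R = (k%:R : R)%:C) ?normcR ?ger0_norm ?rmorph_nat.
Qed.

Lemma Re_le_normc z : `|complex.Re z| <= normc z.
Proof. by rewrite normcE -sqrtr_sqr ler_wsqrtr// lerDl sqr_ge0. Qed.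

Lemma Im_le_normc z : `|complex.Im z| <= normc z.
Proof. by rewrite normcE -sqrtr_sqr ler_wsqrtr// lerDr sqr_ge0. Qed.

Lemma normc_le_ReIm z : normc z <= `|complex.Re z| + `|complex.Im z|.
Proof.
rewrite normcE -[leRHS]ger0_norm ?addr_ge0// -sqrtr_sqr ler_wsqrtr//.
rewrite sqrrD !real_normK ?num_real// addrAC -addrA lerD2l lerDl.
by rewrite mulrn_wge0// mulr_ge0.
Qed.

Lemma eqc z w : complex.Re z = complex.Re w -> complex.Im z = complex.Im w -> z = w.
Proof. by case: z w => [a b] [c d] /= -> ->. Qed.

Lemma ReD z w : complex.Re (z + w) = complex.Re z + complex.Re w.
Proof. by case: z w => [a b] [c d]. Qed.
Lemma ImD z w : complex.Im (z + w) = complex.Im z + complex.Im w.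
Proof. by case: z w => [a b] [c d]. Qed.
Lemma ReN z : complex.Re (- z) = - complex.Re z.
Proof. by case: z. Qed.
Lemma ImN z : complex.Im (- z) = - complex.Im z.
Proof. by case: z. Qed.
Lemma ReM z w : complex.Re (z * w) =
  complex.Re z * complex.Re w - complex.Im z * complex.Im w.
Proof. by case: z w => [a b] [c d]. Qed.
Lemma ImM z w : complex.Im (z * w) =
  complex.Re z * complex.Im w + complex.Im z * complex.Re w.
Proof. by case: z w => [a b] [c d]. Qed.

Definition asumc I (f : I -> R[i]) : Prop := asum (fun k => normc (f k)).

Lemma asumc_le I (f : I -> R[i]) (g : I -> R) :
  (forall k, normc (f k) <= g k) -> asum g -> asumc f.
Proof. by move=> h; apply: asum_le => k; rewrite ger0_norm ?normc_ge0. Qed.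

Lemma asumc_Re I (f : I -> R[i]) : asumc f -> asum (fun k => complex.Re (f k)).
Proof. by apply: asum_le => k; exact: Re_le_normc. Qed.

Lemma asumc_Im I (f : I -> R[i]) : asumc f -> asum (fun k => complex.Im (f k)).
Proof. by apply: asum_le => k; exact: Im_le_normc. Qed.

Lemma asumcD I (f g : I -> R[i]) : asumc f -> asumc g ->
  asumc (fun k => f k + g k).
Proof. by move=> hf hg; apply: asumc_le (asumD hf hg) => k; exact: le_normcD. Qed.

Lemma asumcN I (f : I -> R[i]) : asumc f -> asumc (fun k => - f k).
Proof. by apply: asumc_le => k; rewrite normcN. Qed.

Lemma asumcZ I z (f : I -> R[i]) : asumc f -> asumc (fun k => z * f k).
Proof. by move=> /(asumZ (normc z)); apply: asumc_le => k; rewrite normcM. Qed.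

Lemma eq_csum I (f g : I -> R[i]) : f =1 g -> csum f = csum g.
Proof. by move=> /funext ->. Qed.

Lemma csumD I (f g : I -> R[i]) : asumc f -> asumc g ->
  csum (fun k => f k + g k) = csum f + csum g.
Proof.
move=> hf hg; apply: eqc => /=.
  rewrite -(rsumD (asumc_Re hf) (asumc_Re hg)).
  by apply: eq_rsum => k; rewrite ReD.
rewrite -(rsumD (asumc_Im hf) (asumc_Im hg)).
by apply: eq_rsum => k; rewrite ImD.
Qed.

Lemma csumN I (f : I -> R[i]) : csum (fun k => - f k) = - csum f.
Proof.
by apply: eqc; rewrite /= -rsumN; apply: eq_rsum => k; rewrite ?ReN ?ImN.
Qed.

Lemma csumB I (f g : I -> R[i]) : asumc f -> asumc g ->
  csum (fun k => f k - g k) = csum f - csum g.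
Proof. by move=> hf hg; rewrite csumD ?csumN//; exact: asumcN. Qed.

Lemma csumZ I z (f : I -> R[i]) : asumc f ->
  csum (fun k => z * f k) = z * csum f.
Proof.
move=> hf; have hr := asumc_Re hf; have hi := asumc_Im hf.
have D := rsumD; have B := rsumB; apply: eqc.
  rewrite ReM /= -!rsumZ// -rsumB; do ?exact: asumZ.
  by apply: eq_rsum => k; rewrite ReM.
rewrite ImM /= -!rsumZ// -rsumD; do ?exact: asumZ.
by apply: eq_rsum => k; rewrite ImM.
Qed.

Lemma csum_conj I (f : I -> R[i]) : csum (fun k => conjc (f k)) = conjc (csum f).
Proof.
apply: eqc; rewrite /= -?rsumN; apply: eq_rsum => k; by case: (f k).
Qed.

Lemma le_normc_csum I (f : I -> R[i]) : asumc f ->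
  normc (csum f) <= 2 * rsum (fun k => normc (f k)).
Proof.
move=> hf; apply: le_trans (normc_le_ReIm _) _ => /=.
have h1 := ler_norm_rsum (asumc_Re hf); have h2 := ler_norm_rsum (asumc_Im hf).
have h3 : rsum (fun k => `|complex.Re (f k)|) <= rsum (fun k => normc (f k)).
  apply: ler_rsum => //; [by move=> k; exact: Re_le_normc|].
  by apply: asum_abs; exact: asumc_Re.
have h4 : rsum (fun k => `|complex.Im (f k)|) <= rsum (fun k => normc (f k)).
  apply: ler_rsum => //; [by move=> k; exact: Im_le_normc|].
  by apply: asum_abs; exact: asumc_Im.
lra.
Qed.

Lemma csum1 I (a : I) (f : I -> R[i]) : (forall k, k != a -> f k = 0) ->
  csum f = f a.
Proof.
move=> h; apply: eqc => /=.
  by rewrite (@rsum1 _ _ a) => // k /h ->.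
by rewrite (@rsum1 _ _ a) => // k /h ->.
Qed.

Lemma asumc1 I (a : I) (f : I -> R[i]) : (forall k, k != a -> f k = 0) ->
  asumc f.
Proof. by move=> h; apply: (asum1 (a := a)) => k /h ->; rewrite normc0. Qed.

Lemma csum_reindex I J (e : I -> J) (f : J -> R[i]) : bijective e ->
  csum (f \o e) = csum f.
Proof.
move=> be; apply: eqc => /=.
  by rewrite -(rsum_reindex (fun k => complex.Re (f k)) be).
by rewrite -(rsum_reindex (fun k => complex.Im (f k)) be).
Qed.

Definition asumc2 I J (f : I -> J -> R[i]) : Prop :=
  asum2 (fun i j => normc (f i j)).

Lemma asumc2_le I J (f : I -> J -> R[i]) (g : I -> J -> R) :
  (forall i j, normc (f i j) <= g i j) -> asum2 g -> asumc2 f.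
Proof. by move=> h; apply: asum2_le => i j; rewrite ger0_norm ?normc_ge0. Qed.

Lemma asumc2_swap I J (f : I -> J -> R[i]) : asumc2 f -> asumc2 (fun j i => f i j).
Proof. by move=> /asum2_swap. Qed.

Lemma csum_swap I J (f : I -> J -> R[i]) : asumc2 f ->
  csum (fun i => csum (f i)) = csum (fun j => csum (fun i => f i j)).
Proof.
move=> h; apply: eqc => /=.
  rewrite (rsum_swap (f := fun i j => complex.Re (f i j)))//.
  by apply: asum2_le h => i j; exact: Re_le_normc.
rewrite (rsum_swap (f := fun i j => complex.Im (f i j)))//.
by apply: asum2_le h => i j; exact: Im_le_normc.
Qed.

Lemma csum_fset I (F : {fset I}) (f : I -> R[i]) :
  csum (fun k => if k \in F then f k else 0) = \sum_(k <- F) f k.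
Proof.
transitivity (csum (fun k => if k \in (F : seq I) then f k else 0)) => //.
have : uniq F by exact: fset_uniq.
elim: (F : seq I) => [_|a s ih /= /andP[as_ us]].
  rewrite big_nil; case: (pselect (exists a : I, True)) => [[a _]|h].
    by rewrite (csum1 (a := a)).
  by apply: eqc; rewrite /= /rsum !esum1 ?subrr// => i; case: h; exists i.
rewrite big_cons -ih//.
have -> : (fun k => if k \in a :: s then f k else 0) =
    (fun k => (if k == a then f k else 0) + (if k \in s then f k else 0)).
  apply/funext => k; rewrite inE; case: eqP => [->|_] /=; last by rewrite add0r.
  by rewrite (negbTE as_) addr0.
have h1 k : k != a -> (if k == a then f k else 0) = 0 by move=> /negbTE ->.
rewrite csumD.
- by rewrite (csum1 h1) eqxx.
- exact: asumc1 h1.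
- have := @asum_fset R I [fset k in s]%fset (fun k => normc (f k)).
  by apply: asumc_le => k; rewrite !inE; case: ifP => // _; rewrite normc0.
Qed.

Lemma csum_approx I (f : I -> R[i]) (e : R) : asumc f -> 0 < e ->
  exists F : {fset I},
    rsum (fun k => if k \in F then 0 else normc (f k)) <= e.
Proof.
move=> hf e0; have [F hF] := asum_tail hf e0; exists F.
rewrite (_ : (fun _ => _) = (fun k => if k \in F then 0 else `|normc (f k)|))//.
by apply/funext => k; rewrite ger0_norm ?normc_ge0.
Qed.

(** Stated for a family [g] dominated by [f], so that one finite set works
    uniformly for all the families [k |-> c k * chi k x] with [x] on the torus. *)
Lemma csum_tail I (F : {fset I}) (f g : I -> R[i]) : asumc f ->
  (forall k, normc (g k) <= normc (f k)) ->
  normc (csum g - \sum_(k <- F) g k) <=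
  2 * rsum (fun k => if k \in F then 0 else normc (f k)).
Proof.
move=> hf gf; have hg : asumc g by apply: asumc_le hf.
have hgF : asumc (fun k => if k \in F then g k else 0).
  by apply: asumc_le hg => k; case: ifP => // _; rewrite normc0 normc_ge0.
rewrite -csum_fset -csumB//.
have hgT : asumc (fun k => g k - (if k \in F then g k else 0)).
  by apply: asumcD => //; exact: asumcN.
apply: le_trans (le_normc_csum hgT) _; rewrite ler_pM2l//.
apply: ler_rsum => //.
  move=> k; case: ifP => _; first by rewrite subrr normc0.
  by rewrite subr0.
apply: asum_le hf => k; case: ifP => _; first by rewrite normr0 normc_ge0.
by rewrite ger0_norm ?normc_ge0.
Qed.

End ComplexSums.

(** * Integration over the unit interval *)

Section UnitInterval.
Context {R : realType}.
Local Notation mu := (@lebesgue_measure R).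

Definition int01 (u : R -> R) : R := Rintegral mu `[0%R, 1%R] u.

Definition lip1 (u : R -> R) : Prop :=
  exists L : R, forall s t, `|u s - u t| <= L * `|s - t|.

Lemma lip1_continuous u : lip1 u -> continuous u.
Proof.
move=> [L hL] t; apply/cvgrPdist_le => e e0.
have K0 : 0 < `|L| + 1 by rewrite ltr_wpDl.
have d0 : 0 < e / (`|L| + 1) by rewrite divr_gt0.
apply/nbhs_ballP; exists (e / (`|L| + 1)) => // s /= hs.
apply: le_trans (hL t s) _; apply: (@le_trans _ _ ((`|L| + 1) * `|t - s|)).
  by rewrite ler_wpM2r// (le_trans (ler_norm L)) ?lerDl.
by rewrite mulrC -ler_pdivlMr// ltW.
Qed.

Lemma integrable_lip1 u (a b : R) : lip1 u ->
  mu.-integrable `[a, b] (EFin \o u).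
Proof.
move=> hu; apply: continuous_compact_integrable; first exact: segment_compact.
by apply: continuous_subspaceT => x; exact: lip1_continuous.
Qed.


Lemma int01D u v : lip1 u -> lip1 v ->
  int01 (fun t => u t + v t) = int01 u + int01 v.
Proof. by move=> hu hv; rewrite /int01 RintegralD//; exact: integrable_lip1. Qed.

Lemma int01Z c u : lip1 u -> int01 (fun t => c * u t) = c * int01 u.
Proof. by move=> hu; rewrite /int01 RintegralZl//; exact: integrable_lip1. Qed.

Lemma le_int01 u v : lip1 u -> lip1 v ->
  (forall t, 0 <= t <= 1 -> u t <= v t) -> int01 u <= int01 v.
Proof.
move=> hu hv uv; apply: le_Rintegral => //; do ?exact: integrable_lip1.
Qed.

Lemma int01_cst (r : R) : int01 (fun=> r) = r.
Proof.
rewrite /int01 Rintegral_cst//= lebesgue_measure_itv /= lte_fin ltr01.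
by rewrite -EFinB /= subr0 mulr1.
Qed.

Lemma Rintegral_shift u (a b h : R) : a <= b -> lip1 u ->
  Rintegral mu `[a, b] (fun t => u (t + h)) = Rintegral mu `[a + h, b + h] u.
Proof.
move=> ab hu; rewrite /Rintegral; congr fine; apply/esym.
pose F (t : R) := t + h.
have dF (x : R) : is_derive x 1 F 1.
  by rewrite /F; apply: is_derive_eq; rewrite addr0.
have F1 : derive1 F = fun=> 1.
  by apply/funext => x; rewrite derive1E; have [_ ->] := dF x.
have cF : continuous F.
  by move=> x; apply: differentiable_continuous; apply/derivable1_diffP; have [] := dF x.
rewrite (@integration_by_substitution_increasing _ F u a b)//.
- apply: eq_integral => x _ /=; rewrite F1 /=; congr EFin.
  by rewrite -[RHS]mulr1.
- by move=> x y _ _ xy; rewrite /F ltrD2r.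
- by move=> x _; rewrite F1; exact: cvg_cst.
- by rewrite F1; exact: is_cvg_cst.
- by rewrite F1; exact: is_cvg_cst.
- split.
  + by move=> x _; have [] := dF x.
  + by apply: cvg_at_right_filter; exact: cF.
  + by apply: cvg_at_left_filter; exact: cF.
- by apply: continuous_subspaceT => x; exact: lip1_continuous.
Qed.

Let int01_shift_pos u h : lip1 u -> (forall t, u (t + 1) = u t) ->
  0 <= h <= 1 -> int01 (fun t => u (t + h)) = int01 u.
Proof.
move=> hu pu /andP[h0 h1]; rewrite /int01 Rintegral_shift// add0r.
have i1 := integrable_lip1 h (1 + h) hu.
have i2 := integrable_lip1 0 1 hu.
have oc (a b : R) : Rintegral mu `]a, b] u = Rintegral mu `[a, b] u.
  apply: Rintegral_itv_obnd_cbnd.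
  by apply: integrableS (integrable_lip1 a b hu) => //; exact: subset_itv_oc_cc.
have A := @Rintegral_itvB R u (BLeft h) (BRight (1 + h)) 1 i1.
have B := @Rintegral_itvB R u (BLeft 0) (BRight 1) h i2.
rewrite !oc !bnd_simp in A B.
have {A} := A h1 (ltac:(lra)); have {B} := B h0 h1.
have -> : Rintegral mu `[1, 1 + h] u = Rintegral mu `[0, h] u.
  have := Rintegral_shift 1 h0 hu; rewrite add0r (addrC h) => <-.
  by apply: eq_Rintegral => x _; exact: pu.
lra.
Qed.

Lemma int01_shift u h : lip1 u -> (forall t, u (t + 1) = u t) ->
  int01 (fun t => u (t + h)) = int01 u.
Proof.
move=> hu pu.
have pn (k : nat) t : u (t + k%:R) = u t.
  elim: k t => [|k ih] t; first by rewrite addr0.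
  by rewrite -addn1 natrD addrA pu ih.
have pz (q : int) t : u (t + q%:~R) = u t.
  case: q => k; first exact: pn.
  by rewrite NegzE mulrNz -[LHS](pn k.+1) subrK.
have E : (fun t => u (t + h)) = (fun t => u (t + (h - (Num.floor h)%:~R))).
  apply/funext => t; rewrite -[RHS](pz (Num.floor h)); congr u.
  by rewrite -addrA subrK.
rewrite E int01_shift_pos//.
rewrite subr_ge0 floor_le /= lerBlDl.
by rewrite ltW // -[X in _ + X]/(1%:~R) -intrD floorD1_gt.
Qed.

End UnitInterval.

(** * Iterated integrals of Lipschitz functions *)

Section TorusIntegral.
Context {R : realType}.

Definition dist1 n (x y : 'rV[R]_n) : R := \sum_j `|x 0 j - y 0 j|.

(** The inner integral of a Lipschitz function is Lipschitz in the outer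
    variable, with the same constant; this makes induction on the dimension
    possible without joint measurability or uniform continuity. *)
Definition rlip n (L : R) (u : 'rV[R]_n -> R) : Prop :=
  forall x y, `|u x - u y| <= L * dist1 x y.

Definition slice n (T : Type) (u : 'rV[R]_n.+1 -> T) (t : R) (y : 'rV[R]_n) : T :=
  u (row_mx (t%:M : 'M[R]_1) y).

Lemma torus_RintS n (u : 'rV[R]_n.+1 -> R) :
  torus_Rint u = int01 (fun t => torus_Rint (slice u t)).
Proof. by []. Qed.

Lemma dist1_ge0 n (x y : 'rV[R]_n) : 0 <= dist1 x y.
Proof. by apply: sumr_ge0. Qed.

Lemma dist1_row n (s t : R) (y z : 'rV[R]_n) :
  dist1 (row_mx (s%:M : 'M[R]_1) y : 'rV[R]_n.+1) (row_mx (t%:M : 'M[R]_1) z)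
  = `|s - t| + dist1 y z.
Proof.
rewrite /dist1 big_ord_recl; congr (_ + _).
  by rewrite !mxE; case: splitP => // k _; rewrite !mxE ord1.
apply: eq_bigr => j _.
rewrite !mxE; case: splitP => k; first by rewrite ord1.
by rewrite /= /bump /= add1n => -[/val_inj ->].
Qed.

Lemma dist1xx n (x : 'rV[R]_n) : dist1 x x = 0.
Proof. by apply: big1 => j _; rewrite subrr normr0. Qed.

Lemma rlip_slice n L (u : 'rV[R]_n.+1 -> R) t : rlip L u -> rlip L (slice u t).
Proof.
by move=> hu y z; apply: le_trans (hu _ _) _; rewrite dist1_row subrr normr0 add0r.
Qed.

Lemma rlipD n L M (u v : 'rV[R]_n -> R) : rlip L u -> rlip M v ->
  rlip (L + M) (fun x => u x + v x).
Proof.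
move=> hu hv x y; rewrite opprD addrACA mulrDl (le_trans (ler_normD _ _))//.
by rewrite lerD.
Qed.

Lemma rlipZ n L c (u : 'rV[R]_n -> R) : rlip L u -> rlip (`|c| * L) (fun x => c * u x).
Proof. by move=> hu x y; rewrite -mulrBr normrM -mulrA ler_wpM2l. Qed.

Lemma rlip_cst n (c : R) : rlip 0 (fun _ : 'rV[R]_n => c).
Proof. by move=> x y; rewrite subrr normr0 mul0r. Qed.

(** Linearity and monotonicity are proved together with the continuity in the
    outer variable that makes the next integration meaningful. *)
Lemma torus_Rint_core n :
  [/\ forall L M (u v : 'rV[R]_n -> R), rlip L u -> rlip M v ->
        torus_Rint (fun x => u x + v x) = torus_Rint u + torus_Rint v,
      forall L c (u : 'rV[R]_n -> R), rlip L u ->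
        torus_Rint (fun x => c * u x) = c * torus_Rint u,
      forall L M (u v : 'rV[R]_n -> R), rlip L u -> rlip M v ->
        (forall x, u x <= v x) -> torus_Rint u <= torus_Rint v
    & forall c, torus_Rint (fun _ : 'rV[R]_n => c) = c].
Proof.
elim: n => [|n [iD iZ iM iC]].
  by split => //= *.
have lipS L (u : 'rV[R]_n.+1 -> R) : rlip L u ->
    lip1 (fun t => torus_Rint (slice u t)).
  move=> hu; exists L => s t.
  have lt w := rlip_slice w hu.
  have h1 : torus_Rint (slice u s) <= torus_Rint (slice u t) + L * `|s - t|.
    rewrite -[X in _ + X]iC -(iD L 0)//; last exact: rlip_cst.
    apply: (iM L (L + 0)) => //; first by apply: rlipD => //; exact: rlip_cst.
    move=> y; rewrite -lerBlDl (le_trans (ler_norm _))// (le_trans (hu _ _))//.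
    by rewrite dist1_row dist1xx addr0.
  have h2 : torus_Rint (slice u t) <= torus_Rint (slice u s) + L * `|s - t|.
    rewrite -[X in _ + X]iC -(iD L 0)//; last exact: rlip_cst.
    apply: (iM L (L + 0)) => //; first by apply: rlipD => //; exact: rlip_cst.
    move=> y; rewrite -lerBlDl (le_trans (ler_norm _))// (le_trans (hu _ _))//.
    by rewrite dist1_row dist1xx addr0 distrC.
  by rewrite ler_norml; apply/andP; split; lra.
split.
- move=> L M u v hu hv; rewrite !torus_RintS -(int01D (lipS _ _ hu) (lipS _ _ hv)).
  by congr int01; apply/funext => t; rewrite -(iD L M)//; exact: rlip_slice.
- move=> L c u hu; rewrite !torus_RintS -(int01Z _ (lipS _ _ hu)).
  by congr int01; apply/funext => t; rewrite -(iZ L)//; exact: rlip_slice.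
- move=> L M u v hu hv uv; rewrite !torus_RintS; apply: le_int01.
  + exact: lipS hu.
  + exact: lipS hv.
  + by move=> t _; apply: (iM L M) => [||y]; [exact: rlip_slice|exact: rlip_slice|exact: uv].
- move=> c; rewrite torus_RintS -[RHS]int01_cst; congr int01.
  by apply/funext => t; exact: iC.
Qed.

Lemma torus_RintD n L M (u v : 'rV[R]_n -> R) : rlip L u -> rlip M v ->
  torus_Rint (fun x => u x + v x) = torus_Rint u + torus_Rint v.
Proof. by have [h _ _ _] := torus_Rint_core n; exact: h. Qed.

Lemma torus_RintZ n L c (u : 'rV[R]_n -> R) : rlip L u ->
  torus_Rint (fun x => c * u x) = c * torus_Rint u.
Proof. by have [_ h _ _] := torus_Rint_core n; exact: h. Qed.

Lemma le_torus_Rint n L M (u v : 'rV[R]_n -> R) : rlip L u -> rlip M v ->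
  (forall x, u x <= v x) -> torus_Rint u <= torus_Rint v.
Proof. by have [_ _ h _] := torus_Rint_core n; exact: h. Qed.

Lemma torus_Rint_cst n (c : R) : torus_Rint (fun _ : 'rV[R]_n => c) = c.
Proof. by have [_ _ _ ->] := torus_Rint_core n. Qed.

Lemma torus_Rint_bound n L M (u : 'rV[R]_n -> R) : rlip L u ->
  (forall x, `|u x| <= M) -> `|torus_Rint u| <= M.
Proof.
move=> hu hM; rewrite ler_norml -{1}(torus_Rint_cst n (- M)) -{2}(torus_Rint_cst n M).
apply/andP; split.
  by apply: (le_torus_Rint (rlip_cst (- M)) hu) => x; have := hM x; rewrite ler_norml => /andP[].
by apply: (le_torus_Rint hu (rlip_cst M)) => x; have := hM x; rewrite ler_norml => /andP[].
Qed.

Lemma lip1_slice n L (u : 'rV[R]_n.+1 -> R) : rlip L u ->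
    lip1 (fun t => torus_Rint (slice u t)).
Proof.
move=> hu; exists L => s t.
rewrite -mulN1r -(torus_RintZ _ (rlip_slice t hu)).
rewrite -(torus_RintD (rlip_slice s hu) (rlipZ (-1) (rlip_slice t hu))).
apply: torus_Rint_bound; first exact: (rlipD (rlip_slice s hu) (rlipZ (-1) (rlip_slice t hu))).
move=> x; rewrite mulN1r (le_trans (hu _ _))//.
by rewrite dist1_row dist1xx addr0.
Qed.

(** Only the one-variable integral over the shifted coordinate changes, so no
    exchange of integrals is involved. *)
Lemma torus_Rint_shift n L (u : 'rV[R]_n -> R) (j : 'I_n) (h : R) :
  rlip L u -> zperiodic u ->
  torus_Rint (fun x => u (x + h *: delta_mx 0 j)) = torus_Rint u.
Proof.
elim: n u j => [|n ih] u j; first by case: j.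
move=> hu pu; rewrite !torus_RintS.
have E (t s : R) (y z : 'rV[R]_n) :
  row_mx (t%:M : 'M[R]_1) y + row_mx (s%:M : 'M[R]_1) z =
  row_mx ((t + s)%:M : 'M[R]_1) (y + z).
  by rewrite add_row_mx raddfD.
have d0 : (delta_mx 0 (lshift n 0) : 'rV[R]_(1 + n)) = row_mx (1%:M : 'M[R]_1) 0.
  apply/rowP => i; rewrite !mxE /=; case: splitP => k ik.
    by rewrite !mxE !ord1 /= (_ : i == _) //; apply/eqP/val_inj; rewrite /= ik ord1.
  by rewrite !mxE -?val_eqE /= ik.
have dS k : (delta_mx 0 (rshift 1 k) : 'rV[R]_(1 + n)) = row_mx (0%:M : 'M[R]_1) (delta_mx 0 k).
  apply/rowP => i; rewrite !mxE /=; case: splitP => l il.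
    by rewrite !mxE !ord1 /= -val_eqE /= il ord1.
  by rewrite !mxE /= -!val_eqE /= il eqSS.
have d0h (c : R) : c *: (delta_mx 0 (lshift n 0) : 'rV[R]_(1 + n)) = row_mx (c%:M : 'M[R]_1) 0.
  by rewrite d0 scale_row_mx scaler0 scale_scalar_mx mulr1.
have dSh (c : R) k : c *: (delta_mx 0 (rshift 1 k) : 'rV[R]_(1 + n)) = row_mx (0%:M : 'M[R]_1) (c *: delta_mx 0 k).
  by rewrite dS scale_row_mx scale_scalar_mx mulr0.
have [->|[k ->]] : j = lshift n (0 : 'I_1) \/ exists k, j = rshift 1 k.
  have [k jk] : exists k : 'I_1 + 'I_n, j = unsplit k by exists (fintype.split (j : 'I_(1 + n))); rewrite splitK.
  case: k jk => k ->; last by right; exists k.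
  by left; rewrite (ord1 k).
- rewrite -[RHS](int01_shift h (lip1_slice hu)).
    congr int01; apply/funext => t; congr torus_Rint; apply/funext => y.
    rewrite /slice; congr u.
    by rewrite [X in _ + X]d0h [LHS]E addr0.
  move=> t; congr torus_Rint; apply/funext => y; rewrite /slice.
  rewrite -[RHS](pu _ (lshift n (0 : 'I_1))); congr u.
  by rewrite [X in _ = _ + X]d0 [RHS]E addr0.
- congr int01; apply/funext => t.
  rewrite -[RHS](ih _ k (rlip_slice t hu)).
    congr torus_Rint; apply/funext => y; rewrite /slice; congr u.
    by rewrite [X in _ + X]dSh [LHS]E addr0.
  move=> y i; rewrite /slice -[RHS](pu _ (rshift 1 i)); congr u.
  by rewrite [X in _ = _ + X]dS [RHS]E addr0.
Qed.

End TorusIntegral.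

(** * Bounded Lipschitz functions on the torus *)

Section BoundedLipschitz.
Context {R : realType}.

(** An algebra of functions (closed under products and, away from zero, under
    inverses) on which the iterated integral is linear. *)
Definition bl n (u : 'rV[R]_n -> R[i]) : Prop := exists2 M : R,
  (forall x, normc (u x) <= M) &
  (forall x y, normc (u x - u y) <= M * dist1 x y).

Lemma bl_ex n (u : 'rV[R]_n -> R[i]) (B L : R) : (forall x, normc (u x) <= B) ->
  (forall x y, normc (u x - u y) <= L * dist1 x y) -> bl u.
Proof.
move=> hB hL; exists (Num.max B L) => [x|x y].
  by rewrite le_max hB.
by rewrite (le_trans (hL x y))// ler_wpM2r ?dist1_ge0// le_max lexx orbT.
Qed.

Lemma bl_cst n (z : R[i]) : bl (fun _ : 'rV[R]_n => z).
Proof.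
exists (normc z) => // x y; rewrite subrr normc0.
by rewrite mulr_ge0 ?dist1_ge0 ?normc_ge0.
Qed.

Lemma blD n (u v : 'rV[R]_n -> R[i]) : bl u -> bl v -> bl (fun x => u x + v x).
Proof.
move=> [M hM hM'] [N hN hN']; exists (M + N) => [x|x y].
  by rewrite (le_trans (le_normcD _ _))// lerD.
by rewrite opprD addrACA mulrDl (le_trans (le_normcD _ _))// lerD.
Qed.

Lemma blM n (u v : 'rV[R]_n -> R[i]) : bl u -> bl v -> bl (fun x => u x * v x).
Proof.
move=> [M hM hM'] [N hN hN'].
have M0 : 0 <= M by apply: le_trans (hM 0); exact: normc_ge0.
have N0 : 0 <= N by apply: le_trans (hN 0); exact: normc_ge0.
apply: (@bl_ex _ _ (M * N) (2 * (M * N))) => [x|x y].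
  by rewrite normcM ler_pM ?normc_ge0.
have -> : u x * v x - u y * v y = u x * (v x - v y) + (u x - u y) * v y by ring.
apply: le_trans (le_normcD _ _) _; rewrite !normcM.
have h1 : normc (u x) * normc (v x - v y) <= M * (N * dist1 x y).
  by rewrite ler_pM ?normc_ge0.
have h2 : normc (u x - u y) * normc (v y) <= (M * dist1 x y) * N.
  by rewrite ler_pM ?normc_ge0.
lra.
Qed.

Lemma blZ n z (u : 'rV[R]_n -> R[i]) : bl u -> bl (fun x => z * u x).
Proof. by apply: blM; exact: bl_cst. Qed.

Lemma blN n (u : 'rV[R]_n -> R[i]) : bl u -> bl (fun x => - u x).
Proof.
by move=> /(blZ (-1)) [M h1 h2]; exists M => [x|x y];
  [have := h1 x|have := h2 x y]; rewrite !mulN1r.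
Qed.

Lemma blB n (u v : 'rV[R]_n -> R[i]) : bl u -> bl v -> bl (fun x => u x - v x).
Proof. by move=> hu hv; apply: blD => //; exact: blN. Qed.

Lemma bl_sum n (I : Type) (s : seq I) (u : I -> 'rV[R]_n -> R[i]) :
  (forall i, bl (u i)) -> bl (fun x => \sum_(i <- s) u i x).
Proof.
move=> h; elim: s => [|i s ih].
  by under eq_fun do rewrite big_nil; exact: bl_cst.
by under eq_fun do rewrite big_cons; exact: blD.
Qed.

Lemma bl_shift n (u : 'rV[R]_n -> R[i]) z : bl u -> bl (fun x => u (x + z)).
Proof.
move=> [M h1 h2]; exists M => [//|x y]; apply: le_trans (h2 _ _) _.
rewrite /dist1; under eq_bigr do rewrite !mxE opprD addrACA subrr addr0.
exact: lexx.
Qed.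

Lemma bl_inv n (u : 'rV[R]_n -> R[i]) (c : R) : bl u -> 0 < c ->
  (forall x, c <= normc (u x)) -> bl (fun x => (u x)^-1).
Proof.
move=> [M hM hM'] c0 hc.
have u0 x : u x != 0.
  by apply: contraTneq (hc x) => ->; rewrite normc0 -ltNge.
have iu x : normc (u x)^-1 <= c^-1.
  by rewrite normcV lef_pV2// posrE (lt_le_trans c0).
apply: (@bl_ex _ _ c^-1 (c^-1 * M * c^-1)) => // x y.
have -> : (u x)^-1 - (u y)^-1 = (u x)^-1 * (u y - u x) * (u y)^-1.
  by field; rewrite !u0.
rewrite !normcM -[leRHS]mulrA (mulrC c^-1 (dist1 _ _)) mulrA.
rewrite ler_pM ?mulr_ge0 ?normc_ge0// -mulrA ler_pM ?normc_ge0//.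
by rewrite -normcN opprB.
Qed.

Lemma bl_Re n (u : 'rV[R]_n -> R[i]) : bl u ->
  exists L, rlip L (fun x => complex.Re (u x)).
Proof.
move=> [M _ h]; exists M => x y; apply: le_trans (h x y).
by rewrite -ReN -ReD; exact: Re_le_normc.
Qed.

Lemma bl_Im n (u : 'rV[R]_n -> R[i]) : bl u ->
  exists L, rlip L (fun x => complex.Im (u x)).
Proof.
move=> [M _ h]; exists M => x y; apply: le_trans (h x y).
by rewrite -ImN -ImD; exact: Im_le_normc.
Qed.

Lemma torus_intD n (u v : 'rV[R]_n -> R[i]) : bl u -> bl v ->
  torus_int (fun x => u x + v x) = torus_int u + torus_int v.
Proof.
move=> hu hv; apply: eqc => /=.
  have [L hL] := bl_Re hu; have [M hM] := bl_Re hv.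
  rewrite -(torus_RintD hL hM); congr torus_Rint.
  by apply/funext => x; rewrite ReD.
have [L hL] := bl_Im hu; have [M hM] := bl_Im hv.
rewrite -(torus_RintD hL hM); congr torus_Rint.
by apply/funext => x; rewrite ImD.
Qed.

Lemma torus_intZ n z (u : 'rV[R]_n -> R[i]) : bl u ->
  torus_int (fun x => z * u x) = z * torus_int u.
Proof.
move=> hu; have [L hL] := bl_Re hu; have [M hM] := bl_Im hu; apply: eqc.
  rewrite ReM /= -(torus_RintZ _ hL) -(torus_RintZ _ hM) -mulN1r.
  rewrite -(torus_RintZ _ (rlipZ _ hM)) -(torus_RintD (rlipZ _ hL) (rlipZ _ (rlipZ _ hM))).
  by congr torus_Rint; apply/funext => x; rewrite ReM mulN1r.
rewrite ImM /= -(torus_RintZ _ hL) -(torus_RintZ _ hM).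
rewrite -(torus_RintD (rlipZ _ hM) (rlipZ _ hL)).
by congr torus_Rint; apply/funext => x; rewrite ImM.
Qed.

Lemma torus_intN n (u : 'rV[R]_n -> R[i]) : bl u ->
  torus_int (fun x => - u x) = - torus_int u.
Proof.
move=> hu; rewrite -mulN1r -torus_intZ//.
by congr torus_int; apply/funext => x; rewrite mulN1r.
Qed.

Lemma torus_intB n (u v : 'rV[R]_n -> R[i]) : bl u -> bl v ->
  torus_int (fun x => u x - v x) = torus_int u - torus_int v.
Proof. by move=> hu hv; rewrite torus_intD ?torus_intN//; exact: blN. Qed.

Lemma torus_int_cst n z : torus_int (fun _ : 'rV[R]_n => z) = z.
Proof. by apply: eqc; rewrite /= torus_Rint_cst. Qed.

Lemma torus_int_sum n (I : Type) (s : seq I) (u : I -> 'rV[R]_n -> R[i]) :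
  (forall i, bl (u i)) ->
  torus_int (fun x => \sum_(i <- s) u i x) = \sum_(i <- s) torus_int (u i).
Proof.
move=> h; elim: s => [|i s ih].
  by rewrite big_nil -[RHS](torus_int_cst n); congr torus_int; apply/funext => x; rewrite big_nil.
rewrite big_cons -ih -torus_intD//; last exact: bl_sum.
by congr torus_int; apply/funext => x; rewrite big_cons.
Qed.

Lemma torus_int_bound n M (u : 'rV[R]_n -> R[i]) : bl u ->
  (forall x, normc (u x) <= M) -> normc (torus_int u) <= 2 * M.
Proof.
move=> hu h; have [L hL] := bl_Re hu; have [L' hL'] := bl_Im hu.
apply: le_trans (normc_le_ReIm _) _.
have h1 : `|torus_Rint (fun x => complex.Re (u x))| <= M.
  by apply: (torus_Rint_bound hL) => x; apply: le_trans (h x); exact: Re_le_normc.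
have h2 : `|torus_Rint (fun x => complex.Im (u x))| <= M.
  by apply: (torus_Rint_bound hL') => x; apply: le_trans (h x); exact: Im_le_normc.
by move: h1 h2 => /=; lra.
Qed.

Lemma torus_int_shift n (u : 'rV[R]_n -> R[i]) (j : 'I_n) (h : R) :
  bl u -> zperiodic u ->
  torus_int (fun x => u (x + h *: delta_mx 0 j)) = torus_int u.
Proof.
move=> hu pu; have [L hL] := bl_Re hu; have [M hM] := bl_Im hu.
apply: eqc => /=.
  rewrite (torus_Rint_shift (u := fun x => complex.Re (u x)) j h hL)//.
  by move=> x i; rewrite pu.
rewrite (torus_Rint_shift (u := fun x => complex.Im (u x)) j h hM)//.
by move=> x i; rewrite pu.
Qed.

End BoundedLipschitz.

(** * Characters *)

Section Characters.
Context {R : realType}.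

Lemma expiD (s t : R) : expi (s + t) = expi s * expi t.
Proof. by apply: eqc; rewrite ?ReM ?ImM /= ?cosD ?sinD // addrC [X in _ + X]mulrC. Qed.

Lemma expi0 : expi (0 : R) = 1.
Proof. by rewrite /expi cos0 sin0. Qed.

Lemma expiN (t : R) : expi (- t) = conjc (expi t).
Proof. by rewrite /expi cosN sinN. Qed.

Lemma normc_expi (t : R) : normc (expi t) = 1.
Proof. by rewrite /= cos2Dsin2 sqrtr1. Qed.

Lemma expi_2pi (q : int) : expi (2 * pi * q%:~R : R) = 1.
Proof.
have e1 : expi (2 * pi : R) = 1 by rewrite /expi mulr_natl cos2pi sin2pi.
have en (k : nat) : expi (2 * pi * k%:R : R) = 1.
  elim: k => [|k ih]; first by rewrite mulr0 expi0.
  by rewrite -(addn1 k) natrD mulrDr expiD ih mulr1 e1 mul1r.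
case: q => k; first exact: en.
by rewrite NegzE mulrNz mulrN expiN en; apply: eqc; rewrite //= oppr0.
Qed.

Lemma lipschitz_deriv (f df : R -> R) (M : R) :
  (forall x : R, is_derive x (1 : R) f (df x)) -> (forall x, `|df x| <= M) ->
  forall a b, `|f b - f a| <= M * `|b - a|.
Proof.
move=> hd hM.
have cf : continuous f.
  by move=> x; apply: differentiable_continuous; apply/derivable1_diffP; have [] := hd x.
suff H a b : a <= b -> `|f b - f a| <= M * `|b - a|.
  move=> a b; case: (leP a b) => [/H//|/ltW /H].
  by rewrite distrC (distrC a b).
move=> ab; have [c _ ->] := @MVT_segment R f df a b ab
   (fun x _ => hd x) (continuous_subspaceT cf).
by rewrite normrM ler_wpM2r.
Qed.

Lemma expi_lip (s t : R) : normc (expi s - expi t) <= 2 * `|s - t|.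
Proof.
apply: le_trans (normc_le_ReIm _) _ => /=.
have h1 : `|cos s - cos t| <= 1 * `|s - t|.
  apply: (lipschitz_deriv (df := fun x => - sin x)) => x.
  by rewrite normrN ler_norml sin_geN1 sin_le1.
have h2 : `|sin s - sin t| <= 1 * `|s - t|.
  apply: (lipschitz_deriv (df := fun x => cos x)) => x.
  by rewrite ler_norml cos_geN1 cos_le1.
lra.
Qed.

Definition nrm n (k : 'rV[int]_n) : nat := (\sum_j `|k 0%R j|%N)%N.

Lemma dotD n (k l : 'rV[int]_n) (x : 'rV[R]_n) : dot (k + l) x = dot k x + dot l x.
Proof.
rewrite /dot -big_split /=; apply: eq_bigr => j _.
by rewrite !mxE intrD mulrDl.
Qed.

Lemma dotN n (k : 'rV[int]_n) (x : 'rV[R]_n) : dot (- k) x = - dot k x.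
Proof.
rewrite /dot -sumrN; apply: eq_bigr => j _.
by rewrite !mxE mulrNz mulNr.
Qed.

Lemma dot_shift n (k : 'rV[int]_n) (x : 'rV[R]_n) (h : R) j :
  dot k (x + h *: delta_mx 0 j) = dot k x + (k 0 j)%:~R * h.
Proof.
rewrite /dot; under eq_bigr do rewrite !mxE mulrDr.
rewrite big_split /=; congr (_ + _).
rewrite (bigD1 j)//= !eqxx mulr1 big1 ?addr0// => i /negbTE ->.
by rewrite ?andbF !mulr0.
Qed.

Lemma dist_dot n (k : 'rV[int]_n) (x y : 'rV[R]_n) :
  `|dot k x - dot k y| <= (nrm k)%:R * dist1 x y.
Proof.
rewrite /dot -sumrB (le_trans (ler_norm_sum _ _ _))// /dist1 mulr_sumr.
apply: ler_sum => j _; rewrite -mulrBr normrM ler_wpM2r//.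
rewrite -intr_norm -natr_absz ler_nat /nrm (bigD1 j)//= leq_addr//.
Qed.

Definition chi n (k : 'rV[int]_n) (x : 'rV[R]_n) : R[i] := expi (2 * pi * dot k x).

Lemma chiD n (k l : 'rV[int]_n) x : chi (k + l) x = chi k x * chi l x.
Proof. by rewrite /chi dotD mulrDr expiD. Qed.

Lemma chi0 n x : chi (0 : 'rV[int]_n) x = 1.
Proof.
by rewrite /chi /dot big1 ?mulr0 ?expi0// => j _; rewrite mxE mul0r.
Qed.

Lemma chiNM n (k : 'rV[int]_n) x : chi k x * chi (- k) x = 1.
Proof. by rewrite -chiD subrr chi0. Qed.

Lemma normc_chi n (k : 'rV[int]_n) x : normc (chi k x) = 1.
Proof. exact: normc_expi. Qed.

Lemma chi_shift n (k : 'rV[int]_n) x h j :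
  chi k (x + h *: delta_mx 0 j) = expi (2 * pi * ((k 0 j)%:~R * h)) * chi k x.
Proof. by rewrite /chi dot_shift mulrDr expiD mulrC. Qed.

Lemma chi_periodic n (k : 'rV[int]_n) : zperiodic (chi k).
Proof.
by move=> x j; have := chi_shift k x 1 j; rewrite scale1r mulr1 expi_2pi mul1r.
Qed.

Lemma chi_lip n (k : 'rV[int]_n) x y :
  normc (chi k x - chi k y) <= 4 * pi * (nrm k)%:R * dist1 x y.
Proof.
apply: le_trans (expi_lip _ _) _.
rewrite -mulrBr normrM ger0_norm ?mulr_ge0 ?pi_ge0//.
have := dist_dot k x y; rewrite -!mulrA => h.
have : 2 * pi * `|dot k x - dot k y| <= 2 * pi * ((nrm k)%:R * dist1 x y).
  by rewrite ler_wpM2l ?mulr_ge0 ?pi_ge0.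
lra.
Qed.

Lemma bl_chi n (k : 'rV[int]_n) : bl (chi k).
Proof.
apply: (@bl_ex _ _ _ 1) => [x|x y]; last exact: chi_lip.
by rewrite normc_chi.
Qed.

Lemma zperiodicM n (u v : 'rV[R]_n -> R[i]) : zperiodic u -> zperiodic v ->
  zperiodic (fun x => u x * v x).
Proof. by move=> hu hv x j; rewrite hu hv. Qed.

(** Translating by half a period flips the sign of a character with
    [k 0 j != 0], so translation invariance alone gives orthogonality and the
    decay of Fourier coefficients. *)
Lemma chi_half n (k : 'rV[int]_n) x j : k 0 j != 0 ->
  chi k (x + (2 * `|k 0 j|%:~R)^-1 *: delta_mx 0 j) = - chi k x.
Proof.
move=> k0; rewrite chi_shift -mulN1r; congr (_ * _).
have q0 : `|k 0 j|%:~R != 0 :> R by rewrite intr_eq0 normr_eq0.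
have -> : 2 * pi * ((k 0 j)%:~R * (2 * `|k 0 j|%:~R)^-1) = (Num.sg (k 0 j))%:~R * pi :> R.
  rewrite {1}[k 0 j]numEsg intrM; field; exact: q0.
have epi : expi (pi : R) = -1 by rewrite /expi cospi sinpi; apply: eqc; rewrite //= oppr0.
case: sgrP k0 => // _ _; first by rewrite mul1r.
by rewrite mulN1r expiN epi; apply: eqc; rewrite //= !oppr0.
Qed.

Lemma torus_int_chi n (k : 'rV[int]_n) :
  torus_int (chi k) = (k == 0)%:R.
Proof.
case: eqP => [->|/eqP k0].
  rewrite (_ : chi 0 = fun=> 1) ?torus_int_cst//.
  by apply/funext => x; exact: chi0.
have [j kj] : exists j, k 0 j != 0.
  apply: contrapT => h; case/negP: k0; apply/eqP/rowP => j; rewrite mxE.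
  by apply/eqP; apply: contrapT => /negP hj; apply: h; exists j.
have := torus_int_shift j (2 * `|k 0 j|%:~R)^-1 (bl_chi k) (chi_periodic k).
under eq_fun do rewrite chi_half//.
rewrite torus_intN; last exact: bl_chi.
by move=> /eqP; rewrite eq_sym -addr_eq0 -mulr2n mulrn_eq0 /= => /eqP.
Qed.

Definition fcoef n (u : 'rV[R]_n -> R[i]) (k : 'rV[int]_n) : R[i] :=
  torus_int (fun x => u x * chi (- k) x).

End Characters.

(** * Uniqueness of Fourier coefficients *)

Section Uniqueness.
Context {R : realType}.

Lemma zperiodic_int n (T : Type) (u : 'rV[R]_n -> T) j : zperiodic u ->
  forall (q : int) x, u (x + q%:~R *: delta_mx 0 j) = u x.
Proof.
move=> pu.
have pn (k : nat) x : u (x + k%:R *: delta_mx 0 j) = u x.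
  elim: k x => [|k ih] x; first by rewrite scale0r addr0.
  by rewrite -(addn1 k) natrD scalerDl scale1r addrA pu ih.
case=> k x; first exact: pn.
by rewrite NegzE mulrNz -[LHS](pn k.+1) -addrA -scalerDl addNr scale0r addr0.
Qed.

Lemma le_Re_torus_int n (u v : 'rV[R]_n -> R[i]) : bl u -> bl v ->
  (forall x, complex.Re (u x) <= complex.Re (v x)) ->
  complex.Re (torus_int u) <= complex.Re (torus_int v).
Proof.
move=> hu hv uv; have [L hL] := bl_Re hu; have [M hM] := bl_Re hv.
exact: (le_torus_Rint hL hM).
Qed.

Definition kz (q : int) : 'rV[int]_1 := const_mx q.

Lemma kzB (p q : int) : kz p - kz q = kz (p - q).
Proof. by apply/rowP => j; rewrite !mxE. Qed.

Lemma chi_kz (q : int) (x : 'rV[R]_1) : chi (kz q) x = expi (2 * pi * (q%:~R * x 0 0)).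
Proof. by rewrite /chi /dot big_ord1 mxE. Qed.

Definition dirichlet (N : nat) (x : 'rV[R]_1) : R[i] := \sum_(j < N) chi (kz j%:Z) x.

Lemma dirichlet_mul N x : dirichlet N x * (chi (kz 1) x - 1) = chi (kz N%:Z) x - 1.
Proof.
elim: N => [|N ih]; first by rewrite /dirichlet big_ord0 mul0r chi_kz mul0r mulr0 expi0 subrr.
rewrite /dirichlet big_ord_recr /= mulrDl ih mulrBr -chiD mulr1.
have -> : kz N%:Z + kz 1 = kz N.+1%:Z.
  by apply/rowP => j; rewrite !mxE -addn1 PoszD.
by rewrite addrC addrA subrK.
Qed.

(** Fejer's kernel, up to the factor [N], written as a trigonometric polynomial;
    by [fejerE] it is the squared modulus of the Dirichlet kernel. *)
Definition fejer N (x : 'rV[R]_1) : R[i] :=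
  \sum_(j < N) \sum_(l < N) chi (kz j%:Z - kz l%:Z) x.

Lemma fejerE N x : fejer N x = (normc (dirichlet N x) ^+ 2)%:C.
Proof.
have -> : fejer N x = dirichlet N x * conjc (dirichlet N x).
  rewrite /fejer /dirichlet rmorph_sum /= mulr_suml; apply: eq_bigr => j _.
  rewrite mulr_sumr; apply: eq_bigr => l _; rewrite chiD; congr (_ * _).
  by rewrite /chi dotN mulrN expiN.
by case: (dirichlet N x) => a b; rewrite /= sqr_sqrtr ?addr_ge0 ?sqr_ge0//; apply: eqc; rewrite /=; ring.
Qed.

Lemma bl_fejer N : bl (fejer N).
Proof. by do 2!apply: bl_sum => ?; exact: bl_chi. Qed.

Lemma torus_int_fejer N : torus_int (fejer N) = N%:R.
Proof.
rewrite torus_int_sum => [|j]; last by apply: bl_sum => ?; exact: bl_chi.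
transitivity (\sum_(j < N) (1 : R[i])); last first.
  by rewrite sumr_const card_ord.
apply: eq_bigr => j _; rewrite torus_int_sum => [|l]; last exact: bl_chi.
rewrite (bigD1 j)//= torus_int_chi subrr eqxx big1 ?addr0// => l lj.
rewrite torus_int_chi kzB (_ : _ == _ = false)//; apply/negbTE.
apply: contra lj => /eqP/rowP/(_ 0); rewrite !mxE => /eqP.
by rewrite subr_eq0 eqz_nat => /eqP jl; apply/eqP/val_inj.
Qed.

Lemma torus_int_mul_fejer N (u : 'rV[R]_1 -> R[i]) : bl u ->
  (forall k, torus_int (fun x => u x * chi k x) = 0) ->
  torus_int (fun x => u x * fejer N x) = 0.
Proof.
move=> hu u0.
have -> : (fun x => u x * fejer N x) =
    fun x => \sum_(j < N) \sum_(l < N) u x * chi (kz j%:Z - kz l%:Z) x.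
  apply/funext => x; rewrite mulr_sumr; apply: eq_bigr => j _.
  by rewrite mulr_sumr.
rewrite torus_int_sum => [|j]; last first.
  by apply: bl_sum => l; apply: blM => //; exact: bl_chi.
apply: big1 => j _; rewrite torus_int_sum => [|l]; last first.
  by apply: blM => //; exact: bl_chi.
by apply: big1 => l _; exact: u0.
Qed.

(** Fejer's kernel is small away from the lattice points, in a form that needs
    no integration: the factor [chi 1 - 1] telescopes the Dirichlet kernel. *)
Lemma fejer_concentrated N x : normc (chi (kz 1) x - 1) ^+ 2 * normc (dirichlet N x) ^+ 2 <= 4.
Proof.
rewrite -exprMn -normcM mulrC dirichlet_mul.
have h : normc (chi (kz N%:Z) x - 1) <= 2.
  by apply: le_trans (le_normcB _ _) _; rewrite normc_chi normc1.
have h0 := normc_ge0 (chi (kz N%:Z) x - 1).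
by nra.
Qed.

Lemma normc_chi1_sq (x : 'rV[R]_1) : normc (chi (kz 1) x - 1) ^+ 2 = 2 - 2 * cos (2 * pi * x 0 0).
Proof.
rewrite chi_kz mul1r /= sqr_sqrtr ?addr_ge0 ?sqr_ge0//.
have := cos2Dsin2 (2 * pi * x 0 0); move: (cos _) (sin _) => c s h.
by rewrite subr0; nra.
Qed.

Lemma chi1_sep (e : R) (x : 'rV[R]_1) : 0 < e -> e <= 2^-1 -> e <= x 0 0 -> x 0 0 <= 1 - e ->
  0 < 2 - 2 * cos (2 * pi * e) <= normc (chi (kz 1) x - 1) ^+ 2.
Proof.
move=> e0 e2 ex xe; rewrite normc_chi1_sq; have p0 : 0 < pi :> R by exact: pi_gt0.
have lecos (a b : R) : 0 <= a -> a <= b -> b <= pi -> cos b <= cos a.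
  move=> a0 ab bp; move: ab; rewrite le_eqVlt => /predU1P[->//|ab].
  by rewrite ltW// ltr_cos// in_itv/=; apply/andP; split; lra.
have mon (s t : R) : s <= t -> 2 * pi * s <= 2 * pi * t.
  by move=> st; rewrite ler_wpM2l// mulr_ge0// ltW.
have half : 2 * pi * 2^-1 = pi :> R by field.
have ge0 (t : R) : 0 <= t -> 0 <= 2 * pi * t by move=> t0; rewrite !mulr_ge0// ltW.
apply/andP; split.
  suff : cos (2 * pi * e) < 1 by lra.
  have a0 : 0 < 2 * pi * e by rewrite !mulr_gt0.
  have ap : 2 * pi * e <= pi by rewrite -[leRHS]half mon.
  by rewrite -[ltRHS]cos0 ltr_cos ?in_itv/= ?lexx ?pi_ge0 ?(ltW a0) ?ap.
suff : cos (2 * pi * x 0 0) <= cos (2 * pi * e) by lra.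
have [xh|/ltW xh] := leP (x 0 0) 2^-1.
  by apply: lecos; [apply: ge0; lra|exact: mon|rewrite -[leRHS]half mon].
have -> : cos (2 * pi * x 0 0) = cos (2 * pi * (1 - x 0 0)).
  by rewrite mulrBr mulr1 cosB mulr_natl cos2pi sin2pi mul1r mul0r addr0.
by apply: lecos; [apply: ge0; lra|apply: mon; lra|rewrite -[leRHS]half; apply: mon; lra].
Qed.

(** Integrating [u 0 - u x] against Fejer's kernel gives [N * u 0], because the
    coefficients of [u] vanish. Near the lattice points [u 0 - u x] is small;
    elsewhere it is dominated by a multiple of [|chi 1 x - 1| ^ 2], which costs
    a bounded contribution. Dividing by [N] leaves an arbitrarily small bound. *)
Lemma Re_le0 (u : 'rV[R]_1 -> R[i]) : bl u -> zperiodic u ->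
  (forall k, torus_int (fun x => u x * chi k x) = 0) -> complex.Re (u 0) <= 0.
Proof.
move=> hu pu u0; have [K hK hL] := hu.
have K0 : 0 <= K by apply: le_trans (hK 0); exact: normc_ge0.
apply/ler_addgt0Pr => d d0; rewrite add0r.
pose e := Num.min 2^-1 (d / (2 * (K + 1))).
have e0 : 0 < e by rewrite lt_min invr_gt0 ltr0n divr_gt0 ?mulr_gt0//; lra.
have e2 : e <= 2^-1 by rewrite ge_min lexx.
have eK : K * e <= d / 2.
  apply: (@le_trans _ _ ((K + 1) * (d / (2 * (K + 1))))).
    rewrite ler_pM//; [exact: ltW|lra|by rewrite ge_min lexx orbT].
  by rewrite le_eqVlt; apply/orP; left; apply/eqP; field; rewrite gt_eqF//; lra.
set c : R := 2 - 2 * cos (2 * pi * e).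
have c0 : 0 < c.
  have := @chi1_sep e (const_mx e) e0 e2; rewrite mxE lexx.
  by move=> /(_ isT (ltac:(lra))) /andP[].
pose M := 2 * K / c.
have M0 : 0 <= M by rewrite divr_ge0 ?mulr_ge0// ltW.
have dom x : complex.Re (u 0 - u x) <= d / 2 + M * normc (chi (kz 1) x - 1) ^+ 2.
  have close (y : 'rV[R]_1) : `|y 0 0| <= e -> u y = u x ->
      complex.Re (u 0 - u x) <= d / 2 + M * normc (chi (kz 1) x - 1) ^+ 2.
    move=> ye <-; apply: (@le_trans _ _ (d / 2)); last first.
      by rewrite lerDl mulr_ge0// sqr_ge0.
    apply: le_trans (ler_norm _) _; apply: le_trans (Re_le_normc _) _.
    apply: le_trans (hL _ _) _; apply: le_trans eK.
    by rewrite ler_wpM2l// /dist1 big_ord1 mxE sub0r normrN.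
  pose y := x + (- Num.floor (x 0 0))%:~R *: delta_mx 0 0.
  have uy : u y = u x by exact: zperiodic_int.
  have cy : chi (kz 1) y = chi (kz 1) x by apply: zperiodic_int; exact: chi_periodic.
  have y0 : y 0 0 = x 0 0 - (Num.floor (x 0 0))%:~R by rewrite !mxE /= mulr1 mulrNz.
  have yge : 0 <= y 0 0 by rewrite y0 subr_ge0 floor_le.
  have ylt : y 0 0 < 1.
    by rewrite y0 ltrBlDl -[X in _ + X]/(1%:~R) -intrD floorD1_gt.
  have [ye|ye] := leP (y 0 0) e; first by apply: (close y) => //; rewrite ger0_norm.
  have [ye'|ye'] := leP (1 - e) (y 0 0).
    pose z := y + (-1)%:~R *: delta_mx 0 0.
    have z0 : z 0 0 = y 0 0 - 1 by rewrite [LHS]mxE; congr (_ + _); rewrite !mxE /= mulr1 mulrNz.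
    apply: (close z); last by rewrite -uy /z; exact: (zperiodic_int _ pu).
    by rewrite z0 ler0_norm; [lra|lra].
  have /andP[_ sep] := chi1_sep e0 e2 (ltW ye) (ltW ye').
  rewrite cy -/c in sep.
  have h1 : complex.Re (u 0 - u x) <= 2 * K.
    apply: le_trans (ler_norm _) _; apply: le_trans (Re_le_normc _) _.
    apply: le_trans (le_normcB _ _) _; have := hK 0; have := hK x; lra.
  have h2 : 2 * K <= M * normc (chi (kz 1) x - 1) ^+ 2.
    apply: (@le_trans _ _ (M * c)); last by rewrite ler_wpM2l.
    by rewrite /M divfK// gt_eqF.
  lra.
have main N : (0 < N)%N -> complex.Re (u 0) * N%:R <= d / 2 * N%:R + 4 * M.
  move=> N0; have bf := bl_fejer N.
  have blA : bl (fun x => (u 0 - u x) * fejer N x).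
    by apply: blM => //; apply: blB => //; exact: bl_cst.
  have blB' : bl (fun x : 'rV[R]_1 => (d / 2)%:C * fejer N x + (4 * M)%:C).
    by apply: blD; [apply: blZ|exact: bl_cst].
  have H : complex.Re (torus_int (fun x => (u 0 - u x) * fejer N x)) <=
      complex.Re (torus_int (fun x : 'rV[R]_1 => (d / 2)%:C * fejer N x + (4 * M)%:C)).
    apply: le_Re_torus_int => // x; rewrite !fejerE [leLHS]ReM [leRHS]ReD [complex.Re (_ %:C * _)]ReM /= !mulr0 !subr0.
    have := dom x; have := fejer_concentrated N x.
    move: (complex.Re _) (normc (chi _ _ - 1) ^+ 2) => a b.
    have : 0 <= normc (dirichlet N x) ^+ 2 by exact: sqr_ge0.
    move: (normc _ ^+ 2) => f f0 hbf h.
    apply: (@le_trans _ _ ((d / 2 + M * b) * f)); first by rewrite ler_wpM2r.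
    rewrite mulrDl lerD2l -mulrA mulrC ler_wpM2r//.
  move: H.
  have -> : torus_int (fun x => (u 0 - u x) * fejer N x) = u 0 * N%:R.
    rewrite (_ : (fun x => _) = fun x => u 0 * fejer N x - u x * fejer N x).
      rewrite torus_intB; do ?[exact: blM|exact: blZ].
      by rewrite (torus_int_mul_fejer N hu u0) subr0 torus_intZ// torus_int_fejer.
    by apply/funext => x; rewrite mulrBl.
  rewrite torus_intD; [|exact: blZ|exact: bl_cst].
  rewrite torus_intZ// torus_int_fejer torus_int_cst.
  have -> : N%:R = (N%:R : R)%:C :> R[i] by rewrite rmorph_nat.
  by rewrite ReM ReD ReM /= !mulr0 !subr0.
pose N := (Num.truncn (8 * M / d)).+1.
have hN : 8 * M / d < N%:R.
  by have /andP[] := truncn_itv (divr_ge0 (mulr_ge0 (ler0n _ 8) M0) (ltW d0)).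
have N0 : 0 < N%:R :> R by rewrite ltr0n.
have := main N isT; rewrite ltr_pdivrMr// in hN.
rewrite -(ler_pM2r N0) => h; nra.
Qed.

Lemma uniqueness1 (u : 'rV[R]_1 -> R[i]) : bl u -> zperiodic u ->
  (forall k, torus_int (fun x => u x * chi k x) = 0) -> forall x, u x = 0.
Proof.
move=> hu pu u0 x.
(* A complex number all of whose rotations have nonpositive real part is 0. *)
have H z : complex.Re (z * u x) <= 0.
  pose v y := z * u (y + x).
  have -> : z * u x = v 0 by rewrite /v add0r.
  apply: Re_le0.
  - by apply: blZ; exact: bl_shift.
  - by move=> y j; rewrite /v addrAC pu.
  - move=> k.
    have -> : (fun y => v y * chi k y) =
      (fun y => (z * chi (- k) x) * (u (y + x) * chi k (y + x))).
      apply/funext => y; rewrite /v.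
      have -> : chi k (y + x) = chi k y * chi k x.
        by rewrite /chi -expiD -mulrDr /dot -big_split /=; congr (expi (_ * _)); apply: eq_bigr => j _; rewrite !mxE mulrDr.
      transitivity (z * u (y + x) * chi k y * (chi k x * chi (- k) x)).
        by rewrite chiNM mulr1.
      by ring.
    have bluk : bl (fun y => u y * chi k y) by apply: blM => //; exact: bl_chi.
    rewrite torus_intZ; last exact: (bl_shift x bluk).
    have xE : x = x 0 0 *: delta_mx 0 0.
      by apply/rowP => j; rewrite !mxE ord1 eqxx mulr1.
    have := torus_int_shift 0 (x 0 0) bluk (zperiodicM pu (chi_periodic k)).
    by rewrite -xE u0 => ->; rewrite mulr0.
have := H 1; have := H (-1); have := H 'i; have := H (- 'i).
rewrite !(mulN1r, mul1r, mulNr) !ReN !ReM /= => h1 h2 h3 h4.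
by apply: eqc => /=; lra.
Qed.

Lemma torus_intS n (u : 'rV[R]_n.+1 -> R[i]) :
  torus_int u = torus_int (fun x : 'rV[R]_1 => torus_int (slice u (x 0 0))).
Proof.
have E (t : R) : (row_mx (t%:M : 'M[R]_1) (0 : 'rV[R]_0) : 'rV[R]_1) 0 0 = t.
  by rewrite mxE; case: splitP => // k _; rewrite mxE ord1.
apply: eqc.
  by rewrite /torus_int !torus_RintS; congr int01; apply/funext => t /=; rewrite /slice E.
by rewrite /torus_int !torus_RintS; congr int01; apply/funext => t /=; rewrite /slice E.
Qed.

Lemma chi_row n (q : int) (k : 'rV[int]_n) (t : R) (y : 'rV[R]_n) :
  chi (row_mx (q%:M : 'M[int]_1) k : 'rV[int]_n.+1) (row_mx (t%:M : 'M[R]_1) y) =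
  expi (2 * pi * (q%:~R * t)) * chi k y.
Proof.
rewrite /chi -expiD -mulrDr; congr (expi (_ * _)).
rewrite /dot big_ord_recl; congr (_ + _).
  by rewrite !mxE; case: splitP => // j _; rewrite !mxE ord1.
apply: eq_bigr => j _.
rewrite !mxE; case: splitP => l; first by rewrite ord1.
by rewrite /= /bump /= add1n => -[/val_inj ->].
Qed.

(** Integrating the inner variables against a character reduces to one
    variable; then the slices have vanishing coefficients in one variable
    less. *)
Lemma uniqueness n (u : 'rV[R]_n -> R[i]) : bl u -> zperiodic u ->
  (forall k, torus_int (fun x => u x * chi k x) = 0) -> forall x, u x = 0.
Proof.
elim: n u => [|n ih] u hu pu u0 x.
  have := u0 0.
  rewrite (_ : (fun x => _) = (fun=> u x)) ?torus_int_cst//.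
  by apply/funext => y; rewrite chi0 mulr1; congr u; apply/rowP => -[].
have [K hK hL] := hu.
have bl_slice t : bl (slice u t).
  exists K => [y|y z]; first exact: hK.
  by apply: le_trans (hL _ _) _; rewrite dist1_row subrr normr0 add0r.
have blc t k : bl (fun y => slice u t y * chi k y).
  by apply: blM => //; exact: bl_chi.
have per0 t y : u (row_mx ((t + 1)%:M : 'M[R]_1) y) = u (row_mx (t%:M : 'M[R]_1) y).
  rewrite -[RHS](pu _ (lshift n (0 : 'I_1))); congr u.
  apply/rowP => i; rewrite !mxE /=; case: splitP => k ik.
    by rewrite !mxE !ord1 /= (_ : i == _) //; apply/eqP/val_inj; rewrite /= ik ord1.
  by rewrite -!val_eqE /= ik /= addr0.
have per1 t y j : u (row_mx (t%:M : 'M[R]_1) (y + delta_mx 0 j)) = u (row_mx (t%:M : 'M[R]_1) y).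
  rewrite -[RHS](pu _ (rshift 1 j)); congr u.
  apply/rowP => i; rewrite !mxE /=; case: splitP => k ik.
    by rewrite !mxE !ord1 -!val_eqE /= ik ord1 /= addr0.
  by rewrite !mxE /= -!val_eqE /= ik eqSS.
have W0 k (t : R) : torus_int (fun y => slice u t y * chi k y) = 0.
  pose W (x : 'rV[R]_1) := torus_int (fun y => slice u (x 0 0) y * chi k y).
  have -> : torus_int (fun y => slice u t y * chi k y) = W (const_mx t) by rewrite /W mxE.
  apply: uniqueness1.
  - apply: (@bl_ex _ _ _ (2 * K) (2 * K)) => [z|z w].
      by apply: (torus_int_bound (blc _ _)) => y; rewrite normcM normc_chi mulr1; exact: hK.
    rewrite /W -torus_intB// -mulrA.
    apply: torus_int_bound => [|y]; first exact: blB.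
    rewrite -mulrBl normcM normc_chi mulr1; apply: le_trans (hL _ _) _.
    by rewrite dist1_row dist1xx addr0 /dist1 big_ord1.
  - move=> z j; rewrite /W; congr torus_int; apply/funext => y; congr (_ * _).
    by rewrite /slice !mxE !ord1 /= per0.
  - move=> q; rewrite -[RHS](u0 (row_mx ((q 0 0)%:M : 'M[int]_1) k)) [RHS]torus_intS.
    congr torus_int; apply/funext => z; rewrite /W mulrC -(torus_intZ _ (blc _ _)).
    congr torus_int; apply/funext => y; rewrite /slice chi_row.
    by rewrite (_ : chi q z = expi (2 * pi * ((q 0 0)%:~R * z 0 0))); [ring|rewrite /chi /dot big_ord1].
have -> : x = row_mx ((x 0 0)%:M : 'M[R]_1) (rsubmx (x : 'rV[R]_(1 + n))).
  apply/rowP => i; rewrite mxE; case: splitP => j ij.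
    by rewrite mxE ord1 mulr1n; congr (x _ _); apply/val_inj; rewrite /= ij ord1.
  by rewrite mxE; congr (x _ _); exact/val_inj.
apply: (ih (slice u (x 0 0))) => // y j; exact: per1.
Qed.

End Uniqueness.

(** * Fourier series with summable coefficients *)

Section FourierSeries.
Context {R : realType} {n : nat}.
Implicit Types (c f : 'rV[int]_n -> R[i]) (u v : 'rV[R]_n -> R[i]).

(** The extra factor makes the sum of the Fourier series Lipschitz. *)
Definition wsum c : Prop := asum (fun k => (1 + (nrm k)%:R) * normc (c k)).

Definition fser c (x : 'rV[R]_n) : R[i] := csum (fun k => c k * chi k x).

Lemma wsum_asumc c : wsum c -> asumc c.
Proof.
apply: asumc_le => k; rewrite mulrDl mul1r lerDl.
by rewrite mulr_ge0 ?normc_ge0.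
Qed.

Lemma asumc_chi c x : asumc c -> asumc (fun k => c k * chi k x).
Proof. by apply: asumc_le => k; rewrite normcM normc_chi mulr1. Qed.

Lemma fser_periodic c : zperiodic (fser c).
Proof. by move=> x j; apply: eq_csum => k; rewrite chi_periodic. Qed.

Lemma bl_fser c : wsum c -> bl (fser c).
Proof.
move=> hw; have hc := wsum_asumc hw.
set S := rsum (fun k => (1 + (nrm k)%:R) * normc (c k)).
apply: (@bl_ex _ _ _ (2 * S) (8 * pi * S)) => [x|x y].
  apply: le_trans (le_normc_csum (asumc_chi x hc)) _; rewrite ler_pM2l//.
  apply: ler_rsum => [k||]; last exact: hw.
    by rewrite normcM normc_chi mulr1 mulrDl mul1r lerDl mulr_ge0 ?normc_ge0.
  exact: asumc_chi.
have hx := asumc_chi x hc; have hy := asumc_chi y hc.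
rewrite /fser -csumB//.
have hxy : asumc (fun k => c k * chi k x - c k * chi k y).
  by apply: asumcD => //; exact: asumcN.
apply: le_trans (le_normc_csum hxy) _.
have -> : 8 * pi * S * dist1 x y =
    2 * ((4 * pi * dist1 x y) * S) by ring.
rewrite ler_pM2l// /S -rsumZ//; apply: ler_rsum => //; last exact: asumZ.
move=> k; rewrite -mulrBr normcM.
have h0 := normc_ge0 (c k); have h := chi_lip k x y; have d0 := dist1_ge0 x y.
have p0 : 0 <= pi :> R by exact: pi_ge0.
have pd : 0 <= 4 * pi * dist1 x y by rewrite !mulr_ge0.
apply: (@le_trans _ _ (normc (c k) * (4 * pi * (nrm k)%:R * dist1 x y))).
  by rewrite ler_wpM2l.
have -> : 4 * pi * dist1 x y * ((1 + (nrm k)%:R) * normc (c k)) =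
  normc (c k) * (4 * pi * (nrm k)%:R * dist1 x y) + (4 * pi * dist1 x y) * normc (c k) by ring.
by rewrite lerDl mulr_ge0.
Qed.

(** The partial sums converge uniformly, with an error governed by the tail of
    the coefficients. *)
Lemma torus_int_fser c u : wsum c -> bl u ->
  torus_int (fun x => u x * fser c x) =
  csum (fun k => c k * torus_int (fun x => u x * chi k x)).
Proof.
move=> hw hu; have hc := wsum_asumc hw; have [M hM _] := hu.
have M0 : 0 <= M by apply: le_trans (hM 0); exact: normc_ge0.
have blk k : bl (fun x => u x * chi k x) by apply: blM => //; exact: bl_chi.
have bls := bl_fser hw.
have boundk k : normc (torus_int (fun x => u x * chi k x)) <= 2 * M.
  by apply: torus_int_bound => // x; rewrite normcM normc_chi mulr1.
set A := torus_int _; set B := csum _.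
suff H (e : R) : 0 < e -> normc (A - B) <= (8 * M) * e.
  have : normc (A - B) <= 0.
    apply/ler_addgt0Pr => d d0; rewrite add0r.
    have K0 : 0 < 8 * M + 1 by lra.
    apply: le_trans (H (d / (8 * M + 1)) (divr_gt0 d0 K0)) _.
    by rewrite mulrA ler_pdivrMr// mulrC ler_wpM2l; [lra|exact: ltW|lra].
  by rewrite le_eqVlt ltNge normc_ge0 orbF => /eqP/eq0_normc/eqP; rewrite subr_eq0 => /eqP.
move=> e0; have [F hF] := csum_approx hc e0.
set tl := rsum _ in hF.
have -> : A - B = torus_int (fun x => u x * (fser c x - \sum_(k <- F) c k * chi k x))
   - (B - \sum_(k <- F) c k * torus_int (fun x => u x * chi k x)).
  have -> : (fun x => u x * (fser c x - \sum_(k <- F) c k * chi k x)) =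
      (fun x => u x * fser c x - \sum_(k <- F) c k * (u x * chi k x)).
    apply/funext => x; rewrite mulrBr mulr_sumr; congr (_ - _).
    by apply: eq_bigr => k _; rewrite mulrCA.
  rewrite torus_intB; [|exact: blM|by apply: bl_sum => k; exact: blZ].
  rewrite torus_int_sum => [|k]; last exact: blZ.
  rewrite (eq_bigr (fun k => c k * torus_int (fun x => u x * chi k x))) => [|k _].
    by rewrite /A; ring.
  exact: torus_intZ.
apply: le_trans (le_normcB _ _) _.
have h1 : normc (torus_int (fun x => u x * (fser c x - \sum_(k <- F) c k * chi k x)))
    <= 2 * (M * (2 * tl)).
  apply: torus_int_bound => [|x].
    apply: blM => //; apply: blB => //; apply: bl_sum => k; apply: blZ.
    exact: bl_chi.
  rewrite normcM ler_pM ?normc_ge0//.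
  by apply: csum_tail => // k; rewrite normcM normc_chi mulr1.
have h2 : normc (B - \sum_(k <- F) c k * torus_int (fun x => u x * chi k x))
    <= 2 * (2 * M * tl).
  have hcM : asumc (fun k => (2 * M)%:C * c k) by exact: asumcZ.
  apply: le_trans (csum_tail F hcM _) _.
    move=> k; rewrite !normcM normcR ger0_norm ?mulr_ge0// mulrC.
    by rewrite ler_wpM2r ?normc_ge0.
  rewrite ler_pM2l// /tl -rsumZ; last first.
    by apply: asum_le hc => k; case: ifP; rewrite ?normr0 ?normc_ge0// ger0_norm ?normc_ge0.
  rewrite le_eqVlt; apply/orP; left; apply/eqP; apply: eq_rsum => k.
  by case: ifP => _; rewrite ?mulr0// normcM normcR ger0_norm ?mulr_ge0.
have h3 : M * tl <= M * e by rewrite ler_wpM2l.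
lra.
Qed.

(** By orthogonality both sides have the same coefficients. *)
Lemma fser_fcoef v : bl v -> zperiodic v -> wsum (fcoef v) -> v = fser (fcoef v).
Proof.
move=> hv pv hw; have hs := bl_fser hw.
apply/funext => x; apply/eqP; rewrite -subr_eq0; apply/eqP.
apply: (uniqueness (u := fun x => v x - fser (fcoef v) x)).
- exact: blB.
- by move=> y j; rewrite pv fser_periodic.
move=> k.
have -> : (fun y => (v y - fser (fcoef v) y) * chi k y) =
   (fun y => v y * chi k y - chi k y * fser (fcoef v) y).
  by apply/funext => y; rewrite mulrBl (mulrC (fser _ _)).
have bk := @bl_chi R n k.
rewrite torus_intB; [|exact: blM|exact: blM].
rewrite torus_int_fser// (csum1 (a := - k)).
  rewrite (_ : (fun y => chi k y * chi (- k) y) = (fun=> 1)); last first.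
    by apply/funext => y; rewrite chiNM.
  by rewrite torus_int_cst mulr1 /fcoef opprK subrr.
move=> l lk.
rewrite (_ : (fun y => chi k y * chi l y) = chi (k + l)); last first.
  by apply/funext => y; rewrite chiD.
by rewrite torus_int_chi addrC addr_eq0 (negbTE lk) mulr0.
Qed.

(** The Fourier series of [v] is integrated term by term against [u]. *)
Lemma fcoefM u v p : bl u -> bl v -> zperiodic v -> wsum (fcoef v) ->
  fcoef (fun x => u x * v x) p = csum (fun q => fcoef v q * fcoef u (p - q)).
Proof.
move=> hu hv pv hw; rewrite {1}/fcoef.
have -> : (fun x => u x * v x * chi (- p) x) =
    (fun x => u x * chi (- p) x * fser (fcoef v) x).
  by rewrite -fser_fcoef//; apply/funext => x; rewrite mulrAC.
have bp := @bl_chi R n (- p).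
rewrite torus_int_fser//; last exact: blM.
apply: eq_csum => q; congr (_ * _); congr torus_int; apply/funext => x.
by rewrite -mulrA -chiD opprB addrC.
Qed.

Lemma fourierE f x : fourier f x = fser (fun k => f (- k)) x.
Proof.
rewrite /fourier /fser.
have bo : bijective (fun k : 'rV[int]_n => - k) by exists -%R => k; rewrite opprK.
rewrite -[LHS](csum_reindex _ bo); apply: eq_csum => k /=.
by rewrite mulrC /chi dotN mulrN opprK.
Qed.

Lemma nrmN (k : 'rV[int]_n) : nrm (- k) = nrm k.
Proof. by apply: eq_bigr => j _; rewrite mxE abszN. Qed.

(** The series defining [fourier f] is integrated term by term. *)
Lemma pdoE (sigma : 'rV[int]_n -> 'rV[R]_n -> R[i]) f k : wsum f -> bl (sigma k) ->
  pdo sigma f k = csum (fun l => fcoef (sigma k) (l - k) * f l).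
Proof.
move=> hw hs.
have bo : bijective (fun k : 'rV[int]_n => - k) by exists -%R => l; rewrite opprK.
have hw' : wsum (fun l => f (- l)).
  rewrite /wsum; have := asum_reindex bo hw; apply: asum_le => l /=.
  by rewrite nrmN ger0_norm // mulr_ge0 ?normc_ge0// addr_ge0.
rewrite /pdo (_ : (fun x => _) =
   (fun x => (chi k x * sigma k x) * fser (fun l => f (- l)) x)); last first.
  by apply/funext => x; rewrite fourierE.
have bk := @bl_chi R n k.
rewrite torus_int_fser//; last exact: blM.
rewrite -[RHS](csum_reindex _ bo); apply: eq_csum => l /=.
rewrite mulrC; congr (_ * _); congr torus_int; apply/funext => x.
by rewrite mulrAC -chiD opprB opprK mulrC addrC.
Qed.

End FourierSeries.

(** * Finite differences and the decay of Fourier coefficients *)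

Section FiniteDifferences.
Context {R : realType} {n : nat}.
Implicit Types (u v : 'rV[R]_n -> R[i]) (j : 'I_n).

Definition fdiff j (h : R) u : 'rV[R]_n -> R[i] :=
  fun x => u (x + h *: delta_mx 0 j) - u x.

(** The bounds on differences of step [h] that hold when the derivatives of
    order at most [N] in the direction [j] are bounded by [M]. They pass to
    products and inverses by plain algebra, and they give the decay of Fourier
    coefficients without integration by parts. *)
Fixpoint FD j (h : R) N (M : R) u : Prop :=
  match N with
  | 0%N => forall x, normc (u x) <= M
  | N'.+1 => (forall x, normc (u x) <= M) /\ FD j h N' (`|h| * M) (fdiff j h u)
  end.

Lemma FD_bound j h N M u : FD j h N M u -> forall x, normc (u x) <= M.
Proof. by case: N => [|N] //= []. Qed.

Lemma FD_le j h N M M' u : M <= M' -> FD j h N M u -> FD j h N M' u.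
Proof.
elim: N M M' u => [|N ih] M M' u MM' /=; first by move=> hu x; apply: le_trans (hu x) _.
move=> [hu hu']; split; first by move=> x; apply: le_trans (hu x) _.
by apply: ih hu'; rewrite ler_wpM2l.
Qed.

Lemma FD_pred j h N M u : FD j h N.+1 M u -> FD j h N M u.
Proof.
elim: N M u => [|N ih] M u; first by case.
by move=> [hu hu']; split => //; exact: ih.
Qed.

Lemma FD_shift j h N M u z : FD j h N M u -> FD j h N M (fun x => u (x + z)).
Proof.
elim: N M u => [|N ih] M u /=; first by move=> hu x.
move=> [hu hu']; split => //.
rewrite (_ : fdiff j h _ = fun x => fdiff j h u (x + z)); first exact: ih.
by apply/funext => x; rewrite /fdiff addrAC.
Qed.

Lemma FDD j h N M M' u v : FD j h N M u -> FD j h N M' v ->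
  FD j h N (M + M') (fun x => u x + v x).
Proof.
elim: N M M' u v => [|N ih] M M' u v /=.
  by move=> hu hv x; rewrite (le_trans (le_normcD _ _))// lerD.
move=> [hu hu'] [hv hv']; split.
  by move=> x; rewrite (le_trans (le_normcD _ _))// lerD.
rewrite mulrDr (_ : fdiff j h _ = fun x => fdiff j h u x + fdiff j h v x); first exact: ih.
by apply/funext => x; rewrite /fdiff; ring.
Qed.

Lemma FDN j h N M u : FD j h N M u -> FD j h N M (fun x => - u x).
Proof.
elim: N M u => [|N ih] M u /=; first by move=> hu x; rewrite normcN.
move=> [hu hu']; split; first by move=> x; rewrite normcN.
rewrite (_ : fdiff j h _ = fun x => - fdiff j h u x); first exact: ih.
by apply/funext => x; rewrite /fdiff; ring.
Qed.

Lemma FDM j h N M M' u v : FD j h N M u -> FD j h N M' v ->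
  FD j h N (2 ^+ N * (M * M')) (fun x => u x * v x).
Proof.
have nn N' M1 (w : 'rV[R]_n -> R[i]) : FD j h N' M1 w -> 0 <= M1.
  by move=> /FD_bound/(_ 0); apply: le_trans; exact: normc_ge0.
elim: N M M' u v => [|N ih] M M' u v.
  by move=> /= hu hv x; rewrite expr0 mul1r normcM ler_pM ?normc_ge0.
move=> hu hv; have M0 := nn _ _ _ hu; have M'0 := nn _ _ _ hv.
split.
  move=> x; apply: (@le_trans _ _ (M * M')).
    by rewrite normcM ler_pM ?normc_ge0 ?(FD_bound hu) ?(FD_bound hv).
  by rewrite ler_peMl ?mulr_ge0// exprn_ege1// ler1n.
have hv1 := FD_shift (h *: delta_mx 0 j) (FD_pred hv).
have H := FDD (ih _ _ _ _ hu.2 hv1) (ih _ _ _ _ (FD_pred hu) hv.2).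
rewrite (_ : fdiff j h _ = fun x => fdiff j h u x * v (x + h *: delta_mx 0 j) + u x * fdiff j h v x).
  by apply: FD_le H; rewrite le_eqVlt; apply/orP; left; apply/eqP; rewrite exprS; ring.
by apply/funext => x; rewrite /fdiff; ring.
Qed.

(** The constant depends on [u] only through [C] and [c]; applied to a
    normalized symbol, it is uniform in the discrete variable. *)
Lemma FD_inv N (C c : R) : 0 < c -> exists2 K, 0 <= K & forall j h u,
  FD j h N C u -> (forall x, c <= normc (u x)) -> FD j h N K (fun x => (u x)^-1).
Proof.
move=> c0; have iu u x : (forall x, c <= normc (u x)) -> normc (u x)^-1 <= c^-1.
  by move=> hc; rewrite normcV lef_pV2// posrE (lt_le_trans c0).
elim: N => [|N [K K0 ih]].
  by exists c^-1 => [|j h u hu hc x]; [rewrite invr_ge0 ltW|exact: iu].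
exists (c^-1 + 2 ^+ N * (`|C| * (2 ^+ N * (K * K)))).
  by rewrite addr_ge0 ?invr_ge0 ?(ltW c0)// !mulr_ge0// exprn_ge0.
move=> j h u hu hc; split.
  move=> x; apply: le_trans (iu u x hc) _.
  by rewrite lerDl !mulr_ge0// exprn_ge0.
have h1 := ih j h u (FD_pred hu) hc.
have h2 := FD_shift (h *: delta_mx 0 j) h1.
have h3 := FDM (FDN hu.2) (FDM h1 h2).
rewrite (_ : fdiff j h _ = fun x => - fdiff j h u x * ((u x)^-1 * (u (x + h *: delta_mx 0 j))^-1)).
  apply: FD_le h3.
  rewrite mulrDr -!mulrA mulrCA -[leLHS]add0r lerD//.
    by rewrite mulr_ge0// invr_ge0 ltW.
  rewrite ler_wpM2l// ler_wpM2l ?exprn_ge0// ler_wpM2r ?ler_norm//.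
  by rewrite !mulr_ge0// exprn_ge0.
have u0 x : u x != 0 by apply: contraTneq (hc x) => ->; rewrite normc0 -ltNge.
by apply/funext => x; rewrite /fdiff; field; rewrite !u0.
Qed.

Lemma FDZ j h N M z u : FD j h N M u -> FD j h N (normc z * M) (fun x => z * u x).
Proof.
elim: N M u => [|N ih] M u /=.
  by move=> hu x; rewrite normcM ler_wpM2l ?normc_ge0.
move=> [hu hu']; split; first by move=> x; rewrite normcM ler_wpM2l ?normc_ge0.
rewrite mulrCA (_ : fdiff j h _ = fun x => z * fdiff j h u x); first exact: ih.
by apply/funext => x; rewrite /fdiff mulrBr.
Qed.

Lemma fdiff_bl j h u : bl u -> bl (fdiff j h u).
Proof. by move=> hu; apply: blB => //; exact: bl_shift. Qed.

Lemma fdiff_periodic j h u : zperiodic u -> zperiodic (fdiff j h u).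
Proof. by move=> pu x i; rewrite /fdiff addrAC !pu. Qed.

Lemma fcoef_fdiff j u (k : 'rV[int]_n) : bl u -> zperiodic u -> k 0 j != 0 ->
  fcoef (fdiff j (2 * `|k 0 j|%:~R)^-1 u) k = - (2 * fcoef u k).
Proof.
move=> hu pu kj; set h := _^-1.
have bc := @bl_chi R n (- k).
have hs := bl_shift (h *: delta_mx 0 j) hu.
rewrite /fcoef (_ : (fun x => _) = (fun x => u (x + h *: delta_mx 0 j) * chi (- k) x - u x * chi (- k) x)); last first.
  by apply/funext => x; rewrite mulrBl.
rewrite torus_intB; [|exact: blM|exact: blM].
have bu : bl (fun x => u x * chi (- k) x) by exact: blM.
have := torus_int_shift j h bu (zperiodicM pu (chi_periodic (- k))).
have kj' : (- k) 0 j != 0 by rewrite mxE oppr_eq0.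
have E x : chi (- k) (x + h *: delta_mx 0 j) = - chi (- k) x :> R[i].
  by have := chi_half x kj'; rewrite mxE normrN.
under eq_fun do rewrite E mulrN.
rewrite torus_intN; last exact: blM.
by move=> <-; ring.
Qed.

(** Each difference with half a period of the character as its step doubles the
    coefficient, up to sign, and costs a factor of the order of the step. *)
Lemma fcoef_decay1 j N M u (k : 'rV[int]_n) : bl u -> zperiodic u -> k 0 j != 0 ->
  FD j (2 * `|k 0 j|%:~R)^-1 N M u ->
  normc (fcoef u k) * `|k 0 j|%:~R ^+ N <= 2 * M.
Proof.
move=> hu pu kj; elim: N M u hu pu => [|N ih] M u hu pu.
  move=> h; rewrite expr0 mulr1; apply: torus_int_bound.
    by apply: blM => //; exact: bl_chi.
  by move=> x; rewrite normcM normc_chi mulr1.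
move=> hfd.
have M0 : 0 <= M by apply: le_trans (FD_bound hfd 0); exact: normc_ge0.
have := ih _ _ (fdiff_bl j (2 * `|k 0 j|%:~R)^-1 hu) (fdiff_periodic j _ pu) hfd.2.
rewrite fcoef_fdiff// normcN normcM (normc_nat 2).
have q0 : 0 < `|k 0 j|%:~R :> R by rewrite ltr0z normr_gt0.
rewrite exprS; move: (`|k 0 j|%:~R : R) q0 => q q0.
have -> : `|(2 * q)^-1| = (2 * q)^-1 by rewrite ger0_norm// invr_ge0 mulr_ge0// ltW.
set a := normc _; set b := q ^+ N => H.
have {H} : 2 * a * b * q <= 2 * ((2 * q)^-1 * M) * q by rewrite ler_wpM2r// ltW.
have -> : 2 * ((2 * q)^-1 * M) * q = M by field; rewrite gt_eqF.
by move=> H; rewrite (_ : a * (q * b) = a * b * q); [lra|ring].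
Qed.

Lemma fcoef_decay N M u : bl u -> zperiodic u ->
  (forall j h, FD j h N M u) -> (forall x, normc (u x) <= M) -> forall k,
  (1 + (nrm k)%:R) ^+ N * normc (fcoef u k) <= (n.+1%:R ^+ N * 2) * M.
Proof.
move=> hu pu hfd hM k.
have M0 : 0 <= M by apply: le_trans (hM 0); exact: normc_ge0.
have [->|k0] := eqVneq k 0.
  rewrite (_ : nrm _ = 0%N) ?addr0; last by apply: big1 => j _; rewrite mxE.
  rewrite expr1n mul1r; apply: (@le_trans _ _ (2 * M)).
    apply: torus_int_bound => [|x]; first by apply: blM => //; exact: bl_chi.
    by rewrite normcM normc_chi mulr1.
  by rewrite ler_wpM2r// ler_peMl// exprn_ege1// ler1n.
(* The largest coordinate of [k] is comparable to its norm. *)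
have [j hj] : exists j, (nrm k < n.+1 * `|k 0%R j|)%N.
  apply: contrapT => h; case/negP: k0; apply/eqP/rowP => j; rewrite mxE.
  have hle i : (n.+1 * `|k 0%R i| <= nrm k)%N.
    by rewrite leqNgt; apply/negP => hi; apply: h; exists i.
  have : (n.+1 * nrm k <= n * nrm k)%N.
    rewrite {1}/nrm big_distrr /=; apply: (@leq_trans (\sum_(i < n) nrm k)).
      by apply: leq_sum => i _; exact: hle.
    by rewrite sum_nat_const card_ord.
  rewrite mulSn -[leqRHS]add0n leq_add2r leqn0 /nrm sum_nat_eq0 => /forallP/(_ j).
  by rewrite absz_eq0 => /eqP.
have kj : k 0 j != 0 by apply/eqP => kj0; move: hj; rewrite kj0 absz0 muln0.
have := fcoef_decay1 hu pu kj (hfd _ _).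
set a := normc _ => H.
have q0 : 0 <= `|k 0 j|%:~R :> R by rewrite ler0z.
apply: (@le_trans _ _ ((n.+1%:R * `|k 0 j|%:~R) ^+ N * a)).
  rewrite ler_wpM2r ?normc_ge0// lerXn2r// ?nnegrE ?addr_ge0 ?mulr_ge0//.
  by rewrite nat1r -natr_absz -natrM ler_nat.
rewrite exprMn -mulrA -mulrA ler_wpM2l ?exprn_ge0//.
by rewrite mulrC.
Qed.

End FiniteDifferences.

(** * Differences of smooth functions *)

Section Smooth.
Context {R : realType} {n : nat}.
Implicit Types (w : 'rV[R]_n -> R) (u v : 'rV[R]_n -> R[i]) (j : 'I_n).

Lemma CrD r w1 w2 : Cr r w1 -> Cr r w2 -> Cr r (fun x => w1 x + w2 x).
Proof.
elim: r w1 w2 => [|r ih] w1 w2 /=.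
  by move=> h1 h2 x; exact: (continuousD (h1 x) (h2 x)).
move=> [h1 d1] [h2 d2]; split.
  by move=> x; exact: (continuousD (h1 x) (h2 x)).
move=> j; have [e1 c1] := d1 j; have [e2 c2] := d2 j; split.
  by move=> x; apply: derivableD.
have -> : (fun x => 'D_(delta_mx 0 j) (fun y => w1 y + w2 y) x) =
    (fun x => 'D_(delta_mx 0 j) w1 x + 'D_(delta_mx 0 j) w2 x).
  by apply/funext => x; exact: (deriveD (e1 x) (e2 x)).
exact: ih.
Qed.

Lemma CrZ r (c : R) w : Cr r w -> Cr r (fun x => c * w x).
Proof.
elim: r w => [|r ih] w /=.
  by move=> h x; exact: (continuousM (@cst_continuous _ _ c x) (h x)).
move=> [h d]; split.
  by move=> x; exact: (continuousM (@cst_continuous _ _ c x) (h x)).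
move=> j; have [e k] := d j; split.
  by move=> x; exact: (@derivableZ _ _ _ w c x _ (e x)).
have -> : (fun x => 'D_(delta_mx 0 j) (fun y => c * w y) x) =
    (fun x => c * 'D_(delta_mx 0 j) w x).
  by apply/funext => x; exact: (@deriveZ _ _ _ w c x _ (e x)).
exact: ih.
Qed.

Lemma smooth_lin z1 z2 u v : smooth u -> smooth v ->
  smooth (fun x => z1 * u x + z2 * v x).
Proof.
move=> hu hv r; have [u1 u2] := hu r; have [v1 v2] := hv r.
pose a1 := complex.Re z1; pose b1 := complex.Im z1.
pose a2 := complex.Re z2; pose b2 := complex.Im z2.
split.
  rewrite (_ : (fun x => _) = fun x =>
    (a1 * complex.Re (u x) + - b1 * complex.Im (u x)) +
    (a2 * complex.Re (v x) + - b2 * complex.Im (v x))).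
    by do !apply: CrD; exact: CrZ.
  by apply/funext => x; rewrite ReD !ReM !mulNr.
rewrite (_ : (fun x => _) = fun x =>
  (a1 * complex.Im (u x) + b1 * complex.Re (u x)) +
  (a2 * complex.Im (v x) + b2 * complex.Re (v x))).
  by do !apply: CrD; exact: CrZ.
by apply/funext => x; rewrite ImD !ImM.
Qed.

Lemma smooth_cpartial j u : smooth u -> smooth (cpartial j u).
Proof.
move=> hu r; have [[_ h1] [_ h2]] := hu r.+1.
by split; [have [_] := h1 j|have [_] := h2 j].
Qed.

Lemma smooth_Dfact1 j l u : smooth u -> smooth (Dfact1 j l u).
Proof.
move=> hu; elim: l => [//|l ih] /=.
rewrite (_ : (fun x => _) = fun x =>
   (0 +i* (2 * pi))^-1 * cpartial j (Dfact1 j l u) x + (- l%:R) * Dfact1 j l u x).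
  by apply: smooth_lin => //; exact: smooth_cpartial.
by apply/funext => x; rewrite mulNr.
Qed.

Definition pderivable j u : Prop := forall x,
  derivable (fun y => complex.Re (u y)) x (delta_mx 0 j) /\
  derivable (fun y => complex.Im (u y)) x (delta_mx 0 j).

Lemma smooth_pderivable j u : smooth u -> pderivable j u.
Proof.
move=> hu x; have [[_ h1] [_ h2]] := hu 1%N.
by have [e1 _] := h1 j; have [e2 _] := h2 j.
Qed.

Lemma derive_line w j x : (forall y, derivable w y (delta_mx 0 j)) ->
  forall t : R, is_derive t (1 : R) (fun s : R => w (x + s *: delta_mx 0 j))
                ('D_(delta_mx 0 j) w (x + t *: delta_mx 0 j)).
Proof.
move=> dw t; set e := delta_mx 0 j; set F := fun s : R => _.
have E : (fun h : R => h^-1 *: ((F \o shift t) (h *: (1 : R)) - F t)) =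
    (fun h : R => h^-1 *: ((w \o shift (x + t *: e)) (h *: e) - w (x + t *: e))).
  apply/funext => h; rewrite /F /=; congr (_ *: (w _ - _)).
  by rewrite [h *: _]mulr1 scalerDl addrCA.
split; first by rewrite /derivable E; exact: dw.
by rewrite /derive E.
Qed.

Lemma rdiff_bound w j (M : R) x h : (forall y, derivable w y (delta_mx 0 j)) ->
  (forall y, `|'D_(delta_mx 0 j) w y| <= M) ->
  `|w (x + h *: delta_mx 0 j) - w x| <= M * `|h|.
Proof.
move=> dw hM; have := lipschitz_deriv (derive_line x dw) (fun t => hM _) 0 h.
by rewrite scale0r addr0 subr0.
Qed.

Lemma fdiff_bound u j (M : R) h : pderivable j u ->
  (forall y, normc (cpartial j u y) <= M) ->
  forall x, normc (fdiff j h u x) <= 2 * M * `|h|.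
Proof.
move=> du hM x.
apply: le_trans (normc_le_ReIm _) _; rewrite /fdiff ReD ReN ImD ImN.
have h1 : `|complex.Re (u (x + h *: delta_mx 0 j)) - complex.Re (u x)| <= M * `|h|.
  apply: (@rdiff_bound (fun y => complex.Re (u y))) => y; first by have [] := du y.
  by apply: le_trans (hM y); exact: (Re_le_normc (cpartial j u y)).
have h2 : `|complex.Im (u (x + h *: delta_mx 0 j)) - complex.Im (u x)| <= M * `|h|.
  apply: (@rdiff_bound (fun y => complex.Im (u y))) => y; first by have [] := du y.
  by apply: le_trans (hM y); exact: (Im_le_normc (cpartial j u y)).
lra.
Qed.

Lemma derive_shift w j z x :
  derivable w (x + z) (delta_mx 0 j) ->
  is_derive x (delta_mx 0 j) (fun y => w (y + z)) ('D_(delta_mx 0 j) w (x + z)).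
Proof.
move=> dw; set e := delta_mx 0 j; set F := fun y => _.
have E : (fun h : R => h^-1 *: ((F \o shift x) (h *: e) - F x)) =
    (fun h : R => h^-1 *: ((w \o shift (x + z)) (h *: e) - w (x + z))).
  by apply/funext => h; rewrite /F /= addrA.
split; first by rewrite /derivable E.
by rewrite /derive E.
Qed.

Lemma is_derive_fdiff w j h x : (forall y, derivable w y (delta_mx 0 j)) ->
  is_derive x (delta_mx 0 j) (fun y => w (y + h *: delta_mx 0 j) - w y)
    ('D_(delta_mx 0 j) w (x + h *: delta_mx 0 j) - 'D_(delta_mx 0 j) w x).
Proof.
move=> dw; have [d1 e1] := derive_shift (dw (x + h *: delta_mx 0 j)).
split; first exact: (derivableB d1 (dw x)).
by rewrite -e1; exact: (deriveB d1 (dw x)).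
Qed.

Lemma cpartial_fdiff j h u : pderivable j u ->
  pderivable j (fdiff j h u) /\ cpartial j (fdiff j h u) = fdiff j h (cpartial j u).
Proof.
move=> du.
have dre x := is_derive_fdiff h x (fun y => (du y).1).
have dim x := is_derive_fdiff h x (fun y => (du y).2).
have ERe : (fun y => complex.Re (fdiff j h u y)) =
   (fun y => complex.Re (u (y + h *: delta_mx 0 j)) - complex.Re (u y)).
  by apply/funext => y; rewrite ReD ReN.
have EIm : (fun y => complex.Im (fdiff j h u y)) =
   (fun y => complex.Im (u (y + h *: delta_mx 0 j)) - complex.Im (u y)).
  by apply/funext => y; rewrite ImD ImN.
split.
  by move=> x; rewrite ERe EIm; split; [have [] := dre x|have [] := dim x].
apply/funext => x; rewrite /cpartial ERe EIm; apply: eqc.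
  by have [_ ->] := dre x.
by have [_ ->] := dim x.
Qed.

Let kappa : R[i] := 0 +i* (2 * pi).

Lemma kappa_neq0 : kappa != 0.
Proof.
by apply/eqP => -[] /eqP; rewrite mulf_eq0 (gt_eqF (pi_gt0 R)) (_ : (2 == 0 :> R) = false) ?pnatr_eq0.
Qed.

Lemma normc_kappa : normc kappa = 2 * pi.
Proof.
rewrite /= expr0n add0r sqrtr_sqr ger0_norm// mulr_ge0// ; exact: pi_ge0.
Qed.

(** The constant for differences of order [N] of the [l]-th member of a family
    [U] bounded by [M] with [cpartial (U l) = kappa * (U l.+1 + l * U l)]; this
    recurrence relates consecutive factorial derivatives. *)
Fixpoint diffconst (M : nat -> R) (N l : nat) : R :=
  match N with
  | 0%N => M l
  | N'.+1 => M l + diffconst (fun l => 4 * pi * (M l.+1 + l%:R * M l)) N' l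
  end.

Lemma diffconst_ge0 M N l : (forall l, 0 <= M l) -> 0 <= diffconst M N l.
Proof.
elim: N M l => [//|N ih] M l M0 /=; rewrite addr_ge0// ih// => k.
by rewrite !mulr_ge0 ?pi_ge0// addr_ge0 ?mulr_ge0.
Qed.

(** Differences of the family [U] satisfy the same recurrence, and the mean
    value inequality bounds them; hence induction on the order. *)
Lemma FD_family j h N (U : nat -> 'rV[R]_n -> R[i]) (M : nat -> R) (c : R) :
  0 <= c -> (forall l, 0 <= M l) ->
  (forall l, pderivable j (U l)) ->
  (forall l x, cpartial j (U l) x = kappa * (U l.+1 x + l%:R * U l x)) ->
  (forall l x, normc (U l x) <= c * M l) ->
  forall l, FD j h N (c * diffconst M N l) (U l).
Proof.
elim: N U M c => [|N ih] U M c c0 M0 dU rU bU l; first exact: bU.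
have M'0 k : 0 <= 4 * pi * (M k.+1 + k%:R * M k).
  by rewrite !mulr_ge0 ?pi_ge0// addr_ge0 ?mulr_ge0.
split.
  move=> x; apply: le_trans (bU l x) _; rewrite ler_wpM2l// lerDl.
  exact: diffconst_ge0.
have bcp k y : normc (cpartial j (U k) y) <= (2 * pi) * (c * (M k.+1 + k%:R * M k)).
  rewrite rU normcM normc_kappa ler_wpM2l ?mulr_ge0 ?pi_ge0//.
  apply: le_trans (le_normcD _ _) _; rewrite normcM normc_nat mulrDr lerD//.
  by rewrite mulrCA ler_wpM2l.
have H := ih (fun k => fdiff j h (U k)) (fun k => 4 * pi * (M k.+1 + k%:R * M k)) (`|h| * c)
   (mulr_ge0 (normr_ge0 h) c0) M'0.
have {}H : FD j h N (`|h| * c * diffconst (fun k => 4 * pi * (M k.+1 + k%:R * M k)) N l) (fdiff j h (U l)).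
  apply: H.
  - by move=> k; have [] := cpartial_fdiff h (dU k).
  - move=> k x; have [_ ->] := cpartial_fdiff h (dU k).
    by rewrite /fdiff !rU; ring.
  - move=> k x; apply: le_trans (fdiff_bound h (dU k) (bcp k) x) _.
    by rewrite le_eqVlt; apply/orP; left; apply/eqP; ring.
apply: FD_le H; rewrite /= -mulrA !ler_wpM2l//.
by rewrite lerDr.
Qed.

Definition pidx j (l : nat) : 'I_n -> nat := fun i => if i == j then l else 0%N.

Lemma Dfact_pidx j l u : Dfact (pidx j l) u = Dfact1 j l u.
Proof.
rewrite /Dfact; have : j \in enum 'I_n by rewrite mem_enum.
have : uniq (enum 'I_n) by exact: enum_uniq.
have notin (s : seq 'I_n) : j \notin s -> foldr (fun i v => Dfact1 i (pidx j l i) v) u s = u.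
  elim: s => [//|i s ih] /=; rewrite inE negb_or => /andP[ij js].
  by rewrite ih// /pidx eq_sym (negbTE ij).
elim: (enum 'I_n) => [//|i s ih] /= /andP[si us]; rewrite inE.
case: eqP => [ji _|/eqP ij /= js]; first by rewrite -ji in si *; rewrite notin// /pidx eqxx.
by rewrite ih// /pidx eq_sym (negbTE ij).
Qed.

(** Only pure derivatives are bounded, since the decay of Fourier coefficients
    uses differences in one coordinate direction at a time. *)
Lemma FD_smooth (A : Type) (u : A -> 'rV[R]_n -> R[i]) (W : A -> R) N :
  (forall k, 0 <= W k) -> (forall k, smooth (u k)) ->
  (forall j l, exists2 C : R, 0 < C & forall k x, normc (Dfact1 j l (u k) x) <= C * W k) ->
  exists2 K, 0 <= K & forall k j h, FD j h N (K * W k) (u k).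
Proof.
move=> W0 su hD.
have H j : exists2 K, 0 <= K & forall k h, FD j h N (K * W k) (u k).
  have [M hM] := choice (fun l => let: ex_intro2 C C0 hC := hD j l in
    ex_intro (fun C => 0 < C /\ forall k x, normc (Dfact1 j l (u k) x) <= C * W k) C (conj C0 hC)).
  have M0 l : 0 <= M l by have [/ltW] := hM l.
  exists (diffconst M N 0) => [|k h]; first exact: diffconst_ge0.
  rewrite mulrC; apply: (@FD_family j h N (fun l => Dfact1 j l (u k)) M (W k) (W0 k) M0).
  - by move=> l; apply: smooth_pderivable; exact: smooth_Dfact1.
  - by move=> l x /=; rewrite subrK mulVKf ?kappa_neq0.
  - by move=> l x; rewrite mulrC; exact: (hM l).2.
have {}H j : exists K, 0 <= K /\ forall k h, FD j h N (K * W k) (u k).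
  by have [K K0 hK] := H j; exists K.
have [K hK] := choice H.
exists (\sum_j K j) => [|k j h]; first by apply: sumr_ge0 => j _; exact: (hK j).1.
apply: FD_le ((hK j).2 k h); rewrite ler_wpM2r// (bigD1 j)//= lerDl.
by apply: sumr_ge0 => i _; exact: (hK i).1.
Qed.

(** The difference between two points is telescoped by moving one coordinate at
    a time. *)
Lemma bl_FD M u : (forall j h, FD j h 1 M u) -> (forall x, normc (u x) <= M) -> bl u.
Proof.
move=> hfd hM; exists M => // x y; rewrite /dist1.
have step (s : seq 'I_n) (z : 'rV[R]_n) : normc (u (z + \sum_(j <- s) (x 0 j - y 0 j) *: delta_mx 0 j) - u z)
    <= M * \sum_(j <- s) `|x 0 j - y 0 j|.
  elim: s z => [|j s ih] z; first by rewrite !big_nil addr0 subrr normc0 mulr0.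
  rewrite !big_cons; set a := u _; set b := u z.
  have -> : a - b = (a - u (z + (x 0 j - y 0 j) *: delta_mx 0 j)) +
     fdiff j (x 0 j - y 0 j) u z by rewrite /fdiff -/b; ring.
  apply: le_trans (le_normcD _ _) _; rewrite addrC mulrDr lerD//.
    by rewrite mulrC; exact: (hfd j (x 0 j - y 0 j)).2.
  by rewrite /a addrA; exact: ih.
have := step (index_enum 'I_n) y.
rewrite (_ : y + _ = x)//.
apply/rowP => i; rewrite mxE summxE (bigD1 i)//= big1 ?addr0 => [|j ji].
  by rewrite !mxE !eqxx mulr1 addrC subrK.
by rewrite !mxE (negbTE (_ : i != j)) 1?eq_sym// andbF mulr0.
Qed.

End Smooth.

(** * The lattice and the weight *)

Section LatticeWeights.
Context {n : nat}.
Implicit Types (k l : 'rV[int]_n) (i : 'I_n).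

Lemma nrmD k l : (nrm (k + l)%R <= nrm k + nrm l)%N.
Proof.
rewrite /nrm -big_split /=; apply: leq_sum => j _; rewrite mxE.
by rewrite -lez_nat PoszD !abszE ler_normD.
Qed.

Lemma nrm0 : nrm (0 : 'rV[int]_n) = 0%N.
Proof. by apply: big1 => j _; rewrite mxE. Qed.

Lemma nrmBC k l : nrm (k - l) = nrm (l - k).
Proof. by rewrite -nrmN opprB. Qed.

Lemma nrm_pred k : k != 0 -> exists i l,
  (k = l + delta_mx 0 i \/ l = k + delta_mx 0 i) /\ nrm k = (nrm l).+1.
Proof.
move=> k0; have [i ki] : exists i, k 0 i != 0.
  apply: contrapT => h; case/negP: k0; apply/eqP/rowP => j; rewrite mxE.
  by apply/eqP; apply: contrapT => /negP hj; apply: h; exists j.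
have E (z : int) : nrm (k + z *: delta_mx 0 i) = (`|(k 0 i + z)%R| + \sum_(j < n | j != i) `|k 0%R j|)%N.
  rewrite /nrm (bigD1 i)//= !mxE !eqxx mulr1; congr (_ + _)%N.
  by apply: eq_bigr => j /negbTE ji; rewrite !mxE ji andbF mulr0 addr0.
have Ek : nrm k = (`|k 0%R i| + \sum_(j < n | j != i) `|k 0%R j|)%N.
  by rewrite /nrm (bigD1 i).
have [kp|kn] : 0 < k 0 i \/ k 0 i < 0.
  by apply/orP; move: ki; rewrite neq_lt orbC.
- exists i, (k + (-1) *: delta_mx 0 i); split.
    by left; rewrite scaleN1r subrK.
  by rewrite E Ek -addSn; congr addn; lia.
- exists i, (k + 1 *: delta_mx 0 i); split.
    by right; rewrite scale1r.
  by rewrite E Ek -addSn; congr addn; lia.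
Qed.

Lemma nrm_eq0 k : nrm k = 0%N -> k = 0.
Proof.
move=> h; apply/eqP/negPn/negP => /nrm_pred [i [l [_]]].
by rewrite h.
Qed.

(** The bounds on unit steps are summed along a shortest path from [k] to [l],
    which stays within distance [nrm (l - k)] of [k]. *)
Lemma lattice_path {R : realType} (D : 'rV[int]_n -> R) (b : nat -> R) k :
  (forall r s, (r <= s)%N -> b r <= b s) ->
  (forall l i r, (nrm (l - k)%R <= r)%N -> (nrm (l + delta_mx 0 i - k)%R <= r)%N ->
    D (l + delta_mx 0 i) <= D l + b r /\ D l <= D (l + delta_mx 0 i) + b r) ->
  forall l, D l <= D k + (nrm (l - k))%:R * b (nrm (l - k)).
Proof.
move=> bm step l.
suff H r q : (q <= r)%N -> forall l, nrm (l - k) = q -> D l <= D k + q%:R * b r.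
  exact: (H _ _ (leqnn _)).
elim: q => [|q ih] qr {}l.
  by move=> /nrm_eq0/eqP; rewrite subr_eq0 => /eqP ->; rewrite mul0r addr0.
move=> h; have lk : l - k != 0 by apply/eqP => h0; move: h; rewrite h0 nrm0.
have [i [l' [e1 e2]]] := nrm_pred lk.
have q' : nrm (l' + k - k) = q by rewrite addrK; move: e2; rewrite h => -[].
have IH := ih (ltnW qr) _ q'.
have hr : (nrm (l - k)%R <= r)%N by rewrite h.
have hr' : (nrm (l' + k - k)%R <= r)%N by rewrite q' ltnW.
have stp : D l <= D (l' + k) + b r.
  case: e1 => e1.
    have e : l = l' + k + delta_mx 0 i by rewrite addrAC -e1 subrK.
    by rewrite {1}e; apply: (step (l' + k) i r _ _).1; rewrite // -e.
  have e : l' + k = l + delta_mx 0 i by rewrite e1 addrAC subrK.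
  by rewrite e; apply: (step l i r _ _).2; rewrite // -e.
rewrite -natr1 mulrDl mul1r addrA; lra.
Qed.

Context {R : realType}.

Lemma pidx_len i : mlen (pidx i 1) = 1%N.
Proof.
rewrite /mlen (bigD1 i)//= /pidx eqxx big1 ?addn0// => j ji.
by rewrite (negbTE ji).
Qed.

Lemma Delta0 (V : zmodType) (f : 'rV[int]_n -> V) (a : 'I_n -> nat) :
  (forall j, a j = 0%N) -> Delta a f = f.
Proof. by move=> a0; rewrite /Delta; elim: (enum _) => [//|j s ih] /=; rewrite a0. Qed.

Lemma Delta_pidx (V : zmodType) (f : 'rV[int]_n -> V) i (a : 'I_n -> nat) :
  a =1 pidx i 1 -> Delta a f = diff1 i f.
Proof.
move=> /funext ->.
rewrite /Delta; have : i \in enum 'I_n by rewrite mem_enum.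
have : uniq (enum 'I_n) by exact: enum_uniq.
have notin (s : seq 'I_n) : i \notin s -> foldr (fun j g => iter (pidx i 1 j) (diff1 j) g) f s = f.
  elim: s => [//|j s ih] /=; rewrite inE negb_or => /andP[ij js].
  by rewrite ih// /pidx eq_sym (negbTE ij).
elim: (enum 'I_n) => [//|j s ih] /= /andP[sj us]; rewrite inE.
case: eqP => [ij _|/eqP ij /= js]; first by rewrite -ij in sj *; rewrite notin// /pidx eqxx.
by rewrite ih// /pidx eq_sym (negbTE ij).
Qed.

Variables (Lambda : 'rV[int]_n -> R) (mu0 mu1 mu C0 C1 : R).
Hypothesis hLambda : weight_function Lambda mu0 mu1 mu C0 C1.

Lemma Lambda_gt0 k : 0 < Lambda k.
Proof. by have [h _ _ _ _] := hLambda. Qed.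

Lemma Lambda_ge k : C0 <= Lambda k.
Proof.
have [_ [m0 _ _] [c0 _] h _] := hLambda; apply: le_trans (h k).1.
have e1 : 1 = 1 `^ mu0 :> R by rewrite powR1.
have e0 : 0 <= eucl k :> R by exact: sqrtr_ge0.
by rewrite ler_pMr// [leLHS]e1 ge0_ler_powR ?(ltW m0) ?nnegrE ?addr_ge0 ?lerDl.
Qed.

Lemma Lambda_powR_neg (s : R) : s <= 0 -> exists2 C, 0 < C & forall k, Lambda k `^ s <= C.
Proof.
move=> s0; have [_ _ [c0 _] _ _] := hLambda.
exists (C0 `^ s) => [|k]; first exact: powR_gt0.
rewrite -[s]opprK !(powRN _ (- s)) lef_pV2 ?posrE ?powR_gt0 ?Lambda_gt0//.
by rewrite ge0_ler_powR ?nnegrE ?oppr_ge0 ?Lambda_ge// ltW ?Lambda_gt0.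
Qed.

Lemma Lambda_step : exists2 C : R, 0 < C & forall k i,
  `|Lambda (k + delta_mx 0 i) - Lambda k| <= C * Lambda k `^ (1 - 1 / mu).
Proof.
have [_ _ _ _ h] := hLambda.
have H i : exists C : R, 0 < C /\ forall k,
    `|Lambda (k + delta_mx 0 i) - Lambda k| <= C * Lambda k `^ (1 - 1 / mu).
  have [C c0 hC] := h (pidx i 1) (fun=> false); exists C; split => // k.
  have := hC k; rewrite pidx_len (@Delta_pidx _ Lambda i); last first.
    by move=> j; rewrite /madd /mind addn0.
  rewrite (_ : monom k _ = 1) ?mul1r//.
  by rewrite /monom big1.
have [C hC] := choice H.
have sge i : C i <= \sum_j C j.
  rewrite (bigD1 i)//= lerDl sumr_ge0// => j _; exact: ltW (hC j).1.
exists (1 + \sum_j C j) => [|k i].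
  by rewrite ltr_wpDr// sumr_ge0// => j _; exact: ltW (hC j).1.
apply: le_trans ((hC i).2 k) _; rewrite ler_wpM2r ?powR_ge0//.
by rewrite (le_trans (sge i))// lerDr.
Qed.

(** A fractional power of the weight is Lipschitz, because each unit step
    changes the weight by at most a multiple of its [1 - 1 / mu]-th power. An
    integral root keeps the comparison of powers elementary. *)
Lemma Lambda_root : exists N : nat, exists w : 'rV[int]_n -> R, exists C : R,
  [/\ 0 < C, forall k, 0 < w k, forall k, w k ^+ N.+1 = Lambda k,
     forall k l, w l <= w k + C * (nrm (l - k))%:R & exists2 c, 0 < c & forall k, c <= w k].
Proof.
have [_ [m0 m01 m1] [c0 _] _ _] := hLambda.
have mu_gt0 : 0 < mu by lra.
pose N := Num.truncn mu; exists N.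
have hN : mu < N.+1%:R by have /andP[] := truncn_itv (ltW mu_gt0).
pose t : R := N.+1%:R^-1.
have t0 : 0 < t by rewrite invr_gt0.
pose w k := Lambda k `^ t; exists w.
have w0 k : 0 < w k by rewrite powR_gt0 ?Lambda_gt0.
have wN k : w k ^+ N.+1 = Lambda k.
  rewrite -powR_mulrn ?ltW// /w -powRrM mulVf// powRr1// ltW// ; exact: Lambda_gt0.
have [C Cp step] := Lambda_step.
have tmu : t - 1 / mu <= 0.
  by rewrite subr_le0 div1r /t lef_pV2 ?posrE// ltW.
have [B Bp hB] := Lambda_powR_neg tmu.
have cst k : C * Lambda k `^ (1 - 1 / mu) <= C * B * w k ^+ N.
  rewrite -mulrA ler_pM2l//.
  have -> : 1 - 1 / mu = (t - 1 / mu) + (1 - t) by ring.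
  rewrite powRD; last by apply/implyP => _; rewrite gt_eqF ?Lambda_gt0.
  rewrite (_ : Lambda k `^ (1 - t) = w k ^+ N) ?ler_wpM2r ?exprn_ge0 ?(ltW (w0 k))//.
  rewrite -powR_mulrn ?ltW// /w -powRrM; congr powR.
  by rewrite /t -natr1; field; rewrite natr1 pnatr_eq0.
set A := C * B; have A0 : 0 < A by rewrite mulr_gt0.
have up k i : w (k + delta_mx 0 i) <= w k + A.
  have h : w (k + delta_mx 0 i) ^+ N.+1 <= (w k + A) ^+ N.+1.
    apply: (@le_trans _ _ ((w k + A) * w k ^+ N)).
      rewrite wN mulrDl -exprS wN -lerBlDl; apply: le_trans (cst k).
      by apply: le_trans (step k i); exact: ler_norm.
    rewrite exprS ler_wpM2l ?addr_ge0 ?(ltW (w0 k)) ?(ltW A0)//.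
    by rewrite lerXn2r ?nnegrE ?addr_ge0 ?(ltW (w0 k)) ?(ltW A0)// lerDl ltW.
  by move: h; rewrite ler_pXn2r ?nnegrE ?addr_ge0 ?(ltW (w0 _)) ?(ltW A0).
have down k i : w k <= w (k + delta_mx 0 i) + A.
  rewrite leNgt; apply/negP => hlt; set w' := w (k + _) in hlt.
  have w'0 : 0 < w' by exact: w0.
  have h1 : w k ^+ N.+1 - A * w k ^+ N <= w' ^+ N.+1.
    rewrite /w' !wN lerBlDr addrC -lerBlDr.
    apply: le_trans (cst k); apply: le_trans (step k i).
    by rewrite -normrN opprB ler_norm.
  have wkN : 0 < w k ^+ N by rewrite exprn_gt0.
  have h2 : w' * w k ^+ N < w k ^+ N.+1 - A * w k ^+ N.
    by rewrite exprS -mulrBl ltr_pM2r// ltrBrDr.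
  have h3 : w' ^+ N.+1 <= w' * w k ^+ N.
    rewrite exprS ler_pM2l// lerXn2r ?nnegrE ?(ltW w'0) ?(ltW (w0 k))//; lra.
  lra.
exists A; split => //.
  move=> k l; rewrite mulrC.
  by apply: (lattice_path (D := w) (b := fun=> A)) => // l' i r _ _; split.
exists (C0 `^ t) => [|k]; first exact: powR_gt0.
by rewrite ge0_ler_powR ?nnegrE ?(ltW t0) ?(ltW c0) ?Lambda_ge// ltW// Lambda_gt0.
Qed.

(** An inequality of Peetre's type: the root [w] of [Lambda_root] is Lipschitz
    and bounded below, so [w l] is at most a multiple of
    [w k * (1 + nrm (l - k))]. *)
Lemma Lambda_temperate : exists N : nat, exists2 C : R, 0 < C &
  forall k l, Lambda l <= C * Lambda k * (1 + (nrm (l - k))%:R) ^+ N.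
Proof.
have [N [w [C [C_gt0 w0 wN lip [c c0 wc]]]]] := Lambda_root.
exists N.+1, ((1 + C / c) ^+ N.+1) => [|k l].
  by rewrite exprn_gt0// addr_gt0// divr_gt0.
have nr0 : 0 <= (nrm (l - k))%:R :> R by [].
have h : w l <= (1 + C / c) * w k * (1 + (nrm (l - k))%:R).
  apply: le_trans (lip k l) _.
  have h1 : C <= C / c * w k.
    by rewrite mulrAC ler_pdivlMr// ler_pM2l.
  have h2 : C * (nrm (l - k))%:R <= C / c * w k * (nrm (l - k))%:R by rewrite ler_wpM2r.
  have h3 := w0 k; have h4 : 0 <= C / c * w k by lra.
  have h5 : 0 <= w k * (nrm (l - k))%:R by rewrite mulr_ge0// ltW.
  rewrite !mulrDr !mulrDl !mulr1 !mul1r; lra.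
rewrite -!wN -!exprMn lerXn2r// nnegrE ?(ltW (w0 _))//.
by rewrite !mulr_ge0// ?ltW// ?addr_gt0 ?divr_gt0 ?ltr_wpDr.
Qed.

Lemma Lambda_powR (s : R) : exists N : nat, exists2 C : R, 0 < C &
  forall k l, Lambda l `^ s <= C * Lambda k `^ s * (1 + (nrm (l - k))%:R) ^+ N.
Proof.
have [N [C Cp h]] := Lambda_temperate.
pose t := `|s|; pose M := (Num.truncn (N%:R * t)).+1.
have hM : N%:R * t <= M%:R by rewrite ltW//; have /andP[] := truncn_itv (mulr_ge0 (ler0n R N) (normr_ge0 s)).
have P k l : Lambda l `^ t <= C `^ t * Lambda k `^ t * (1 + (nrm (l - k))%:R) ^+ M.
  have x1 : 1 <= 1 + (nrm (l - k))%:R :> R by rewrite lerDl.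
  have x0 : 0 <= 1 + (nrm (l - k))%:R :> R by rewrite addr_ge0.
  apply: (@le_trans _ _ ((C * Lambda k * (1 + (nrm (l - k))%:R) ^+ N) `^ t)).
    have q0 : 0 <= C * Lambda k * (1 + (nrm (l - k))%:R) ^+ N.
      by rewrite !mulr_ge0 ?exprn_ge0 ?(ltW (Lambda_gt0 _)) ?(ltW Cp).
    by apply: ge0_ler_powR; rewrite ?nnegrE ?(ltW (Lambda_gt0 _)) ?normr_ge0.
  rewrite powRM ?exprn_ge0 ?mulr_ge0 ?(ltW (Lambda_gt0 _)) ?(ltW Cp)//.
  rewrite powRM ?(ltW (Lambda_gt0 _)) ?(ltW Cp)//.
  rewrite ler_wpM2l ?mulr_ge0 ?powR_ge0//.
  by rewrite -!powR_mulrn// -powRrM ler_powR.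
exists M, (C `^ t); first exact: powR_gt0.
move=> k l; have [s0|s0] := leP 0 s.
  by have := P k l; rewrite /t ger0_norm.
have ts : s = - t by rewrite /t ltr0_norm// opprK.
have := P l k; rewrite nrmBC ts !powRN.
have lk : 0 < Lambda k `^ t by rewrite powR_gt0 ?Lambda_gt0.
have ll : 0 < Lambda l `^ t by rewrite powR_gt0 ?Lambda_gt0.
move: (Lambda k `^ t) (Lambda l `^ t) lk ll => a b a0 b0 H.
have ab0 : 0 <= a^-1 * b^-1 by rewrite mulr_ge0// invr_ge0 ltW.
have := ler_wpM2r ab0 H; set q := (_ ^+ M); set K := C `^ t => H'.
have -> : b^-1 = a * (a^-1 * b^-1) by field; rewrite !gt_eqF.
have -> // : K * a^-1 * q = K * b * q * (a^-1 * b^-1) by field; rewrite !gt_eqF.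
Qed.

End LatticeWeights.

(** * Fourier coefficients of the symbol *)

Definition inv_symbol {R : realType} {n : nat}
    (sigma : 'rV[int]_n -> 'rV[R]_n -> R[i]) (k : 'rV[int]_n) (x : 'rV[R]_n) :=
  (sigma k x)^-1.

Section SymbolCoefficients.
Context {R : realType} {n : nat}.
Variables (Lambda : 'rV[int]_n -> R) (mu0 mu1 mu C0 C1 : R).
Hypothesis hLambda : weight_function Lambda mu0 mu1 mu C0 C1.
Variables (rho m : R) (sigma : 'rV[int]_n -> 'rV[R]_n -> R[i]).
Hypothesis hsigma : symbM Lambda rho m sigma.

Let L0 k : 0 < Lambda k. Proof. exact: Lambda_gt0 hLambda k. Qed.

Lemma symbM_symbS : symbS Lambda rho m sigma.
Proof.
have [_ /(_ (fun=> false))] := hsigma.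
rewrite (_ : (fun k x => _) = sigma)//.
apply/funext => k; apply/funext => x.
rewrite Delta0 => [|j]; last by rewrite /mind.
by rewrite /monom big1 ?mul1r// => j _; rewrite /mind expr0.
Qed.

Lemma sigma_periodic k : zperiodic (sigma k).
Proof. by have [/(_ k) []] := hsigma. Qed.

Lemma sigma_smooth k : smooth (sigma k).
Proof. by have [/(_ k) []] := hsigma. Qed.

Lemma sigma_FD N : exists2 K, 0 <= K &
  forall k j h, FD j h N (K * Lambda k `^ m) (sigma k).
Proof.
apply: FD_smooth => [k|k|j l]; [exact: powR_ge0|exact: sigma_smooth|].
have [_ hS] := symbM_symbS; have [C C_gt0 hC] := hS (fun=> 0%N) (pidx j l).
exists C => // k x; have := hC k x.
rewrite Dfact_pidx (_ : mlen _ = 0%N) ?mulr0 ?subr0; last by rewrite /mlen big1.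
rewrite (_ : (fun y => _) = sigma k)//.
by apply/funext => y; rewrite Delta0.
Qed.

Lemma sigma_diff_FD N : exists2 K, 0 <= K &
  forall k i j h, FD j h N (K * Lambda k `^ (m - rho))
    (fun x => sigma (k + delta_mx 0 i) x - sigma k x).
Proof.
have sm k i : smooth (fun x => sigma (k + delta_mx 0 i) x - sigma k x).
  rewrite (_ : (fun x => _) = (fun x => 1 * sigma (k + delta_mx 0 i) x + (-1) * sigma k x)).
    by apply: smooth_lin; exact: sigma_smooth.
  by apply/funext => x; rewrite mul1r mulN1r.
have H i : exists K, 0 <= K /\ forall k j h, FD j h N (K * Lambda k `^ (m - rho))
    (fun x => sigma (k + delta_mx 0 i) x - sigma k x).
  have [K K0 hK] : exists2 K, 0 <= K & forall k j h, FD j h N (K * Lambda k `^ (m - rho))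
    (fun x => sigma (k + delta_mx 0 i) x - sigma k x).
    apply: (@FD_smooth _ _ _ (fun k x => sigma (k + delta_mx 0 i) x - sigma k x) (fun k => Lambda k `^ (m - rho))) => [k|k|j l]; [exact: powR_ge0|exact: sm|].
    have [_ hS] := symbM_symbS; have [C C_gt0 hC] := hS (pidx i 1) (pidx j l).
    exists C => // k x; have := hC k x.
    rewrite Dfact_pidx pidx_len mulr1.
    rewrite (_ : (fun y => _) = (fun y => sigma (k + delta_mx 0 i) y - sigma k y))//.
    by apply/funext => y; rewrite (@Delta_pidx _ _ _ i).
  by exists K.
have [K hK] := choice H; exists (\sum_i K i) => [|k i j h].
  by apply: sumr_ge0 => i _; exact: (hK i).1.
apply: FD_le ((hK i).2 k j h); rewrite ler_wpM2r ?powR_ge0// (bigD1 i)//= lerDl.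
by apply: sumr_ge0 => i' _; exact: (hK i').1.
Qed.

Hypothesis n_gt0 : (0 < n)%N.
Let j0 : 'I_n := Ordinal n_gt0.

Lemma sigma_bl k : bl (sigma k).
Proof.
have [K K0 hK] := sigma_FD 1.
by apply: bl_FD => [j h|x]; [exact: hK|exact: (FD_bound (hK k j0 0))].
Qed.

Lemma sigma_coef N : exists2 C, 0 <= C & forall k l,
  (1 + (nrm l)%:R) ^+ N * normc (fcoef (sigma k) l) <= C * Lambda k `^ m.
Proof.
have [K K0 hK] := sigma_FD N.
exists (n.+1%:R ^+ N * 2 * K) => [|k l]; first by rewrite !mulr_ge0// exprn_ge0.
rewrite -[leRHS]mulrA; apply: fcoef_decay; first exact: sigma_bl.
- exact: sigma_periodic.
- exact: hK.
- exact: FD_bound (hK k j0 0).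
Qed.

Lemma sigma_coef_step N : exists2 C, 0 <= C & forall k i l,
  (1 + (nrm l)%:R) ^+ N * normc (fcoef (sigma (k + delta_mx 0 i)) l - fcoef (sigma k) l)
    <= C * Lambda k `^ (m - rho).
Proof.
have [K K0 hK] := sigma_diff_FD N.
exists (n.+1%:R ^+ N * 2 * K) => [|k i l]; first by rewrite !mulr_ge0// exprn_ge0.
have h1 := sigma_bl k; have h2 := sigma_bl (k + delta_mx 0 i).
have hc : bl (chi (- l) : 'rV[R]_n -> R[i]) by exact: bl_chi.
rewrite -torus_intB; [|exact: blM|exact: blM].
rewrite -[leRHS]mulrA.
rewrite (_ : torus_int _ = fcoef (fun x => sigma (k + delta_mx 0 i) x - sigma k x) l); last first.
  by congr torus_int; apply/funext => x; rewrite mulrBl.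
apply: fcoef_decay; first exact: blB.
- by move=> x j; rewrite !sigma_periodic.
- exact: hK.
- exact: FD_bound (hK k i j0 0).
Qed.

(** Freezing the first variable of the symbol gains a factor
    [Lambda k `^ (- rho)] and costs a polynomial in the distance moved. *)
Lemma sigma_coef_freeze N : exists M : nat, exists2 C, 0 <= C & forall k p l,
  (1 + (nrm l)%:R) ^+ N * normc (fcoef (sigma p) l - fcoef (sigma k) l)
    <= C * Lambda k `^ (m - rho) * (1 + (nrm (p - k))%:R) ^+ M.
Proof.
have [C Cge hC] := sigma_coef_step N.
have [M [B Bgt hB]] := Lambda_powR hLambda (m - rho).
exists M.+1, (C * B) => [|k p l]; first by rewrite mulr_ge0// ltW.
set q := (1 + (nrm l)%:R) ^+ N; have q0 : 0 <= q by rewrite exprn_ge0// addr_ge0.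
have X0 := powR_ge0 (Lambda k) (m - rho).
have cb0 : 0 <= C * B * Lambda k `^ (m - rho) by rewrite !mulr_ge0// ltW.
pose b (r : nat) := C * B * Lambda k `^ (m - rho) * (1 + r%:R) ^+ M.
have H : q * normc (fcoef (sigma p) l - fcoef (sigma k) l) <=
   q * normc (fcoef (sigma k) l - fcoef (sigma k) l) + (nrm (p - k))%:R * b (nrm (p - k)).
  apply: (@lattice_path n R (fun p => q * normc (fcoef (sigma p) l - fcoef (sigma k) l)) b).
    move=> r s rs; rewrite /b ler_wpM2l// lerXn2r// ?nnegrE ?addr_ge0//.
    by rewrite lerD2l ler_nat.
  move=> p' i r h1 h2.
  have h3 : C * Lambda p' `^ (m - rho) <= b r.
    rewrite /b -!mulrA ler_wpM2l// mulrA; apply: le_trans (hB k p') _.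
    rewrite ler_wpM2l ?mulr_ge0 ?(ltW Bgt)// lerXn2r// ?nnegrE ?addr_ge0//.
    by rewrite lerD2l ler_nat.
  have h4 := le_trans (hC p' i l) h3.
  rewrite -/q in h4.
  have tri (x y z : R[i]) : normc (x - z) <= normc (y - z) + normc (x - y).
    by rewrite (_ : x - z = (y - z) + (x - y)) ?le_normcD//; ring.
  split; rewrite -lerBlDl -mulrBr; apply: le_trans h4; rewrite ler_wpM2l// lerBlDl.
    exact: tri.
  by rewrite -[normc (_ - fcoef (sigma p') l)]normcN opprB; exact: tri.
apply: le_trans H _; rewrite subrr normc0 mulr0 add0r /b exprS.
set Y := C * B * _; set z := (1 + _) ^+ M; rewrite mulrCA.
have z0 : 0 <= z by rewrite exprn_ge0// addr_ge0.
rewrite ler_wpM2l// ler_wpM2r// lerDr//.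
Qed.

Variables (Cell R1 : R).
Hypothesis Cell_gt0 : 0 < Cell.
Hypothesis hell : forall k x, R1 <= eucl k -> Cell * Lambda k `^ m <= normc (sigma k x).

Local Notation inv_sigma := (inv_symbol sigma).

Lemma sigma_neq0 k x : R1 <= eucl k -> sigma k x != 0.
Proof.
move=> /(hell x) h; apply: contraTneq h => ->; rewrite normc0 -ltNge.
by rewrite mulr_gt0// powR_gt0.
Qed.

Lemma inv_sigma_bl k : R1 <= eucl k -> bl (inv_sigma k).
Proof.
move=> hk; apply: (bl_inv (sigma_bl k)) => [|x]; last exact: hell.
by rewrite mulr_gt0// powR_gt0.
Qed.

(** After division by [Lambda k `^ m] the symbol is bounded above and below
    uniformly in [k], so the constant of [FD_inv] serves all [k]. *)
Lemma inv_sigma_coef N : exists2 C, 0 <= C & forall k l, R1 <= eucl k ->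
  (1 + (nrm l)%:R) ^+ N * normc (fcoef (inv_sigma k) l) <= C * Lambda k `^ (- m).
Proof.
have [K K0 hK] := sigma_FD N.
have [B B0 hB] := @FD_inv R n N K _ Cell_gt0.
exists (n.+1%:R ^+ N * 2 * B) => [|k l hk]; first by rewrite !mulr_ge0// exprn_ge0.
have W0 : 0 < Lambda k `^ m by rewrite powR_gt0.
have F j h : FD j h N (B * Lambda k `^ (- m)) (inv_sigma k).
  set z : R[i] := (Lambda k `^ m)%:C.
  have nz : normc z = Lambda k `^ m by rewrite normcR ger0_norm// ltW.
  have z0 : z != 0 by apply/eqP => z0; move: nz; rewrite z0 normc0 => e; rewrite -e ltxx in W0.
  have iz : normc z^-1 = Lambda k `^ (- m) by rewrite normcV nz powRN.
  have -> : inv_sigma k = fun x => z^-1 * (z^-1 * sigma k x)^-1.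
    by apply/funext => x; rewrite /inv_symbol; field; rewrite z0 sigma_neq0.
  rewrite mulrC -iz; apply: FDZ; apply: hB.
    have := FDZ z^-1 (hK k j h); rewrite iz powRN mulrCA mulVf ?mulr1//.
    by rewrite gt_eqF.
  move=> x; rewrite normcM iz powRN mulrC ler_pdivlMr//.
  exact: hell.
rewrite -[leRHS]mulrA; apply: fcoef_decay; first exact: inv_sigma_bl.
- by move=> x j; rewrite /inv_symbol sigma_periodic.
- exact: F.
- exact: FD_bound (F j0 0).
Qed.

End SymbolCoefficients.

(** * Convolution on the lattice *)

Section LatticeDecay.
Context {R : realType}.

Lemma asum_nat_sq : asum (fun i : nat => ((1 + i%:R) ^+ 2)^-1 : R).
Proof.
rewrite /asum -nneseries_esumT; last by move=> i; rewrite lee_fin.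
apply: (@le_lt_trans _ _ (2%:E)); last exact: ltry.
apply: lime_le; first by apply: is_cvg_nneseries => i _ _; rewrite lee_fin.
apply: nearW => k; rewrite sumEFin lee_fin.
suff H : \sum_(0 <= i < k) `|((1 + i%:R) ^+ 2)^-1| <= 2 - 2 / (1 + k%:R) :> R.
  by apply: le_trans H _; rewrite gerBl divr_ge0// addr_ge0.
elim: k => [|k ih]; first by rewrite big_geq// addr0 divr1 subrr.
rewrite big_nat_recr//= -(natr1 k) ger0_norm ?invr_ge0 ?exprn_ge0 ?addr_ge0//.
set x : R := 1 + k%:R; have x1 : 1 <= x by rewrite lerDl.
apply: le_trans (lerD ih (lexx _)) _; rewrite -?/x.
have x0 : 0 < x by lra.
have -> : 2 - 2 / x + (x ^+ 2)^-1 = 2 - (2 * x - 1) / x ^+ 2 by field; rewrite gt_eqF.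
have -> : 1 + (k%:R + 1) = x + 1 :> R by rewrite /x; ring.
have x10 : 0 < x + 1 by lra.
rewrite lerD2l lerN2 ler_pdivrMr// mulrAC ler_pdivlMr ?exprn_gt0//.
by rewrite expr2; nra.
Qed.

Lemma asum_int_sq : asum (fun z : int => ((1 + `|z|%:~R) ^+ 2)^-1 : R).
Proof.
rewrite /asum; set a := fun z : int => (`|((1 + `|z|%:~R) ^+ 2)^-1 : R|)%:E.
have a0 z : (0 <= a z)%E by rewrite lee_fin.
have half (e : nat -> int) (S : set int) : set_inj setT e -> S = e @` setT ->
    (forall i, (a (e i) <= (`|((1 + i%:R) ^+ 2)^-1 : R|)%:E)%E) ->
    (\esum_(z in S) a z < +oo)%E.
  move=> ie -> h; rewrite esum_image//; apply: le_lt_trans asum_nat_sq.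
  by apply: le_esum => i _; exact: h.
rewrite (esumID [set z : int | 0 <= z])// lte_add_pinfty// setTI.
  apply: (half Posz) => [i j _ _ [] //||i].
    apply/seteqP; split => [[k|k] //= _|z [i _ <-]//].
    by exists k.
  by rewrite /a lee_fin (_ : `|Posz i| = Posz i).
apply: (half Negz) => [i j _ _ [] //||i].
  apply/seteqP; split => [[k|k] //= _|z [i _ <-]//].
  by exists k.
rewrite /a lee_fin NegzE normrN.
rewrite (_ : `|i.+1%:Z| = i.+1%:Z)// !ger0_norm ?invr_ge0 ?exprn_ge0 ?addr_ge0//.
rewrite lef_pV2 ?posrE ?exprn_gt0 ?ltr_wpDr//.
by rewrite lerXn2r ?nnegrE ?addr_ge0// lerD2l ler_nat.
Qed.

Lemma asum_prod n (psi : int -> R) : (forall z, 0 <= psi z) -> asum psi ->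
  asum (fun k : 'rV[int]_n => \prod_j psi (k 0 j)).
Proof.
move=> p0 hp; elim: n => [|n ih].
  apply: (asum1 (a := 0)) => k; rewrite (_ : k = 0) ?eqxx//.
  by apply/rowP => -[].
pose e (p : int * 'rV[int]_n) : 'rV[int]_n.+1 := row_mx (p.1%:M : 'M[int]_1) p.2.
have be : bijective e.
  exists (fun k : 'rV[int]_n.+1 => (k 0 0, rsubmx (k : 'rV[int]_(1 + n)))).
    move=> [q y]; rewrite /e /=; congr pair; last by rewrite row_mxKr.
    by rewrite mxE; case: splitP => // j _; rewrite mxE ord1.
  move=> k; rewrite /e /=; apply/rowP => i; rewrite mxE; case: splitP => j ij.
    by rewrite mxE ord1 mulr1n; congr (k _ _); apply/val_inj; rewrite /= ij ord1.
  by rewrite mxE; congr (k _ _); exact/val_inj.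
have bb : set_bij setT setT e by rewrite setTT_bijective.
rewrite /asum (@reindex_esum _ _ _ _ _ e _ bb).
have -> : [set: int * 'rV[int]_n] = [set: int] `*`` (fun=> [set: 'rV[int]_n]).
  by apply/seteqP; split.
rewrite (_ : (fun p => _) = (fun p : int * 'rV[int]_n => (fun q y => `|psi q * \prod_j psi (y 0 j)|%:E) p.1 p.2)); last first.
  apply/funext => -[q y]; rewrite /e /=; congr (`|_|%:E).
  rewrite big_ord_recl; congr (psi _ * _).
    by rewrite mxE; case: splitP => // j _; rewrite mxE ord1.
  apply: eq_bigr => j _; congr psi.
  rewrite !mxE; case: splitP => l; first by rewrite ord1.
  by rewrite /= /bump /= add1n => -[/val_inj ->].
rewrite -(@esum_esum R _ _ [set: int] (fun=> [set: 'rV[int]_n]) (fun q y => `|psi q * \prod_j psi (y 0 j)|%:E))//.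
apply: (asum2P (f := fun q (y : 'rV[int]_n) => psi q * \prod_j psi (y 0 j))).
  by move=> q; exact: asumZ.
have := asumZ (rsum (fun y : 'rV[int]_n => `|\prod_j psi (y 0 j)|)) hp.
apply: asum_le => q; rewrite ger0_norm; last by apply: rsum_ge0.
rewrite mulrC -rsumZ; last exact: asum_abs.
by rewrite le_eqVlt; apply/orP; left; apply/eqP; apply: eq_rsum => y; rewrite normrM ger0_norm.
Qed.

(** A summable function on the lattice that dominates all rapidly decreasing
    ones; the exponent [2 * n] leaves a square for each coordinate. *)
Definition decay n (k : 'rV[int]_n) : R := ((1 + (nrm k)%:R) ^+ (2 * n))^-1.

Lemma decay_ge0 n (k : 'rV[int]_n) : 0 <= decay k.
Proof. by rewrite invr_ge0 exprn_ge0// addr_ge0. Qed.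

Lemma decayBC n (k l : 'rV[int]_n) : decay (k - l) = decay (l - k).
Proof. by rewrite /decay nrmBC. Qed.

Lemma decay_le1 n (k : 'rV[int]_n) : decay k <= 1.
Proof. by rewrite invf_le1 ?exprn_gt0 ?ltr_wpDr// exprn_ege1// lerDl. Qed.

Lemma asum_decay n : asum (@decay n).
Proof.
have h := @asum_prod n (fun z => ((1 + `|z|%:~R) ^+ 2)^-1)
   (fun z => ltac:(by rewrite invr_ge0 exprn_ge0// addr_ge0// ler0z)) asum_int_sq.
apply: asum_le h => k; rewrite ger0_norm ?decay_ge0// /decay.
rewrite prodfV lef_pV2 ?posrE.
- rewrite (_ : _ ^+ (2 * n) = \prod_(j < n) (1 + (nrm k)%:R) ^+ 2); last first.
    by rewrite prodr_const card_ord exprM.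
  apply: ler_prod => j _.
  rewrite exprn_ge0 ?addr_ge0 ?ler0z//=.
  rewrite lerXn2r// ?nnegrE ?addr_ge0 ?ler0z// lerD2l.
  by rewrite -natr_absz ler_nat /nrm (bigD1 j)//= leq_addr.
- by rewrite exprn_gt0// ltr_wpDr.
- by apply: prodr_gt0 => j _; rewrite exprn_gt0// ltr_wpDr// ler0z.
Qed.

End LatticeDecay.

Section Young.
Context {R : realType} {n : nat}.
Implicit Types (h : 'rV[int]_n -> R).

Lemma bij_sub (k : 'rV[int]_n) : bijective (fun l => k - l).
Proof. by exists (fun l => k - l) => l; rewrite opprB addrC subrK. Qed.

Lemma bij_addr (k : 'rV[int]_n) : bijective (fun l => l + k).
Proof. by exists (fun l => l - k) => l; rewrite ?addrK ?subrK. Qed.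

Definition conv h (k : 'rV[int]_n) : R := rsum (fun l => decay (k - l) * h l).

Lemma asum_decay_sub (k : 'rV[int]_n) : asum (fun l => decay (k - l) : R).
Proof. exact: (asum_reindex (bij_sub k) (asum_decay n)). Qed.

Lemma asum_decay_subr (k : 'rV[int]_n) : asum (fun l => decay (l - k) : R).
Proof. exact: (asum_reindex (bij_addr (- k)) (asum_decay n)). Qed.

Lemma rsum_decay_subr (k : 'rV[int]_n) : rsum (fun l => decay (l - k) : R) = rsum (@decay R n).
Proof. exact: (rsum_reindex (@decay R n) (bij_addr (- k))). Qed.

Lemma rsum_decay_sub (k : 'rV[int]_n) : rsum (fun l => decay (k - l) : R) = rsum (@decay R n).
Proof. exact: (rsum_reindex (@decay R n) (bij_sub k)). Qed.

Lemma conv_ge0 h k : (forall l, 0 <= h l) -> 0 <= conv h k.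
Proof. by move=> h0; apply: rsum_ge0 => l; rewrite mulr_ge0 ?decay_ge0. Qed.

(** How a family of arithmetic-geometric mean inequalities, one for each weight
    [t], yields the Cauchy-Schwarz inequality. *)
Lemma quad_le (c S Q : R) : 0 <= c -> 0 <= S -> 0 <= Q ->
  (forall t, 0 < t -> 2 * c <= t * S + Q / t) -> c ^+ 2 <= S * Q.
Proof.
move=> c0 S0 Q0 H; have [->|cn0] := eqVneq c 0; first by rewrite expr0n mulr_ge0.
have cp : 0 < c by rewrite lt_neqAle eq_sym cn0.
have [S00|Sn0] := eqVneq S 0.
  have t0 : 0 < (Q + 1) / c by rewrite divr_gt0//; lra.
  have := H _ t0; rewrite S00 mulr0 add0r invf_div mulrA ler_pdivlMr; last lra.
  by nra.
have Sp : 0 < S by rewrite lt_neqAle eq_sym Sn0.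
have := H (c / S) (divr_gt0 cp Sp); rewrite divfK// invf_div mulrA => h.
have : 2 * c * c <= (c + Q * S / c) * c by rewrite ler_wpM2r.
by rewrite [leRHS]mulrDl divfK// expr2; lra.
Qed.

Let dh_ge0 h k l : 0 <= decay (k - l) * h l ^+ 2.
Proof. by apply: mulr_ge0; [exact: decay_ge0|exact: sqr_ge0]. Qed.

Lemma young_aux h : asum (fun l => h l ^+ 2) ->
  asum2 (fun k l => decay (k - l) * h l ^+ 2).
Proof.
move=> hh; apply: (@asum2_swap R _ _ (fun l k => decay (k - l) * h l ^+ 2)); apply: asum2P.
  move=> l; have := asumZ (h l ^+ 2) (asum_decay_subr l).
  by apply: asum_le => k; rewrite (ger0_norm (dh_ge0 h k l)) mulrC.
have := asumZ (rsum (@decay R n)) hh; apply: asum_le => l.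
rewrite ger0_norm; last by apply: rsum_ge0.
rewrite -(rsum_decay_subr l) [leRHS]mulrC -(rsumZ _ (asum_decay_subr l)).
rewrite le_eqVlt; apply/orP; left; apply/eqP; apply: eq_rsum => k.
by rewrite (ger0_norm (dh_ge0 h k l)) mulrC.
Qed.

Lemma asum_conv h k : asum (fun l => h l ^+ 2) -> asum (fun l => decay (k - l) * h l).
Proof.
move=> hh; have h1 := asumD (asum_decay_sub k) (asum2_row k (young_aux hh)).
apply: asum_le h1 => l; rewrite normrM ger0_norm ?decay_ge0// -[X in _ <= X + _]mulr1 -mulrDr.
rewrite ler_wpM2l ?decay_ge0//.
by rewrite ler_norml; nra.
Qed.

(** Young's inequality for a summable kernel on square-summable functions. *)
Lemma young h : (forall l, 0 <= h l) -> asum (fun l => h l ^+ 2) ->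
  asum (fun k => conv h k ^+ 2) /\
  rsum (fun k => conv h k ^+ 2) <= rsum (@decay R n) ^+ 2 * rsum (fun l => h l ^+ 2).
Proof.
move=> h0 hh; set S := rsum (@decay R n).
have S0 : 0 <= S by apply: rsum_ge0 => k; exact: decay_ge0.
have A2 := young_aux hh.
pose Q k := rsum (fun l => decay (k - l) * h l ^+ 2).
have AQ : asum Q by exact: asum2_out' A2.
have dS := rsum_decay_sub.
have cQ k : conv h k ^+ 2 <= S * Q k.
  apply: quad_le => //; first exact: conv_ge0.
    by apply: rsum_ge0 => l; exact: dh_ge0.
  have a1 := asum_decay_sub k; have a2 := asum2_row k A2; have a3 := asum_conv k hh.
  move=> t t0; rewrite /S -(dS k) /Q (mulrC _ t^-1).
  rewrite -(rsumZ t a1) -(rsumZ t^-1 a2) -(rsumZ 2 a3) -(rsumD (asumZ t a1) (asumZ t^-1 a2)).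
  apply: ler_rsum; [|exact: asumZ|by apply: asumD; exact: asumZ].
  move=> l; rewrite mulrCA (mulrC t) (mulrCA t^-1) -mulrDr ler_wpM2l ?decay_ge0//.
  have : 0 <= t^-1 * (t - h l) ^+ 2 by rewrite mulr_ge0 ?sqr_ge0// invr_ge0 ltW.
  have -> : t^-1 * (t - h l) ^+ 2 = t + t^-1 * h l ^+ 2 - 2 * h l by field; rewrite gt_eqF.
  lra.
have AC : asum (fun k => conv h k ^+ 2).
  by apply: asum_le (asumZ S AQ) => k; rewrite ger0_norm ?sqr_ge0.
split => //; apply: le_trans (ler_rsum cQ AC (asumZ S AQ)) _.
rewrite rsumZ// expr2 -mulrA ler_wpM2l// /Q (rsum_swap A2).
rewrite -rsumZ//; apply: ler_rsum; [|exact: asum2_out' (asum2_swap A2)|exact: asumZ].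
move=> l; rewrite /S -(rsum_decay_subr l) [leRHS]mulrC -(rsumZ _ (asum_decay_subr l)).
by rewrite le_eqVlt; apply/orP; left; apply/eqP; apply: eq_rsum => k; rewrite mulrC.
Qed.

End Young.

(** * The formal adjoint *)

Section Schwartz.
Context {R : realType} {n : nat}.
Implicit Types (f g : 'rV[int]_n -> R[i]) (k l : 'rV[int]_n).

Lemma eucl_ge0 k : 0 <= eucl k :> R.
Proof. exact: sqrtr_ge0. Qed.

Lemma le_eucl k j : `|k 0 j|%:~R <= eucl k :> R.
Proof.
rewrite intr_norm -sqrtr_sqr /eucl ler_wsqrtr// (bigD1 j)//= lerDl.
by apply: sumr_ge0 => i _; exact: sqr_ge0.
Qed.

Lemma nrm_eucl k : (nrm k)%:R <= n%:R * eucl k :> R.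
Proof.
have -> : n%:R * eucl k = \sum_(j < n) eucl k :> R.
  by rewrite sumr_const card_ord mulr_natl.
rewrite /nrm natr_sum.
by apply: ler_sum => j _; rewrite natr_absz; exact: le_eucl.
Qed.

Lemma eucl_nrm k : eucl k <= (nrm k)%:R :> R.
Proof.
rewrite -[leRHS]ger0_norm// -sqrtr_sqr ler_wsqrtr//.
rewrite expr2 {1}/nrm natr_sum mulr_suml; apply: ler_sum => j _.
have -> : (k 0 j)%:~R ^+ 2 = `|k 0%R j|%N%:R * `|k 0%R j|%N%:R :> R.
  by rewrite -expr2 natr_absz intr_norm real_normK ?num_real.
by rewrite ler_wpM2l// (bigD1 j)//= lerDl sumr_ge0.
Qed.

Lemma schwartz_rapid f : schwartz f -> forall N, exists2 C : R, 0 <= C &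
  forall k, (1 + (nrm k)%:R) ^+ N * normc (f k) <= C.
Proof.
move=> hf N; have [C hC] := hf N.
have nn k : 0 <= (1 + eucl k : R) ^+ N by rewrite exprn_ge0// addr_ge0 ?eucl_ge0.
exists (n.+1%:R ^+ N * C) => [|k].
  rewrite mulr_ge0 ?exprn_ge0//; apply: le_trans (hC 0).
  by rewrite mulr_ge0 ?normc_ge0.
apply: (@le_trans _ _ (n.+1%:R ^+ N * ((1 + eucl k) ^+ N * normc (f k)))); last first.
  by rewrite ler_wpM2l ?exprn_ge0.
rewrite mulrA ler_wpM2r ?normc_ge0// -exprMn lerXn2r ?nnegrE ?addr_ge0//.
  by rewrite mulr_ge0// addr_ge0 ?eucl_ge0.
rewrite mulrDr mulr1 lerD//; first by rewrite ler1n.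
apply: le_trans (nrm_eucl k) _; rewrite ler_wpM2r ?eucl_ge0//.
by rewrite ler_nat.
Qed.

Lemma rapid_schwartz f : (forall N, exists C : R,
  forall k, (1 + (nrm k)%:R) ^+ N * normc (f k) <= C) -> schwartz f.
Proof.
move=> hf N; have [C hC] := hf N; exists C => k; apply: le_trans (hC k).
rewrite ler_wpM2r ?normc_ge0// lerXn2r ?nnegrE ?addr_ge0 ?eucl_ge0//.
by rewrite lerD2l eucl_nrm.
Qed.

Lemma schwartz_fset (F : {fset 'rV[int]_n}) f :
  (forall k, k \notin F -> f k = 0) -> schwartz f.
Proof.
move=> hF N; exists (\sum_(k <- F) (1 + eucl k) ^+ N * normc (f k)) => k.
have nn l : 0 <= (1 + eucl l) ^+ N * normc (f l) :> R.
  by rewrite mulr_ge0 ?normc_ge0 ?exprn_ge0// addr_ge0 ?eucl_ge0.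
have [kF|kF] := boolP (k \in F).
  by rewrite (big_fsetD1 k)//= lerDl; apply: sumr_ge0.
by rewrite hF// normc0 mulr0 sumr_ge0.
Qed.

Lemma le_decay M (x y : R) k : (1 + (nrm k)%:R) ^+ (2 * n + M) * x <= y ->
  (1 + (nrm k)%:R) ^+ M * x <= y * decay k.
Proof.
rewrite exprD -mulrA => h; rewrite /decay ler_pdivlMr ?exprn_gt0 ?ltr_wpDr//.
by rewrite mulrC.
Qed.

Lemma schwartz_decay f M : schwartz f -> exists2 C : R, 0 <= C &
  forall k, (1 + (nrm k)%:R) ^+ M * normc (f k) <= C * decay k.
Proof.
move=> /schwartz_rapid/(_ (2 * n + M)%N)[C C0 hC].
by exists C => // k; apply: le_decay.
Qed.

Lemma nrm_split N k l :
  (1 + (nrm l)%:R) ^+ N <= (1 + (nrm k)%:R) ^+ N * (1 + (nrm (l - k))%:R) ^+ N :> R.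
Proof.
rewrite -exprMn lerXn2r ?nnegrE ?mulr_ge0 ?addr_ge0//.
have := nrmD k (l - k); rewrite addrC subrK -(ler_nat R) natrD => h.
have : 0 <= (nrm k)%:R * (nrm (l - k))%:R :> R by rewrite mulr_ge0.
by rewrite mulrDl !mulrDr !mulr1 !mul1r; lra.
Qed.

Lemma schwartz_wsum f : schwartz f -> wsum f.
Proof.
move=> hf; have [C C0 hC] := schwartz_decay 1 hf.
apply: asum_le (asumZ C (asum_decay n)) => k.
rewrite ger0_norm ?mulr_ge0 ?normc_ge0 ?addr_ge0//.
by have := hC k; rewrite expr1.
Qed.

Lemma schwartz_l2 f : schwartz f -> asum (fun k => normc (f k) ^+ 2).
Proof.
move=> hf; have [C C0 hC] := schwartz_decay 0 hf.
apply: asum_le (asumZ (C ^+ 2) (asum_decay n)) => k.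
rewrite ger0_norm ?sqr_ge0//; have := hC k; rewrite expr0 mul1r => h.
have d0 := decay_ge0 (R := R) k; have d1 := decay_le1 (R := R) k.
apply: (@le_trans _ _ ((C * decay k) ^+ 2)).
  by rewrite lerXn2r ?nnegrE ?normc_ge0 ?mulr_ge0.
by rewrite exprMn ler_wpM2l ?sqr_ge0// expr2 ler_piMl.
Qed.

Lemma asum2_decay : asum2 (fun k l => decay (l - k) * decay k : R).
Proof.
apply: asum2P => [k|].
  have := asumZ (decay k) (asum_decay_subr (R := R) k).
  by apply: asum_le => l; rewrite ger0_norm ?mulr_ge0 ?decay_ge0// mulrC.
apply: asum_le (asumZ (rsum (@decay R n)) (asum_decay n)) => k.
rewrite ger0_norm; last by apply: rsum_ge0.
rewrite -(rsum_decay_subr k) [leRHS]mulrC -(rsumZ _ (asum_decay_subr k)).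
rewrite le_eqVlt; apply/orP; left; apply/eqP; apply: eq_rsum => l.
by rewrite ger0_norm ?mulr_ge0 ?decay_ge0// mulrC.
Qed.

Definition kdelta k l : R[i] := (l == k)%:R.

Lemma schwartz_kdelta k : schwartz (kdelta k).
Proof.
apply: (@schwartz_fset [fset k]%fset) => l; rewrite inE /kdelta => /negbTE -> //.
Qed.

End Schwartz.

Section Adjoint.
Context {R : realType} {n : nat}.
Variables (Lambda : 'rV[int]_n -> R) (mu0 mu1 mu C0 C1 : R).
Hypothesis hLambda : weight_function Lambda mu0 mu1 mu C0 C1.
Variables (rho m : R) (sigma : 'rV[int]_n -> 'rV[R]_n -> R[i]).
Hypothesis hsigma : symbM Lambda rho m sigma.
Hypothesis n_gt0 : (0 < n)%N.
Implicit Types (f g : 'rV[int]_n -> R[i]) (k l : 'rV[int]_n).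

Let L0 k : 0 < Lambda k. Proof. exact: Lambda_gt0 hLambda k. Qed.

(** The matrix of the operator in the basis of point masses; [pdo_entry]
    justifies the name. *)
Definition entry k l : R[i] := fcoef (sigma k) (l - k).

Lemma entry_decay M : exists2 C, 0 <= C & forall k l,
  (1 + (nrm (l - k))%:R) ^+ M * normc (entry k l) <= C * Lambda k `^ m * decay (l - k).
Proof.
have [C C_ge0 hC] := sigma_coef hsigma n_gt0 (2 * n + M).
by exists C => // k l; apply: le_decay; exact: hC.
Qed.

Lemma entry_decay0 : exists2 C, 0 <= C & forall k l,
  normc (entry k l) <= C * Lambda k `^ m * decay (l - k).
Proof.
by have [C C_ge0 hC] := entry_decay 0; exists C => // k l; have := hC k l; rewrite expr0 mul1r.
Qed.

Lemma pdo_entry f k : schwartz f -> pdo sigma f k = csum (fun l => entry k l * f l).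
Proof.
by move=> hf; apply: pdoE; [exact: schwartz_wsum|exact: (sigma_bl hsigma n_gt0)].
Qed.

Lemma Lambda_poly (s : R) : exists M : nat, exists2 C, 0 <= C &
  forall k, Lambda k `^ s <= C * (1 + (nrm k)%:R) ^+ M.
Proof.
have [M [C C_gt0 hC]] := Lambda_powR hLambda s.
exists M, (C * Lambda 0 `^ s) => [|k]; first by rewrite mulr_ge0 ?powR_ge0// ltW.
by have := hC 0 k; rewrite subr0.
Qed.

Lemma Lambda_schwartz (s : R) g N : schwartz g -> exists2 C, 0 <= C &
  forall k, (1 + (nrm k)%:R) ^+ N * (Lambda k `^ s * normc (g k)) <= C * decay k.
Proof.
move=> hg; have [M [C C_ge0 hC]] := Lambda_poly s.
have [B B_ge0 hB] := schwartz_decay (N + M) hg.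
exists (C * B) => [|k]; first exact: mulr_ge0.
apply: (@le_trans _ _ (C * ((1 + (nrm k)%:R) ^+ (N + M) * normc (g k)))); last first.
  by rewrite -mulrA ler_wpM2l.
rewrite exprD; set q := 1 + (nrm k)%:R.
have -> : C * (q ^+ N * q ^+ M * normc (g k)) = q ^+ N * (C * q ^+ M * normc (g k)) by ring.
by rewrite ler_wpM2l ?exprn_ge0 ?addr_ge0// ler_wpM2r ?normc_ge0.
Qed.

Lemma asumc2_entry f g : schwartz f -> schwartz g ->
  asumc2 (fun k l => entry k l * f l * conjc (g k)).
Proof.
move=> hf hg; have [C C_ge0 hC] := entry_decay0.
have [B B_ge0 hB] := Lambda_schwartz m 0 hg.
have [D D_ge0 hD] := schwartz_rapid hf 0.
apply: asumc2_le (asum2Z (C * B * D) (@asum2_decay R n)) => k l.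
have h1 := hC k l; have h2 := hB k; have h3 := hD l.
rewrite expr0 mul1r in h2; rewrite expr0 mul1r in h3.
rewrite !normcM normc_conj.
apply: (@le_trans _ _ (C * Lambda k `^ m * decay (l - k) * D * normc (g k))).
  by rewrite ler_wpM2r ?normc_ge0// ler_pM ?normc_ge0.
have -> : C * Lambda k `^ m * decay (l - k) * D * normc (g k) =
  (C * D * decay (l - k)) * (Lambda k `^ m * normc (g k)) by ring.
have -> : C * B * D * (decay (l - k) * decay k) =
  (C * D * decay (l - k)) * (B * decay k) by ring.
by rewrite ler_wpM2l// !mulr_ge0// decay_ge0.
Qed.

(** The conjugate transpose of the matrix. *)
Definition adjoint_entry g l : R[i] := csum (fun k => conjc (entry k l) * g k).

Lemma adjoint_entryP f g : schwartz f -> schwartz g ->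
  l2inner (pdo sigma f) g = l2inner f (adjoint_entry g).
Proof.
move=> hf hg; have h := asumc2_entry hf hg; have h' := asumc2_swap h.
transitivity (csum (fun k => csum (fun l => entry k l * f l * conjc (g k)))).
  apply: eq_csum => k; rewrite pdo_entry//.
  have [C C_ge0 hC] := entry_decay0.
  have hkf : asumc (fun l => entry k l * f l).
    have [B B_ge0 hB] := schwartz_rapid hf 0.
    apply: asumc_le (asumZ (C * Lambda k `^ m * B) (asum_decay_subr k)) => l.
    rewrite normcM mulrAC ler_pM ?normc_ge0//.
    by have := hB l; rewrite expr0 mul1r.
  by rewrite mulrC -csumZ//; apply: eq_csum => l; rewrite mulrC.
rewrite csum_swap//; apply: eq_csum => l.
rewrite /adjoint_entry -csum_conj -csumZ.
  apply: eq_csum => k.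
  have -> : conjc (conjc (entry k l) * g k) = entry k l * conjc (g k).
    by case: (entry k l) (g k) => a b [c d]; apply: eqc => /=; ring.
  by ring.
have [C C_ge0 hC] := entry_decay0; have [B B_ge0 hB] := Lambda_schwartz m 0 hg.
apply: asumc_le (asumZ (C * B) (asum_decay n)) => k.
rewrite normc_conj normcM normc_conj.
have h1 := hC k l; have h2 := hB k; rewrite expr0 mul1r in h2.
apply: (@le_trans _ _ (C * (Lambda k `^ m * normc (g k)))).
  rewrite mulrA ler_wpM2r ?normc_ge0//; apply: le_trans h1 _.
  by rewrite ler_piMr ?decay_le1// mulr_ge0// powR_ge0.
by rewrite -mulrA ler_wpM2l.
Qed.

Lemma schwartz_adjoint_entry g : schwartz g -> schwartz (adjoint_entry g).
Proof.
move=> hg; apply: rapid_schwartz => N.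
have [C C_ge0 hC] := entry_decay N; have [B B_ge0 hB] := Lambda_schwartz m N hg.
exists (2 * rsum (fun k => C * B * decay k)) => l.
have bound k : (1 + (nrm l)%:R) ^+ N * normc (conjc (entry k l) * g k) <= C * B * decay k.
  rewrite normcM normc_conj.
  have h1 := hC k l; have h2 := hB k; have h3 := nrm_split (R := R) N k l.
  set x := (1 + (nrm k)%:R) ^+ N in h2 h3; set y := (1 + (nrm (l - k))%:R) ^+ N in h1 h3.
  have x0 : 0 <= x by rewrite exprn_ge0// addr_ge0.
  have y0 : 0 <= y by rewrite exprn_ge0// addr_ge0.
  apply: (@le_trans _ _ (x * y * (normc (entry k l) * normc (g k)))).
    by rewrite ler_wpM2r// mulr_ge0 ?normc_ge0.
  have -> : x * y * (normc (entry k l) * normc (g k)) =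
    (y * normc (entry k l)) * (x * normc (g k)) by ring.
  apply: (@le_trans _ _ ((C * Lambda k `^ m) * (x * normc (g k)))).
    rewrite ler_wpM2r ?mulr_ge0 ?normc_ge0//; apply: le_trans h1 _.
    by rewrite ler_piMr ?decay_le1// mulr_ge0// powR_ge0.
  have -> : (C * Lambda k `^ m) * (x * normc (g k)) =
     C * (x * (Lambda k `^ m * normc (g k))) by ring.
  by rewrite -mulrA ler_wpM2l.
have q1 : 1 <= (1 + (nrm l)%:R) ^+ N :> R by rewrite exprn_ege1// lerDl.
have hs : asumc (fun k => conjc (entry k l) * g k).
  apply: asumc_le (asumZ (C * B) (asum_decay n)) => k; apply: le_trans (bound k).
  by rewrite ler_peMl ?normc_ge0.
have q0 : 0 <= (1 + (nrm l)%:R) ^+ N :> R by lra.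
apply: le_trans (ler_wpM2l q0 (le_normc_csum hs)) _.
rewrite mulrCA ler_wpM2l// -rsumZ//; apply: ler_rsum => //.
  exact: asumZ.
by apply: asumZ; exact: asum_decay.
Qed.

Lemma formal_adjointP : is_formal_adjoint (pdo sigma) (formal_adjoint (pdo sigma)).
Proof.
rewrite /formal_adjoint; case: xgetP => [A _ []//|h].
exfalso; apply: (h adjoint_entry); split; [exact: schwartz_adjoint_entry|].
by move=> f g; exact: adjoint_entryP.
Qed.

Lemma formal_adjoint_kdelta k l :
  formal_adjoint (pdo sigma) (kdelta k) l = conjc (entry k l).
Proof.
have [_ /(_ (kdelta l) (kdelta k) (schwartz_kdelta l) (schwartz_kdelta k))] := formal_adjointP.
rewrite /l2inner (csum1 (a := k)); last first.
  by move=> j /negbTE jk; rewrite /kdelta jk conjc0 mulr0.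
rewrite (csum1 (a := l)); last by move=> j /negbTE jl; rewrite /kdelta jl mul0r.
rewrite /kdelta !eqxx conjc1 mulr1 mul1r pdo_entry; last exact: schwartz_kdelta.
rewrite (csum1 (a := l)); last by move=> j /negbTE jl; rewrite /kdelta jl mulr0.
by rewrite /kdelta eqxx mulr1 => ->; rewrite conjcK.
Qed.

(** The adjoint relation is tested against the point mass at [k]. *)
Lemma maximal_entry (g f : 'rV[int]_n -> R[i]) k : maximal_op sigma (g, f) ->
  f k = csum (fun l => entry k l * g l).
Proof.
move=> [_ _ /= /(_ _ (schwartz_kdelta k))].
rewrite {2}/l2inner (csum1 (a := k)); last first.
  by move=> j /negbTE jk; rewrite /kdelta jk conjc0 mulr0.
have -> : conjc (kdelta k k) = 1 :> R[i] by rewrite /kdelta eqxx conjc1.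
rewrite mulr1 => <-; apply: eq_csum => l.
by rewrite formal_adjoint_kdelta conjcK mulrC.
Qed.

End Adjoint.

(** * Square-summable functions *)

Section SquareSummable.
Context {R : realType} {n : nat}.
Implicit Types (f g u : 'rV[int]_n -> R[i]).

Lemma l2sqE f : asum (fun k => normc (f k) ^+ 2) ->
  l2sq f = (rsum (fun k => normc (f k) ^+ 2))%:E.
Proof. by move=> h; rewrite rsum_nnegE// => k; exact: sqr_ge0. Qed.

Lemma l2P f : l2 f <-> asum (fun k => normc (f k) ^+ 2).
Proof.
rewrite /l2 /asum; suff -> : l2sq f = (\esum_(k in [set: 'rV[int]_n]) `|normc (f k) ^+ 2|%:E)%E by [].
by apply: eq_esum => k _; rewrite ger0_norm ?sqr_ge0.
Qed.

Lemma asum_sqr_le (h h' : 'rV[int]_n -> R) (c : R) :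
  (forall k, `|h k| <= c * h' k) -> asum (fun k => h' k ^+ 2) ->
  asum (fun k => h k ^+ 2).
Proof.
move=> hh /(asumZ (c ^+ 2)); apply: asum_le => k.
rewrite ger0_norm ?sqr_ge0// -exprMn -real_normK ?num_real//.
by rewrite lerXn2r// ?nnegrE// (le_trans _ (hh k)).
Qed.

Lemma asum_sqrD (h h' : 'rV[int]_n -> R) : asum (fun k => h k ^+ 2) ->
  asum (fun k => h' k ^+ 2) -> asum (fun k => (h k + h' k) ^+ 2).
Proof.
move=> h1 h2; apply: asum_le (asumD (asumZ 2 h1) (asumZ 2 h2)) => k.
rewrite ger0_norm ?sqr_ge0//.
have := sqr_ge0 (h k - h' k); rewrite sqrrB sqrrD; lra.
Qed.

Lemma asumc_inner f g : l2 f -> l2 g -> asumc (fun k => f k * conjc (g k)).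
Proof.
move=> /l2P hf /l2P hg; apply: asumc_le (asumD hf hg) => k.
rewrite normcM normc_conj.
by have := sqr_ge0 (normc (f k) - normc (g k)); rewrite sqrrB; have := sqr_ge0 (normc (f k)); have := sqr_ge0 (normc (g k)); lra.
Qed.

(** Continuity of the inner product in its first argument. *)
Lemma inner_small g (e : R) : l2 g -> 0 < e -> exists2 d : R, 0 < d &
  forall f, (l2sq f <= d%:E)%E -> normc (l2inner f g) <= e.
Proof.
move=> hg e0; have hg' := (l2P g).1 hg; set G := rsum (fun k => normc (g k) ^+ 2).
have G0 : 0 <= G by apply: rsum_ge0 => k; exact: sqr_ge0.
pose t := 2 * (G + 1) / e; have t0 : 0 < t by rewrite divr_gt0//; lra.
exists (e / (2 * t)) => [|f fd]; first by rewrite divr_gt0// mulr_gt0.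
have hf : l2 f by apply: le_lt_trans fd _; exact: ltry.
have hf' := (l2P f).1 hf; have hfg := asumc_inner hf hg.
apply: le_trans (le_normc_csum hfg) _; rewrite -rsumZ//.
(* arithmetic-geometric mean with weight [t] *)
apply: (@le_trans _ _ (rsum (fun k => t * normc (f k) ^+ 2 + t^-1 * normc (g k) ^+ 2))).
  apply: ler_rsum; [|exact: asumZ|by apply: asumD; exact: asumZ].
  move=> k; rewrite normcM normc_conj; move: (normc _) (normc _) => b a.
  have : 0 <= t^-1 * (t * a - b) ^+ 2 by rewrite mulr_ge0 ?sqr_ge0// invr_ge0 ltW.
  have -> : t^-1 * (t * a - b) ^+ 2 = t * a ^+ 2 + t^-1 * b ^+ 2 - 2 * (a * b) by field; rewrite gt_eqF.
  lra.
rewrite rsumD; [|exact: asumZ|exact: asumZ]; rewrite !rsumZ// -/G.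
have h1 : rsum (fun k => normc (f k) ^+ 2) <= e / (2 * t) by rewrite -lee_fin -l2sqE.
have h2 : t * rsum (fun k => normc (f k) ^+ 2) <= t * (e / (2 * t)) by rewrite ler_wpM2l// ltW.
have e1 : t * (e / (2 * t)) = e / 2 by field; rewrite gt_eqF.
have e2 : t^-1 * G <= e / 2.
  rewrite /t invf_div mulrAC ler_pdivrMr; last lra.
  have -> : e / 2 * (2 * (G + 1)) = e * (G + 1) by field.
  by rewrite ler_wpM2l ?(ltW e0)//; lra.
lra.
Qed.

Lemma l2innerB f f' g : l2 f -> l2 f' -> l2 g ->
  l2inner (fun k => f k - f' k) g = l2inner f g - l2inner f' g.
Proof.
move=> hf hf' hg; rewrite /l2inner -csumB; do ?exact: asumc_inner.
by apply: eq_csum => k; rewrite mulrBl.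
Qed.

Lemma l2cvgP (u : nat -> 'rV[int]_n -> R[i]) f : l2cvg u f <->
  forall d : R, 0 < d -> exists N, forall j, (N <= j)%N ->
    (l2sq (fun k => (u j k - f k)%R) <= d%:E)%E.
Proof.
have nn j : (0 <= l2sq (fun k => (u j k - f k)%R))%E.
  by apply: esum_ge0 => k _; rewrite lee_fin sqr_ge0.
split.
  move=> /fine_cvgP[[N1 _ fin] /cvgrPdist_le h] d d0.
  have [N2 _ hN] := h d d0; exists (maxn N1 N2) => j; rewrite geq_max => /andP[j1 j2].
  have := hN j j2; rewrite /= sub0r normrN ger0_norm ?fine_ge0// => hj.
  by rewrite -(fineK (fin j j1)) lee_fin.
move=> h; apply/fine_cvgP; split.
  have [N hN] := h 1 ltr01; exists N => // j /= Nj.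
  by rewrite ge0_fin_numE//; apply: le_lt_trans (hN j Nj) _; exact: ltry.
apply/cvgrPdist_le => d d0; have [N hN] := h d d0.
exists N => // j /= Nj; rewrite sub0r normrN ger0_norm ?fine_ge0//.
have hj := hN j Nj; rewrite -lee_fin fineK// ge0_fin_numE//.
by apply: le_lt_trans hj _; exact: ltry.
Qed.

End SquareSummable.

(** * Elliptic regularity *)

Section Regularity.
Context {R : realType} {n : nat}.
Variables (Lambda : 'rV[int]_n -> R) (mu0 mu1 mu C0 C1 : R).
Hypothesis hLambda : weight_function Lambda mu0 mu1 mu C0 C1.
Variables (rho m : R) (sigma : 'rV[int]_n -> 'rV[R]_n -> R[i]).
Hypothesis hsigma : symbM Lambda rho m sigma.
Hypothesis n_gt0 : (0 < n)%N.
Implicit Types (f g : 'rV[int]_n -> R[i]) (k l : 'rV[int]_n).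

Let L0 k : 0 < Lambda k. Proof. exact: Lambda_gt0 hLambda k. Qed.

Variables (Cell R1 : R).
Hypothesis Cell_gt0 : 0 < Cell.
Hypothesis hell : forall k x, R1 <= eucl k -> Cell * Lambda k `^ m <= normc (sigma k x).

Local Notation inv_sigma := (inv_symbol sigma).

Lemma l2_bounded g : l2 g -> exists2 B, 0 <= B & forall k, normc (g k) <= B.
Proof.
move=> /l2P hg; exists (1 + rsum (fun k => normc (g k) ^+ 2)) => [|k].
  by rewrite addr_ge0// rsum_ge0// => k; exact: sqr_ge0.
have := asum_sup k hg.
rewrite ger0_norm ?sqr_ge0// (eq_rsum (g := fun k => normc (g k) ^+ 2)) => [h|l].
  by nra.
by rewrite ger0_norm ?sqr_ge0.
Qed.

Lemma asumc_entry_bounded (a : 'rV[int]_n -> R[i]) g (c B : R) k :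
  (forall l, normc (a l) <= c * decay (l - k)) -> 0 <= c ->
  (forall l, normc (g l) <= B) -> asumc (fun l => a l * g l).
Proof.
move=> ha c0 hB; apply: asumc_le (asumZ (c * B) (asum_decay_subr k)) => l.
by rewrite normcM mulrAC ler_pM ?normc_ge0.
Qed.

(** With the first variable of the symbol frozen at [k], composing with the
    reciprocal symbol is multiplication of functions on the torus, so the
    frozen operator is inverted exactly. *)
Lemma frozen_inverse g k : l2 g -> R1 <= eucl k ->
  csum (fun l => fcoef (inv_sigma k) (l - k) *
                 csum (fun p => fcoef (sigma k) (p - l) * g p)) = g k.
Proof.
move=> hg hk; have [B B_ge0 hB] := l2_bounded hg.
have [C C_ge0 hC] := sigma_coef hsigma n_gt0 (2 * n + 1).
have [D D_ge0 hD] := inv_sigma_coef hLambda hsigma n_gt0 Cell_gt0 hell (2 * n).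
have hCk l : (1 + (nrm l)%:R) * normc (fcoef (sigma k) l) <= (C * Lambda k `^ m) * decay l.
  by have := le_decay (hC k l); rewrite expr1.
have hCk0 l : normc (fcoef (sigma k) l) <= (C * Lambda k `^ m) * decay l.
  apply: le_trans (hCk l); rewrite mulrDl mul1r lerDl.
  by rewrite mulr_ge0 ?normc_ge0.
have hDk l : normc (fcoef (inv_sigma k) l) <= (D * Lambda k `^ (- m)) * decay l.
  have := hD k l hk; rewrite -[(2 * n)%N]addn0 => h.
  by have := le_decay h; rewrite expr0 mul1r.
have c0 : 0 <= C * Lambda k `^ m by rewrite mulr_ge0 ?powR_ge0.
have d0 : 0 <= D * Lambda k `^ (- m) by rewrite mulr_ge0 ?powR_ge0.
set c := C * _ in hCk hCk0 c0; set d := D * _ in hDk d0.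
have A2 : asumc2 (fun l p => fcoef (inv_sigma k) (l - k) * (fcoef (sigma k) (p - l) * g p)).
  have A : asum2 (fun l p => decay (l - k) * decay (p - l) : R).
    apply: asum2P => [l|]; first by apply: asumZ; exact: asum_decay_subr.
    apply: asum_le (asumZ (rsum (@decay R n)) (asum_decay_subr k)) => l.
    rewrite ger0_norm; last by apply: rsum_ge0.
    rewrite -(rsum_decay_subr l) [leRHS]mulrC -(rsumZ _ (asum_decay_subr l)).
    rewrite le_eqVlt; apply/orP; left; apply/eqP; apply: eq_rsum => p.
    by rewrite ger0_norm ?mulr_ge0 ?decay_ge0.
  apply: asumc2_le (asum2Z (d * c * B) A) => l p; rewrite !normcM.
  have -> : d * c * B * (decay (l - k) * decay (p - l)) =
    (d * decay (l - k)) * ((c * decay (p - l)) * B) by ring.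
  by rewrite ler_pM ?mulr_ge0 ?normc_ge0// ler_pM ?normc_ge0.
transitivity (csum (fun l => csum (fun p =>
    fcoef (inv_sigma k) (l - k) * (fcoef (sigma k) (p - l) * g p)))).
  apply: eq_csum => l; rewrite csumZ//.
  by apply: (@asumc_entry_bounded _ _ c B l).
rewrite csum_swap//.
have wc : wsum (fcoef (sigma k)).
  apply: asum_le (asumZ c (asum_decay n)) => l.
  by rewrite ger0_norm ?mulr_ge0 ?normc_ge0 ?addr_ge0.
have E p : csum (fun l => fcoef (inv_sigma k) (l - k) * (fcoef (sigma k) (p - l) * g p)) =
    g p * (p == k)%:R.
  have h1 : asumc (fun l => fcoef (sigma k) (p - l) * fcoef (inv_sigma k) (l - k)).
    apply: asumc_le (asumZ (c * d) (asum_decay_subr k)) => l.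
    rewrite normcM -mulrA ler_pM ?normc_ge0//.
    by apply: le_trans (hCk0 _) _; rewrite ler_piMr ?decay_le1.
  transitivity (g p * csum (fun l => fcoef (sigma k) (p - l) * fcoef (inv_sigma k) (l - k))).
    by rewrite -csumZ//; apply: eq_csum => l; ring.
  congr (_ * _); rewrite -(csum_reindex _ (bij_sub p)).
  rewrite (eq_csum (g := fun q => fcoef (sigma k) q * fcoef (inv_sigma k) ((p - k) - q))); last first.
    move=> q /=; rewrite subKr; congr (_ * fcoef _ _).
    by rewrite addrAC.
  rewrite -fcoefM//.
  - rewrite /fcoef (_ : (fun x => _) = chi (- (p - k))).
      by rewrite torus_int_chi oppr_eq0 subr_eq0.
    by apply/funext => x; rewrite mulVf ?mul1r// (sigma_neq0 hLambda Cell_gt0 hell).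
  - exact: (inv_sigma_bl hLambda hsigma n_gt0 Cell_gt0 hell).
  - exact: (sigma_bl hsigma n_gt0).
  - exact: (sigma_periodic hsigma).
rewrite (eq_csum E) (csum1 (a := k)); last by move=> p /negbTE ->; rewrite mulr0.
by rewrite eqxx mulr1.
Qed.


End Regularity.

Section RegularityStep.
Context {R : realType} {n : nat}.
Variables (Lambda : 'rV[int]_n -> R) (mu0 mu1 mu C0 C1 : R).
Hypothesis hLambda : weight_function Lambda mu0 mu1 mu C0 C1.
Variables (rho m : R) (sigma : 'rV[int]_n -> 'rV[R]_n -> R[i]).
Hypothesis hsigma : symbM Lambda rho m sigma.
Hypothesis n_gt0 : (0 < n)%N.
Implicit Types (f g : 'rV[int]_n -> R[i]) (k l : 'rV[int]_n).
Let L0 k : 0 < Lambda k. Proof. exact: Lambda_gt0 hLambda k. Qed.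
Variables (Cell R1 : R).
Hypothesis Cell_gt0 : 0 < Cell.
Hypothesis hell : forall k x, R1 <= eucl k -> Cell * Lambda k `^ m <= normc (sigma k x).
Local Notation inv_sigma := (inv_symbol sigma).

Lemma Lambda_powRD k (s t : R) : Lambda k `^ (s + t) = Lambda k `^ s * Lambda k `^ t.
Proof. by rewrite powRD//; apply/implyP => _; rewrite gt_eqF. Qed.

Lemma Lambda_powR_mono (s t : R) : s <= t -> exists2 B, 0 <= B &
  forall k, Lambda k `^ s <= B * Lambda k `^ t.
Proof.
move=> st; have st' : s - t <= 0 by rewrite subr_le0.
have [B B_gt0 hB] := Lambda_powR_neg hLambda st'.
exists B => [|k]; first exact: ltW.
by rewrite -{1}(subrK t s) Lambda_powRD ler_wpM2r ?powR_ge0.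
Qed.

(** The product of a coefficient of the reciprocal symbol with the error made
    by freezing the symbol is of order [- rho], uniformly enough that any
    weight of order at most [s + rho] can be moved onto the last variable as a
    weight of order [s]. *)
Lemma freeze_error (s t : R) : t <= s + rho -> exists2 K, 0 <= K &
  forall k l p, R1 <= eucl k ->
  Lambda k `^ t * (normc (fcoef (inv_sigma k) (l - k)) *
    normc (entry sigma l p - fcoef (sigma k) (p - l)))
  <= K * (decay (k - l) * (decay (l - p) * Lambda p `^ s)).
Proof.
move=> tsr.
have [M3 [C3 C3_gt0 hC3]] := Lambda_powR hLambda s.
have [M [C2 C2_ge0 hC2]] := sigma_coef_freeze hLambda hsigma n_gt0 (2 * n + M3).
have [D D_ge0 hD] := inv_sigma_coef hLambda hsigma n_gt0 Cell_gt0 hell (2 * n + (M + M3)).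
have [B2 B2_ge0 hB2] : exists2 B, 0 <= B & forall k, Lambda k `^ (t - rho) <= B * Lambda k `^ s.
  by apply: Lambda_powR_mono; lra.
exists (D * C2 * B2 * C3) => [|k l p hk]; first by rewrite !mulr_ge0// ltW.
have hi := le_decay (hD k (l - k) hk).
have hd := le_decay (hC2 k l (p - l)); rewrite -/(entry sigma l p) in hd.
have hw := hC3 p k; have hB := hB2 k.
have := nrm_split (R := R) M3 (l - p) (k - p).
rewrite (_ : k - p - (l - p) = k - l); last by rewrite opprB addrA subrK.
rewrite (nrmBC l p) (nrmBC k l) decayBC (decayBC l p).
set x := 1 + (nrm (l - k))%:R in hi hd *; set y := 1 + (nrm (p - l))%:R in hd *.
rewrite (decayBC p l) in hd *; rewrite (decayBC l k) in hi *.
move: hi hd hw hB; rewrite exprD.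
set i := normc _; set d := normc _; set e1 := decay _; set e2 := decay _.
set z := (1 + (nrm (k - p))%:R) ^+ M3 => hi hd hw hB hz.
have x0 : 0 < x by rewrite ltr_wpDr.
have y0 : 0 < y by rewrite ltr_wpDr.
have i0 : 0 <= i by exact: normc_ge0.
have d0 : 0 <= d by exact: normc_ge0.
have e10 : 0 <= e1 by exact: decay_ge0.
have e20 : 0 <= e2 by exact: decay_ge0.
have xM : 0 < x ^+ M by exact: exprn_gt0.
have xM3 : 0 < x ^+ M3 by exact: exprn_gt0.
have yM3 : 0 < y ^+ M3 by exact: exprn_gt0.
have Lp (a : R) q : 0 <= Lambda q `^ a by exact: powR_ge0.
have q0 : 0 < x ^+ M * x ^+ M3 * y ^+ M3 by rewrite !mulr_gt0.
rewrite -(ler_pM2l q0).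
have h1 : (x ^+ M * x ^+ M3 * i) * (y ^+ M3 * d) <=
    (D * Lambda k `^ (- m) * e1) * (C2 * Lambda k `^ (m - rho) * x ^+ M * e2).
  by rewrite ler_pM// !mulr_ge0// ltW.
have -> : x ^+ M * x ^+ M3 * y ^+ M3 * (Lambda k `^ t * (i * d)) =
   Lambda k `^ t * ((x ^+ M * x ^+ M3 * i) * (y ^+ M3 * d)) by ring.
apply: le_trans (ler_wpM2l (Lp t k) h1) _.
have -> : Lambda k `^ t * (D * Lambda k `^ (- m) * e1 * (C2 * Lambda k `^ (m - rho) * x ^+ M * e2)) =
   (D * C2 * e1 * e2 * x ^+ M) * Lambda k `^ (t - rho).
  have -> : t - rho = t + (- m + (m - rho)) by ring.
  by rewrite !Lambda_powRD; ring.
have F0 : 0 <= D * C2 * e1 * e2 * x ^+ M by rewrite !mulr_ge0// ltW.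
apply: le_trans (ler_wpM2l F0 hB) _.
have h2 : Lambda k `^ s <= C3 * Lambda p `^ s * (y ^+ M3 * x ^+ M3).
  by apply: le_trans hw _; rewrite ler_wpM2l// mulr_ge0// ltW.
apply: le_trans (ler_wpM2l F0 (ler_wpM2l B2_ge0 h2)) _.
by rewrite le_eqVlt; apply/orP; left; apply/eqP; ring.
Qed.

(** The identity [frozen_inverse] expresses [g k] by the frozen operator; replacing
    the frozen operator by the true one leaves a term in [f] and an error
    controlled by [freeze_error]. *)
Lemma regularity_bound (s t : R) f g : l2 f -> l2 g ->
  (forall k, f k = csum (fun l => entry sigma k l * g l)) ->
  t <= m -> t <= s + rho ->
  asum (fun k => (Lambda k `^ s * normc (g k)) ^+ 2) ->
  exists2 K, 0 <= K & forall k, R1 <= eucl k ->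
    Lambda k `^ t * normc (g k) <= K *
      (conv (fun l => normc (f l)) k + conv (conv (fun p => Lambda p `^ s * normc (g p))) k).
Proof.
move=> hf hg fE tm tsr hs; have [G G_ge0 hG] := l2_bounded hg.
have [K K_ge0 hK] := freeze_error tsr.
have [D D_ge0 hD] := inv_sigma_coef hLambda hsigma n_gt0 Cell_gt0 hell (2 * n + 0).
have [B B_ge0 hB] := Lambda_powR_mono tm.
have [C C_ge0 hC] := entry_decay0 hsigma n_gt0.
have [C' C'_ge0 hC'] := sigma_coef hsigma n_gt0 (2 * n + 0).
set h := fun p => Lambda p `^ s * normc (g p).
have h0 p : 0 <= h p by rewrite mulr_ge0 ?powR_ge0 ?normc_ge0.
have ch0 l : 0 <= conv h l by exact: conv_ge0.
have hch : asum (fun l => conv h l ^+ 2) by have [] := young h0 hs.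
have hf2 := (l2P f).1 hf.
exists (2 * (B * D + 2 * K)) => [|k hk]; first by rewrite mulr_ge0// addr_ge0 ?mulr_ge0.
pose fk l := csum (fun p => fcoef (sigma k) (p - l) * g p).
have inv1 l : normc (fcoef (inv_sigma k) (l - k)) <= D * Lambda k `^ (- m) * decay (k - l).
  by rewrite decayBC; have := le_decay (hD k (l - k) hk); rewrite expr0 mul1r.
have inv2 l : Lambda k `^ t * normc (fcoef (inv_sigma k) (l - k)) <= B * D * decay (k - l).
  apply: le_trans (ler_wpM2l (powR_ge0 _ t) (inv1 l)) _.
  rewrite -[leRHS]mulrA -(mulrA D) mulrCA (mulrCA B) ler_wpM2l// mulrA.
  rewrite ler_wpM2r ?decay_ge0//.
  have := ler_wpM2r (powR_ge0 (Lambda k) (- m)) (hB k).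
  by rewrite -[leRHS]mulrA -[X in _ <= _ * X]Lambda_powRD subrr powRr0 mulr1.
have err l : Lambda k `^ t * (normc (fcoef (inv_sigma k) (l - k)) * normc (f l - fk l))
    <= 2 * K * (decay (k - l) * conv h l).
  have s1 : asumc (fun p => entry sigma l p * g p).
    apply: (@asumc_entry_bounded _ _ _ _ (C * Lambda l `^ m) G l) => [p||//].
      exact: hC.
    by rewrite mulr_ge0 ?powR_ge0.
  have s2 : asumc (fun p => fcoef (sigma k) (p - l) * g p).
    apply: (@asumc_entry_bounded _ _ _ _ (C' * Lambda k `^ m) G l) => [p||//].
      by have := le_decay (hC' k (p - l)); rewrite expr0 mul1r.
    by rewrite mulr_ge0 ?powR_ge0.
  rewrite fE /fk -csumB//.
  have s3 : asumc (fun p => entry sigma l p * g p - fcoef (sigma k) (p - l) * g p).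
    by apply: asumcD => //; exact: asumcN.
  set i := normc (fcoef _ _); have i0 : 0 <= i by exact: normc_ge0.
  have L0t : 0 <= Lambda k `^ t * i by rewrite mulr_ge0 ?powR_ge0.
  rewrite mulrA; apply: le_trans (ler_wpM2l L0t (le_normc_csum s3)) _.
  rewrite mulrCA -mulrA ler_wpM2l// -rsumZ//.
  rewrite [K * _]mulrA -rsumZ; last exact: asum_conv.
  apply: ler_rsum; [|exact: asumZ|by apply: asumZ; exact: asum_conv].
  move=> p; rewrite -mulrBl normcM [leLHS]mulrA -(mulrA (_ `^ t)).
  apply: le_trans (ler_wpM2r (normc_ge0 _) (hK k l p hk)) _.
  by rewrite le_eqVlt; apply/orP; left; apply/eqP; rewrite /h; ring.
have bnd l : Lambda k `^ t * normc (fcoef (inv_sigma k) (l - k) * fk l) <=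
    B * D * (decay (k - l) * normc (f l)) + 2 * K * (decay (k - l) * conv h l).
  rewrite (_ : _ * fk l = fcoef (inv_sigma k) (l - k) * (f l - (f l - fk l))); last by rewrite subKr.
  rewrite normcM; set i := normc (fcoef _ _).
  have L0t : 0 <= Lambda k `^ t * i by rewrite mulr_ge0 ?powR_ge0 ?normc_ge0.
  rewrite mulrA; apply: le_trans (ler_wpM2l L0t (le_normcB _ _)) _.
  rewrite mulrDr lerD//; last by rewrite -[leLHS]mulrA; exact: err.
  by rewrite mulrA ler_wpM2r ?normc_ge0//; exact: inv2.
have S1 := asumZ (B * D) (asum_conv k hf2).
have S2 := asumZ (2 * K) (asum_conv k hch).
have Lt0 : 0 < Lambda k `^ t by rewrite powR_gt0.
have S0 : asumc (fun l => fcoef (inv_sigma k) (l - k) * fk l).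
  apply: asum_le (asumZ (Lambda k `^ t)^-1 (asumD S1 S2)) => l.
  by rewrite ger0_norm ?normc_ge0// [leRHS]mulrC ler_pdivlMr// [leLHS]mulrC; exact: bnd.
have := le_normc_csum S0; rewrite (frozen_inverse hLambda hsigma n_gt0 Cell_gt0 hell hg hk) => gk.
apply: le_trans (ler_wpM2l (ltW Lt0) gk) _.
rewrite mulrCA -!mulrA ler_wpM2l// -rsumZ//.
apply: (@le_trans _ _ (rsum (fun l => B * D * (decay (k - l) * normc (f l)) + 2 * K * (decay (k - l) * conv h l)))).
  by apply: ler_rsum => //; [exact: asumZ|exact: asumD].
rewrite (rsumD S1 S2) (rsumZ _ (asum_conv k hf2)) (rsumZ _ (asum_conv k hch)).
have c1 : 0 <= conv (fun l => normc (f l)) k by apply: conv_ge0 => l; exact: normc_ge0.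
have c2 : 0 <= conv (conv h) k by exact: conv_ge0.
rewrite -/(conv (fun l => normc (f l)) k) -/(conv (conv h) k).
move: c1 c2; set X := conv _ k; set Y := conv _ k => c1 c2.
rewrite -subr_ge0 (_ : _ - _ = B * D * Y + 2 * K * X); last by ring.
by rewrite addr_ge0 ?mulr_ge0.
Qed.

Lemma Lambda_bounded_low (t : R) : exists2 B, 0 <= B & forall k, eucl k < R1 -> Lambda k `^ t <= B.
Proof.
have [M [C C_ge0 hC]] := Lambda_poly hLambda t.
exists (C * (1 + n%:R * `|R1|) ^+ M) => [|k hk].
  by rewrite mulr_ge0// exprn_ge0// addr_ge0// mulr_ge0.
apply: le_trans (hC k) _; rewrite ler_wpM2l// lerXn2r ?nnegrE ?addr_ge0 ?mulr_ge0//.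
rewrite lerD2l; apply: le_trans (nrm_eucl k) _; rewrite ler_wpM2l//.
by apply: le_trans (ltW hk) _; exact: ler_norm.
Qed.

(** On the set where ellipticity says nothing, [eucl k < R1], the weight is
    bounded. *)
Lemma regularity_step (s t : R) f g : l2 f -> l2 g ->
  (forall k, f k = csum (fun l => entry sigma k l * g l)) ->
  t <= m -> t <= s + rho ->
  asum (fun k => (Lambda k `^ s * normc (g k)) ^+ 2) ->
  asum (fun k => (Lambda k `^ t * normc (g k)) ^+ 2).
Proof.
move=> hf hg fE tm tsr hs.
have [K K_ge0 hK] := regularity_bound hf hg fE tm tsr hs.
have [B B_ge0 hB] := Lambda_bounded_low t.
set h := fun p => Lambda p `^ s * normc (g p).
have h0 p : 0 <= h p by rewrite mulr_ge0 ?powR_ge0 ?normc_ge0.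
have [hch _] := young h0 hs.
have [hcch _] := young (fun l => conv_ge0 l h0) hch.
have [hcf _] := young (fun l => normc_ge0 (f l)) ((l2P f).1 hf).
have H := asum_sqrD (asum_sqrD hcf hcch) ((l2P g).1 hg).
apply: (asum_sqr_le _ H (c := K + B)) => k.
have g0 := normc_ge0 (g k).
have c1 : 0 <= conv (fun l => normc (f l)) k by apply: conv_ge0 => l; exact: normc_ge0.
have c2 : 0 <= conv (conv h) k by apply: conv_ge0 => l; exact: conv_ge0.
rewrite ger0_norm ?mulr_ge0 ?powR_ge0//.
have [hk|hk] := leP R1 (eucl k).
  apply: le_trans (hK k hk) _; rewrite -/h; apply: ler_pM => //.
  - by rewrite addr_ge0.
  - by rewrite lerDl.
  - by rewrite lerDl.
apply: (@le_trans _ _ (B * normc (g k))); first by rewrite ler_wpM2r//; exact: hB.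
apply: ler_pM => //; first by rewrite lerDr.
by rewrite lerDr addr_ge0.
Qed.

(** Each step gains [rho], so finitely many steps reach the order [m]; the first
    one starts from an order at most 0, where the weight is bounded. *)
Lemma regularity f g : 0 < rho -> l2 f -> l2 g ->
  (forall k, f k = csum (fun l => entry sigma k l * g l)) ->
  asum (fun k => (Lambda k `^ m * normc (g k)) ^+ 2).
Proof.
move=> rho_gt0 hf hg fE.
have H i : asum (fun k => (Lambda k `^ (Num.min m (i%:R * rho)) * normc (g k)) ^+ 2).
  elim: i => [|i ih].
    have m0 : Num.min m (0%:R * rho) <= 0 by rewrite mul0r ge_min lexx orbT.
    have [B B_gt0 hB] := Lambda_powR_neg hLambda m0.
    apply: (asum_sqr_le _ ((l2P g).1 hg) (c := B)) => k.
    by rewrite ger0_norm ?mulr_ge0 ?powR_ge0 ?normc_ge0// ler_wpM2r ?normc_ge0.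
  apply: (regularity_step hf hg fE _ _ ih); first by rewrite ge_min lexx.
  rewrite -natr1 mulrDl mul1r; have [h|h] := leP m (i%:R * rho).
    by rewrite ge_min; apply/orP; left; lra.
  by rewrite ge_min lexx orbT.
pose N := (Num.truncn (`|m| / rho)).+1.
have := H N; rewrite (min_idPl _)//.
have : `|m| / rho < N%:R.
  by have /andP[] := truncn_itv (divr_ge0 (normr_ge0 m) (ltW rho_gt0)).
rewrite ltr_pdivrMr// => h; apply: le_trans (ltW h); exact: ler_norm.
Qed.

End RegularityStep.

(** * Minimal and maximal operators *)

Section MinimalMaximal.
Context {R : realType} {n : nat}.
Variables (Lambda : 'rV[int]_n -> R) (mu0 mu1 mu C0 C1 : R).
Hypothesis hLambda : weight_function Lambda mu0 mu1 mu C0 C1.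
Variables (rho m : R) (sigma : 'rV[int]_n -> 'rV[R]_n -> R[i]).
Hypothesis hsigma : symbM Lambda rho m sigma.
Hypothesis n_gt0 : (0 < n)%N.
Implicit Types (f g : 'rV[int]_n -> R[i]) (k l : 'rV[int]_n).
Let L0 k : 0 < Lambda k. Proof. exact: Lambda_gt0 hLambda k. Qed.

(** The formal adjoint relation for the approximating sequence passes to the
    limit. *)
Lemma minimal_sub_maximal : (minimal_op sigma `<=` maximal_op sigma)%classic.
Proof.
move=> [g f] [/= hg hf [phi [sphi cg cf]]]; split => //= psi spsi.
have [sA adj] := formal_adjointP hLambda hsigma n_gt0.
set A := formal_adjoint (pdo sigma) in sA adj *.
have hpsi : l2 psi by apply/l2P; exact: schwartz_l2.
have hA : l2 (A psi) by apply/l2P; apply: schwartz_l2; exact: sA.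
suff H (e : R) : 0 < e -> normc (l2inner g (A psi) - l2inner f psi) <= e.
  have : normc (l2inner g (A psi) - l2inner f psi) <= 0.
    by apply/ler_addgt0Pr => e e0; rewrite add0r; exact: H.
  by rewrite le_eqVlt ltNge normc_ge0 orbF => /eqP/eq0_normc/eqP; rewrite subr_eq0 => /eqP.
move=> e0; have e20 : 0 < e / 2 by rewrite divr_gt0.
have [d1 d10 h1] := inner_small hA e20; have [d2 d20 h2] := inner_small hpsi e20.
have [N1 hN1] := (l2cvgP _ _).1 cg d1 d10; have [N2 hN2] := (l2cvgP _ _).1 cf d2 d20.
pose j := maxn N1 N2.
have j1 := hN1 j (leq_maxl _ _); have j2 := hN2 j (leq_maxr _ _).
have hphi : l2 (phi j) by apply/l2P; exact: schwartz_l2.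
have hT : l2 (pdo sigma (phi j)).
  have hd : l2 (fun k => pdo sigma (phi j) k - f k).
    by apply: le_lt_trans j2 _; exact: ltry.
  apply/l2P; apply: (@asum_sqr_le _ _ _ (fun k => normc (pdo sigma (phi j) k - f k) + normc (f k)) 1).
    move=> k; rewrite ger0_norm ?normc_ge0// mul1r.
    by apply: le_trans (le_normcD _ _); rewrite subrK.
  by apply: asum_sqrD; [exact: (l2P _).1 hd|exact: (l2P _).1 hf].
have := h1 _ j1; have := h2 _ j2.
rewrite !l2innerB// adj// => b2 b1.
set x := l2inner g _ in b1 *; set y := l2inner f psi in b2 *.
set z := l2inner (phi j) _ in b1 b2.
have -> : x - y = (z - y) - (z - x) by ring.
by apply: le_trans (le_normcB _ _) _; lra.
Qed.

(** The decay off the diagonal absorbs the polynomial factor that [Lambda_powR]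
    costs for moving the weight from [k] to [l]. *)
Lemma entry_decay_r : exists2 C, 0 <= C & forall k l,
  normc (entry sigma k l) <= C * (decay (k - l) * Lambda l `^ m).
Proof.
have [M [B B_gt0 hB]] := Lambda_powR hLambda m.
have [C C_ge0 hC] := entry_decay hsigma n_gt0 M.
exists (C * B) => [|k l]; first by rewrite mulr_ge0// ltW.
have q0 : 0 < (1 + (nrm (l - k))%:R : R) ^+ M by rewrite exprn_gt0// ltr_wpDr.
rewrite -(ler_pM2l q0); apply: le_trans (hC k l) _.
have := hB l k; rewrite nrmBC decayBC => h.
have := ler_wpM2l (mulr_ge0 C_ge0 (decay_ge0 (R := R) (k - l))) h.
rewrite (decayBC k l) => H; rewrite mulrAC; apply: le_trans H _.
by rewrite le_eqVlt; apply/orP; left; apply/eqP; ring.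
Qed.

Lemma invn_small (d : R) : 0 < d -> exists N, forall j, (N <= j)%N -> j.+1%:R^-1 <= d.
Proof.
move=> d0; exists (Num.truncn d^-1) => j Nj.
have d10 : 0 <= d^-1 by rewrite invr_ge0 ltW.
have /andP[_ h] := truncn_itv d10.
rewrite -[leRHS]invrK lef_pV2 ?posrE ?invr_gt0//.
by apply: le_trans (ltW h) _; rewrite ler_nat ltnS.
Qed.

Variables (Cell R1 : R).
Hypothesis Cell_gt0 : 0 < Cell.
Hypothesis hell : forall k x, R1 <= eucl k -> Cell * Lambda k `^ m <= normc (sigma k x).
Hypothesis rho_gt0 : 0 < rho.

(** By regularity, truncations of [g] converge to [g] with the weight
    [Lambda `^ m], for which the operator is bounded. *)
Lemma maximal_sub_minimal : (maximal_op sigma `<=` minimal_op sigma)%classic.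
Proof.
move=> [g f] hgf; have [/= hg hf _] := hgf; split => //=.
have fE k := maximal_entry hLambda hsigma n_gt0 k hgf.
have reg := regularity hLambda hsigma n_gt0 Cell_gt0 hell rho_gt0 hf hg fE.
have hg2 := (l2P g).1 hg.
have Htot := asumD hg2 reg.
have [F hF] := choice (fun j : nat => asum_tail Htot (e := j.+1%:R^-1) (ltac:(by rewrite invr_gt0))).
pose phi j k := if k \in F j then g k else 0.
have sphi j : schwartz (phi j).
  by apply: (@schwartz_fset _ _ (F j)) => k /negbTE kF; rewrite /phi kF.
pose r j k := normc (phi j k - g k).
have r_out j k : r j k = if k \in F j then 0 else normc (g k).
  by rewrite /r /phi; case: ifP => _; rewrite ?subrr ?normc0// sub0r normcN.
have tot0 k : 0 <= normc (g k) ^+ 2 + (Lambda k `^ m * normc (g k)) ^+ 2.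
  by rewrite addr_ge0 ?sqr_ge0.
have Atail j : asum (fun k => if k \in F j then 0 else
    `|normc (g k) ^+ 2 + (Lambda k `^ m * normc (g k)) ^+ 2|).
  apply: asum_le (asum_abs Htot) => k; case: ifP => _; first by rewrite normr0.
  by rewrite normr_id.
have r1 j : asum (fun k => r j k ^+ 2) /\ rsum (fun k => r j k ^+ 2) <= j.+1%:R^-1.
  have le1 k : r j k ^+ 2 <= if k \in F j then 0 else
      `|normc (g k) ^+ 2 + (Lambda k `^ m * normc (g k)) ^+ 2|.
    by rewrite r_out; case: ifP => _; [rewrite expr0n|rewrite ger0_norm// lerDl sqr_ge0].
  have A1 : asum (fun k => r j k ^+ 2).
    by apply: asum_le (Atail j) => k; rewrite ger0_norm ?sqr_ge0.
  by split => //; apply: le_trans (hF j); exact: ler_rsum.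
have r2 j : asum (fun k => (Lambda k `^ m * r j k) ^+ 2) /\
    rsum (fun k => (Lambda k `^ m * r j k) ^+ 2) <= j.+1%:R^-1.
  have le1 k : (Lambda k `^ m * r j k) ^+ 2 <= if k \in F j then 0 else
      `|normc (g k) ^+ 2 + (Lambda k `^ m * normc (g k)) ^+ 2|.
    by rewrite r_out; case: ifP => _; [rewrite mulr0 expr0n|rewrite ger0_norm// lerDr sqr_ge0].
  have A1 : asum (fun k => (Lambda k `^ m * r j k) ^+ 2).
    by apply: asum_le (Atail j) => k; rewrite ger0_norm ?sqr_ge0.
  by split => //; apply: le_trans (hF j); exact: ler_rsum.
exists phi; split => //.
  apply/l2cvgP => d d0; have [N hN] := invn_small d0; exists N => j Nj.
  have [A1 B1] := r1 j.
  rewrite l2sqE// lee_fin; exact: le_trans B1 (hN j Nj).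
have [C C_ge0 hC] := entry_decay_r.
have [G G_ge0 hG] := l2_bounded hg.
have [C' C'_ge0 hC'] := entry_decay0 hsigma n_gt0.
set S := rsum (@decay R n).
have S0 : 0 <= S by apply: rsum_ge0 => k; exact: decay_ge0.
pose K := (2 * C) ^+ 2 * S ^+ 2 + 1.
have K0 : 0 < K by rewrite ltr_wpDl// mulr_ge0 ?sqr_ge0.
apply/l2cvgP => d d0; have [N hN] := invn_small (divr_gt0 d0 K0); exists N => j Nj.
have [A2 B2] := r2 j.
set h := fun l => Lambda l `^ m * r j l.
have h0 l : 0 <= h l by rewrite mulr_ge0 ?powR_ge0 ?normc_ge0.
have bnd k : normc (pdo sigma (phi j) k - f k) <= 2 * C * conv h k.
  have sm u : (forall l, normc (u l) <= G) -> asumc (fun l => entry sigma k l * u l).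
    move=> hu; apply: (@asumc_entry_bounded _ _ _ _ (C' * Lambda k `^ m) G k) => [l||//].
      exact: hC'.
    by rewrite mulr_ge0 ?powR_ge0.
  have hphiG l : normc (phi j l) <= G by rewrite /phi; case: ifP; rewrite ?normc0.
  have s1 := sm _ hG; have s2 := sm _ hphiG.
  rewrite (pdo_entry hsigma n_gt0)// fE -csumB//.
  have s3 : asumc (fun l => entry sigma k l * phi j l - entry sigma k l * g l).
    by apply: asumcD => //; exact: asumcN.
  apply: le_trans (le_normc_csum s3) _; rewrite -mulrA ler_wpM2l//.
  have ac := asum_conv k A2; rewrite -/h in ac.
  rewrite /conv -(rsumZ C ac); apply: ler_rsum => //; last exact: asumZ.
  move=> l; rewrite -mulrBr normcM -/(r j l).
  apply: le_trans (ler_wpM2r (normc_ge0 _) (hC k l)) _.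
  by rewrite le_eqVlt; apply/orP; left; apply/eqP; rewrite /h /r; ring.
have [Y1 Y2] := young h0 A2.
have bnd2 k : normc (pdo sigma (phi j) k - f k) ^+ 2 <= (2 * C) ^+ 2 * conv h k ^+ 2.
  rewrite -exprMn lerXn2r// ?nnegrE ?normc_ge0// mulr_ge0 ?mulr_ge0//.
  exact: conv_ge0.
have A3 : asum (fun k => normc (pdo sigma (phi j) k - f k) ^+ 2).
  by apply: asum_le (asumZ ((2 * C) ^+ 2) Y1) => k; rewrite ger0_norm ?sqr_ge0.
rewrite l2sqE// lee_fin.
apply: le_trans (ler_rsum bnd2 A3 (asumZ _ Y1)) _; rewrite rsumZ//.
have c0 : 0 <= (2 * C) ^+ 2 by exact: sqr_ge0.
apply: le_trans (ler_wpM2l c0 Y2) _; rewrite mulrA -/S.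
have e1 : rsum (fun l => h l ^+ 2) <= d / K by apply: le_trans B2 (hN j Nj).
have KS : 0 <= (2 * C) ^+ 2 * S ^+ 2 by rewrite mulr_ge0 ?sqr_ge0.
apply: le_trans (ler_wpM2l KS e1) _.
rewrite mulrCA ler_piMr ?(ltW d0)// ler_pdivrMr// mul1r.
by rewrite /K lerDl.
Qed.

End MinimalMaximal.

Theorem theorem5p18 (R : realType) (n : nat) (n_gt0 : (0 < n)%N)
    (Lambda : 'rV[int]_n -> R) (mu0 mu1 mu C0 C1 : R)
    (hLambda : weight_function Lambda mu0 mu1 mu C0 C1)
    (rho : R) (rho_gt0 : 0 < rho) (rho_le : rho <= 1 / mu)
    (m : R) (sigma : 'rV[int]_n -> 'rV[R]_n -> complex R)
    (hsigma : symbM Lambda rho m sigma)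
    (hell : M_elliptic Lambda m sigma) :
  minimal_op sigma = maximal_op sigma.
Proof.
have [C [R1 [C_gt0 _ hC]]] := hell.
apply/seteqP; split.
  exact: (minimal_sub_maximal hLambda hsigma n_gt0).
exact: (maximal_sub_minimal hLambda hsigma n_gt0 C_gt0 hC rho_gt0).
Qed.
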